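(* Let $P_{\theta}$ belong to an exponential family with per-position natural parameters (see context) and suppose that for each $t$ the Fisher information matrix $\bar F_t$ is positive definite at the base model. For small $\lambda,\mu$, let $\theta^*$ be the minimizer of $$\mathcal H_{\mathrm{deep}}(\theta)=\lambda\,\mathbb{E}_{y\sim P_\theta}[\mathrm{Harm}(y)]+\mu\,\mathbb{E}_{y\sim Q}\Big[\sum_{t=1}^T\gamma^{t-1}\mathrm{Fail}_t(\theta,y_{<t})\Big]+D_{\mathrm{KL}}(P_\theta\|P_{\mathrm{base}}).$$ Then $$D_{\mathrm{KL}}^{(t)}(\theta^* )=\tfrac12\big\|\lambda G_t+\mu\gamma^{t-1}\tilde G_t\big\|^2_{\bar F_t^{-1}}+O\big((\lambda+\mu)^3\big),$$ where $\|v\|_M^2:=v^\top Mv$. In particular: (i) For $t>k$, where $k$ is the harm horizon (i.e. beyond the harm horizon), $G_t=0$, so $$D_{\mathrm{KL}}^{(t)}(\theta^* )=\frac{\mu^2\gamma^{2(t-1)}}{2}\|\tilde G_t\|^2_{\bar F_t^{-1}}+O(\mu^3).$$ This is generically positive wherever $Q$ has support and the recovery information satisfies $J_t>0$. (ii) Setting $\mu=0$ gives $D_{\mathrm{KL}}^{(t)}(\theta^* )=O(\lambda^2I_t)$.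
   Context: Let $\mathcal V$ be a vocabulary (finite set of tokens) and $T\ge1$. $P_\theta$ is a distribution on $y=(y_1,\dots,y_T)\in\mathcal V^T$ with $P_\theta(y)=\prod_{t=1}^TP_\theta(y_t\mid y_{<t})$, $y_{<t}=(y_1,\dots,y_{t-1})$, $y_{\le t}=(y_1,\dots,y_t)$. $P_{\mathrm{base}}=P_{\theta_{\mathrm{base}}}$ is a fixed base model in the family. $\mathrm{Harm}$ is a fixed function from complete sequences to $[0,1]$. Exponential family with per-position natural parameters: $\theta=(\theta_1,\dots,\theta_T)$ and the conditional $P_\theta(\cdot\mid y_{<t})$ at position $t$ is an exponential family with natural parameter $\theta_t$, not depending on $\theta_s$ for $s\neq t$. $\mathcal R\subset\mathcal V$ is a set of recovery tokens, and $\mathrm{Fail}_t(\theta,y_{<t}):=1-P_\theta(y_t\in\mathcal R\mid y_{<t})$. $Q$ is a fixed distribution on sequences (the adversarial prefix distribution), not depending on $\theta$; $\gamma\in(0,1]$ is a discount factor; $\lambda>0$ and $\mu>0$ are penalty strengths ($\mu=0$ is allowed in (ii)). $h_t(y_{\le t}):=\mathbb{E}_{P_\theta}[\mathrm{Harm}(y)\mid y_{\le t}]$, $h_0=\mathbb{E}[\mathrm{Harm}]$, and the harm information is $I_t:=\mathbb{E}[(h_t-h_{t-1})^2]$. The harm horizon $k$ is the smallest $k$ such that $I_t=0$ for all $t>k$ (equivalently, $\mathrm{Harm}(y)$ is almost surely a function of $y_{\le k}$). Recovery information: $J_t(\theta):=\mathbb{E}_{y_{<t}\sim Q}[p_t(1-p_t)]$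 with $p_t:=P_\theta(y_t\in\mathcal R\mid y_{<t})$. Harm gradient: $G_t(\theta):=\mathbb{E}_{y_{<t}\sim P_\theta}\big[\mathrm{Cov}_{y_t\mid y_{<t}}(h_t,\nabla_\theta\log P_\theta(y_t\mid y_{<t}))\big]$. Recovery gradient: $\tilde G_t(\theta):=-\mathbb{E}_{y_{<t}\sim Q}\big[\mathrm{Cov}_{y_t\mid y_{<t}}(\mathbf 1[y_t\in\mathcal R],\nabla_\theta\log P_\theta(y_t\mid y_{<t}))\big]$. Here $y_t\sim P_\theta(\cdot\mid y_{<t})$ in the covariances. Fisher information: $\bar F_t(\theta):=\mathbb{E}_{y_{<t}\sim P_\theta}\mathbb{E}_{y_t\mid y_{<t}}[\nabla_\theta\log P_\theta(y_t\mid y_{<t})\nabla_\theta\log P_\theta(y_t\mid y_{<t})^\top]$. Gradients at position $t$ are with respect to the position-$t$ parameter $\theta_t$, and in the claim $G_t,\tilde G_t,\bar F_t,I_t,J_t$ are evaluated at $\theta_{\mathrm{base}}$. The per-position KL divergence is $D_{\mathrm{KL}}^{(t)}(\theta):=\mathbb{E}_{y_{<t}\sim P_\theta}[D_{\mathrm{KL}}(P_\theta(\cdot\mid y_{<t})\|P_{\mathrm{base}}(\cdot\mid y_{<t}))]$. ''Generically'' is meant in the sense that $\tilde G_t=0$ despite $J_t>0$ would require the score function to be orthogonal to the recovery indicator conditional on every prefix, which is regarded as a non-generic condition of measure zero in parameter space.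
   Formalization: In (i) the error is O(μ²(λ+μ)), and O(μ³) only when λ ≤ cμ; the exceptional set (J_t>0 but G̃_t=0) is null only if G̃_t is not identically zero; in (ii) O(λ²I_t) is claimed only if I_t>0 or t>k, otherwise λ²I_t/2+O(λ³). *)

(* Defs.v *)
From mathcomp Require Import all_boot all_order all_algebra.
From mathcomp Require Import all_classical all_reals all_analysis.

Set Implicit Arguments.
Unset Strict Implicit.
Unset Printing Implicit Defensive.

Import Order.TTheory GRing.Theory Num.Theory.
Import numFieldNormedType.Exports.

Local Open Scope classical_set_scope.
Local Open Scope ring_scope.

(* Positions are numbered from 0: the index t : 'I_T is the (t+1)-st position
   of the sequence y : T.-tuple V.  Hence y_{<t} is [take t y] (length t), the
   token at t is [tnth y t], y_{<=t} is [take t.+1 y] (or [rcons s v] for a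
   prefix s extended by v), and the discount of position t is gamma ^+ t.

   An expectation over prefixes y_{<t} drawn from a law P on full sequences is
   written as the expectation over y of a function of [take t y]. *)

Section FiniteLaws.
Context {R : realType} {A : finType}.
Implicit Types p q : A -> R.

Definition is_dist p := (forall a, 0 <= p a) /\ \sum_a p a = 1.

Definition expect p (f : A -> R) : R := \sum_a p a * f a.

Definition vexpect (U : lmodType R) p (f : A -> U) : U := \sum_a p a *: f a.

Definition vcov (U : lmodType R) p (f : A -> R) (g : A -> U) : U :=
  vexpect p (fun a => f a *: g a) - expect p f *: vexpect p g.

(* Terms with p a = 0 vanish.  This real-valued formula is the divergence only
   when q a = 0 implies p a = 0, which always holds between two members of one
   exponential family, since they share their support. *)
Definition kl p q : R := \sum_a p a * ln (p a / q a).

End FiniteLaws.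

Section Calculus.
Context {R : realType}.

Definition dotv n (u v : 'rV[R]_n) : R := \sum_(i < n) u 0 i * v 0 i.

Definition grad n (f : 'rV[R]_n -> R) (x : 'rV[R]_n) : 'rV[R]_n :=
  \row_(i < n) 'D_(delta_mx 0 i) f x.

Definition qform n (M : 'M[R]_n) (v : 'rV[R]_n) : R := (v *m M *m v^T) 0 0.

(* Only used for symmetric matrices. *)
Definition posdef n (M : 'M[R]_n) := forall v, v != 0 -> 0 < qform M v.

(* Lebesgue-null subsets of R^n: for every e > 0, A is covered by countably
   many boxes of total volume at most e. *)
Definition lebesgue_null n (A : set 'rV[R]_n) :=
  forall e : R, 0 < e ->
    exists a b : nat -> 'rV[R]_n,
      [/\ forall m i, a m 0 i <= b m 0 i,
          forall x, A x ->
            exists m, forall i, a m 0 i <= x 0 i <= b m 0 i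
        & forall N : nat,
            \sum_(m < N) \prod_(i < n) (b m 0 i - a m 0 i) <= e].

End Calculus.

Definition is_minimizer (R : realType) (X : Type) (f : X -> R) (x : X) :=
  forall z, f x <= f z.

(* The position-t conditional given the prefix s is the exponential family on V
   with carrier measure [carrier t s], sufficient statistic [stat t s] and
   natural parameter theta_t in R^(d t).  V being finite, the natural parameter
   space is all of R^(d t).  The carrier may vanish on some tokens. *)
Record seq_exp_family (R : realType) (V : finType) (T : nat)
    (d : 'I_T -> nat) := SeqExpFamily {
  stat : forall t : 'I_T, seq V -> V -> 'rV[R]_(d t);
  carrier : 'I_T -> seq V -> V -> R;
  carrier_ge0 : forall t s v, 0 <= carrier t s v;
  carrier_neq0 : forall t s, exists v, 0 < carrier t s v }.

Definition params (R : realType) (T : nat) (d : 'I_T -> nat) :=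
  forall t : 'I_T, 'rV[R]_(d t).

Section Model.
Context {R : realType} {V : finType} {T : nat} {d : 'I_T -> nat}.
Context (E : seq_exp_family R V d).
Implicit Types (t : 'I_T) (s : seq V) (y : T.-tuple V) (th thb : params R d).

Definition weight t (x : 'rV[R]_(d t)) s (v : V) : R :=
  carrier E t s v * expR (dotv x (stat E t s v)).

(* P_theta(v | s) at position t, as a function of x = theta_t alone. *)
Definition cond t (x : 'rV[R]_(d t)) s (v : V) : R :=
  weight x s v / \sum_w weight x s w.

Definition law th y : R :=
  \prod_(t < T) cond (th t) (take t y) (tnth y t).

(* On a token outside the support of the conditional, [ln 0 = 0] makes the score
   0; such tokens always have weight 0 below. *)
Definition score t (x : 'rV[R]_(d t)) s (v : V) : 'rV[R]_(d t) :=
  grad (fun z => ln (cond z s v)) x.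

Definition fisher th t : 'M[R]_(d t) :=
  vexpect (law th) (fun y =>
    vexpect (cond (th t) (take t y)) (fun v =>
      (score (th t) (take t y) v)^T *m score (th t) (take t y) v)).

Definition posKL thb th t : R :=
  expect (law th) (fun y =>
    kl (cond (th t) (take t y)) (cond (thb t) (take t y))).

Section Harm.
Context (Harm : T.-tuple V -> R).

(* E[Harm(y) | y starts with s], which is 0 / 0 = 0 for s of probability 0. *)
Definition harm_cond th s : R :=
  (\sum_(y : T.-tuple V | take (size s) y == s) law th y * Harm y) /
  (\sum_(y : T.-tuple V | take (size s) y == s) law th y).

Definition harm_info th t : R :=
  expect (law th) (fun y =>
    (harm_cond th (take t.+1 y) - harm_cond th (take t y)) ^+ 2).

(* In the 0-based numbering, "position > k" reads k <= t. *)
Definition is_harm_horizon th (k : nat) :=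
  (forall t, (k <= t)%N -> harm_info th t = 0) /\
  (forall k', (forall t, (k' <= t)%N -> harm_info th t = 0) -> (k <= k')%N).

Definition harm_grad th t : 'rV[R]_(d t) :=
  vexpect (law th) (fun y =>
    vcov (cond (th t) (take t y))
      (fun v => harm_cond th (rcons (take t y) v))
      (score (th t) (take t y))).

End Harm.

Section Recovery.
Context (Rec : {set V}) (Q : T.-tuple V -> R).

Definition rec_prob t (x : 'rV[R]_(d t)) s : R := \sum_(v in Rec) cond x s v.

Definition fail t (x : 'rV[R]_(d t)) s : R := 1 - rec_prob x s.

(* These depend on theta only through x = theta_t. *)
Definition rec_info t (x : 'rV[R]_(d t)) : R :=
  expect Q (fun y => rec_prob x (take t y) * (1 - rec_prob x (take t y))).

Definition rec_grad t (x : 'rV[R]_(d t)) : 'rV[R]_(d t) :=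
  - vexpect Q (fun y =>
      vcov (cond x (take t y)) (fun v => (v \in Rec)%:R)
        (score x (take t y))).

End Recovery.

Definition H_deep (thb : params R d) (Harm : T.-tuple V -> R) (Rec : {set V})
    (Q : T.-tuple V -> R) (gamma lam mu : R) th : R :=
  lam * expect (law th) Harm
  + mu * expect Q (fun y =>
      \sum_(t < T) gamma ^+ t * fail Rec (th t) (take t y))
  + kl (law th) (law thb).

End Model.

(* Main.v *)
(* All parameters live at separate positions, so [H_deep] is only ever
   differentiated in one [th t] at a time.  At a minimizer the resulting equation
   reads [(th t - thb t) *m F_t = - (lam G_t + mu gamma ^+ t Gr_t) - remainder],
   where the remainder is Lipschitz with a small constant near [thb]; hence
   minimizers near [thb] are unique, at distance O(lam + mu), and the expansion
   follows from that of the relative entropy.  All minimizers are near [thb]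
   because the divergence is nondecreasing along rays in each [th t] and blocks
   before [t] are not affected by moving [th t].  Beyond the harm horizon the harm
   depends on the first [k] tokens only and, as scores have mean zero given the
   prefix, the remainder at [t] involves only positions [>= t]; this gives
   [th t - thb t = O(mu)].  The bound by the harm information is Cauchy-Schwarz.
   Finally [rec_grad] is a quotient of exponential sums in [x], and the zeros of
   a nonzero exponential sum lie in countably many pieces where some derivative
   vanishes but one of its partial derivatives does not. *)

Require Import Defs.
From mathcomp Require Import all_boot all_order all_algebra.
From mathcomp Require Import all_classical all_reals all_analysis.
From mathcomp Require Import ring lra.

Set Implicit Arguments.
Unset Strict Implicit.
Unset Printing Implicit Defensive.

Import Order.TTheory GRing.Theory Num.Theory.
Import numFieldNormedType.Exports.

Local Open Scope ring_scope.

(** * Calculus and row vectors *)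

(** The divergence is not a sum of functions of separate blocks: moving [th t] changes the law of
    all later prefixes. That cross effect ([kl_dir]) is an average of a score times a relative
    entropy, hence of second order at [thb], so the linearized system is block diagonal with the
    Fisher matrices on its diagonal. The predicate [flat] records the order of vanishing together
    with a Lipschitz constant, and such facts then follow by adding orders in products. The Fisher
    matrices are assumed definite only at [thb] and the objective need not be convex. Far from [thb]
    only values are compared, with the value at [thb] as the benchmark; existence of a minimizer
    comes from compactness of the unit ball around [thb]. An error of order [(lam + mu) ^+ 3] is too
    coarse past the horizon, where a factor [mu ^+ 2] is wanted. Hence the estimates keep apart the
    size of the block at [t], of the gradient vector and of the residual of the linear equation, and
    the equations past the horizon are solved as a system of their own. *)

Section RealCalculus.
Context {R : realType}.
Implicit Types (f g : R -> R) (x y d e : R).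
Local Open Scope classical_set_scope.
Local Open Scope ring_scope.

Lemma isd_cst (a x : R) : is_derive x (1 : R) (fun _ : R => a) 0.
Proof. exact: is_derive_cst. Qed.

Lemma isdD f g x d e : is_derive x 1 f d -> is_derive x 1 g e ->
  is_derive x 1 (fun r => f r + g r) (d + e).
Proof. exact: is_deriveD. Qed.

Lemma isdB f g x d e : is_derive x 1 f d -> is_derive x 1 g e ->
  is_derive x 1 (fun r => f r - g r) (d - e).
Proof. exact: is_deriveB. Qed.

Lemma isdM f g x d e : is_derive x 1 f d -> is_derive x 1 g e ->
  is_derive x 1 (fun r => f r * g r) (d * g x + f x * e).
Proof.
move=> df dg; apply: is_derive_eq (is_deriveM df dg) _.
by rewrite /GRing.scale/= addrC [g x * d]mulrC.
Qed.

Lemma isdZ f (a x d : R) : is_derive x 1 f d ->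
  is_derive x 1 (fun r => a * f r) (a * d).
Proof. exact: is_deriveZ. Qed.

Lemma isd_sum (I : Type) (r : seq I) (P : pred I) (F : I -> R -> R)
    (D : I -> R) x :
  (forall i, is_derive x 1 (F i) (D i)) ->
  is_derive x 1 (fun z => \sum_(i <- r | P i) F i z) (\sum_(i <- r | P i) D i).
Proof.
move=> h; elim: r => [|i r ih].
  rewrite big_nil (_ : (fun _ => _) = fun=> 0); first exact: isd_cst.
  by apply/funext => z; rewrite big_nil.
rewrite big_cons (_ : (fun _ => _) = fun z =>
  if P i then F i z + \sum_(i <- r | P i) F i z
  else \sum_(i <- r | P i) F i z); last by apply/funext => z; rewrite big_cons.
by case: ifP => _ //; apply: isdD.
Qed.

Lemma isd_affine (a b x : R) : is_derive x 1 (fun r => a + r * b) b.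
Proof.
have := isdD (isd_cst a x) (isdM (@is_derive_id R _ x 1) (isd_cst b x)).
by move/is_derive_eq; apply; rewrite add0r mul1r mulr0 addr0.
Qed.

Lemma isd_expR f x d : is_derive x 1 f d ->
  is_derive x 1 (fun r => expR (f r)) (d * expR (f x)).
Proof.
by move=> df; apply: is_derive_eq (is_derive1_comp (is_derive_expR _) df) _;
  rewrite mulrC.
Qed.

Lemma isd_ln f x d : 0 < f x -> is_derive x 1 f d ->
  is_derive x 1 (fun r => ln (f r)) (d / f x).
Proof.
by move=> fx df; apply: is_derive_eq (is_derive1_comp (is_derive1_ln fx) df) _;
  rewrite mulrC.
Qed.

Lemma isd_inv f x d : f x != 0 -> is_derive x 1 f d ->
  is_derive x 1 (fun r => (f r)^-1) (- (d / f x ^+ 2)).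
Proof.
move=> fx df; apply: is_derive_eq (is_deriveV fx df) _.
by rewrite /GRing.scale/= mulNr mulrC.
Qed.

Lemma isd_continuous f f' : (forall x, is_derive x 1 f (f' x)) -> continuous f.
Proof.
by move=> h x; apply/differentiable_continuous/derivable1_diffP; case: (h x).
Qed.

Lemma isd_MVT f f' : (forall x, is_derive x 1 f (f' x)) ->
  exists2 c : R, 0 <= c <= 1 & f 1 - f 0 = f' c.
Proof.
move=> h.
have cf : {within `[0, 1], continuous f}.
  by apply: continuous_subspaceT; exact: isd_continuous h.
have [c] := @MVT_segment R f f' 0 1 ler01 (fun x _ => h x) cf.
by rewrite in_itv/= => c01; rewrite subr0 mulr1; exists c.
Qed.

Lemma isd_lip f f' C : (forall x, is_derive x 1 f (f' x)) ->
  (forall x, 0 <= x <= 1 -> `|f' x| <= C) -> `|f 1 - f 0| <= C.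
Proof. by move=> h b; have [c c01 ->] := isd_MVT h; exact: b. Qed.

Lemma isd_nondecr f f' : (forall x, is_derive x 1 f (f' x)) ->
  (forall x, 0 <= x -> 0 <= f' x) -> forall x y, 0 <= x -> x <= y -> f x <= f y.
Proof.
move=> h f0 x y x0 xy; rewrite -subr_ge0.
have cf : {within `[x, y], continuous f}.
  by apply: continuous_subspaceT; exact: isd_continuous h.
have [c] := @MVT_segment R f f' x y xy (fun x _ => h x) cf.
rewrite in_itv/= => /andP[xc _] ->.
by rewrite mulr_ge0 ?subr_ge0 ?f0// (le_trans x0).
Qed.

Lemma isd_min f d : is_derive (0 : R) 1 f d -> (forall x, derivable f x 1) ->
  (forall x, f 0 <= f x) -> d = 0.
Proof.
move=> fd df fmin.
have [_ <-] : is_derive (0 : R) 1 f 0.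
  have h11 : (-1 : R) <= 1 by lra.
  have h0 : (0 : R) \in `]-1, 1[%R.
    by rewrite in_itv/= ltrN10 ltr01.
  exact: derive1_at_min h11 (fun t _ => df t) h0 (fun t _ => fmin t).
by case: fd.
Qed.

(** The sum of the individual constants serves, as each property survives enlarging its constant.
    Repeated use turns bounds per token, coordinate or position into a single constant. *)
Lemma uniform_bound (I : finType) (P : I -> R -> Prop) :
  (forall i C C', C <= C' -> P i C -> P i C') ->
  (forall i, exists2 C : R, 0 <= C & P i C) ->
  exists2 C : R, 0 <= C & forall i, P i C.
Proof.
move=> mono h.
have /choice[c hc] : forall i, exists C : R, 0 <= C /\ P i C.
  by move=> i; case: (h i) => C; exists C.
have c0 i : 0 <= c i by case: (hc i).
exists (\sum_i c i) => [|i]; first exact: sumr_ge0.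
by apply: mono (proj2 (hc i)); rewrite (bigD1 i)//= lerDl sumr_ge0.
Qed.

End RealCalculus.

Section Vectors.
Context {R : realType}.

Definition norm1 n (v : 'rV[R]_n) : R := \sum_i `|v 0 i|.

Section fixed_dim.
Context {n : nat}.
Implicit Types u v w : 'rV[R]_n.

Lemma norm1_ge0 v : 0 <= norm1 v. Proof. exact: sumr_ge0. Qed.

Lemma norm10 : norm1 (0 : 'rV[R]_n) = 0.
Proof. by rewrite /norm1 big1// => i _; rewrite mxE normr0. Qed.

Lemma norm1D u v : norm1 (u + v) <= norm1 u + norm1 v.
Proof. by rewrite -big_split/=; apply: ler_sum => i _; rewrite mxE ler_normD. Qed.

Lemma norm1Z a v : norm1 (a *: v) = `|a| * norm1 v.
Proof. by rewrite mulr_sumr; apply: eq_bigr => i _; rewrite mxE normrM. Qed.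

Lemma norm1_coord v i : `|v 0 i| <= norm1 v.
Proof. by rewrite /norm1 (bigD1 i)//= lerDl sumr_ge0. Qed.

Lemma norm1_dist u v : `|norm1 u - norm1 v| <= norm1 (u - v).
Proof.
rewrite -sumrB; apply: le_trans (ler_norm_sum _ _ _) _.
by apply: ler_sum => i _; rewrite !mxE ler_dist_dist.
Qed.

Lemma norm1_eq0 v : norm1 v <= 0 -> v = 0.
Proof.
move=> h; apply/rowP => i; rewrite mxE; apply/eqP; rewrite -normr_le0.
exact: le_trans (norm1_coord v i) h.
Qed.

Lemma norm1_le v C : (forall i, `|v 0 i| <= C) -> norm1 v <= n%:R * C.
Proof.
move=> h; apply: le_trans (ler_sum _ (fun i _ => h i)) _.
by rewrite sumr_const card_ord mulr_natl.
Qed.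

Lemma dotvDl u v w : dotv (u + v) w = dotv u w + dotv v w.
Proof. by rewrite -big_split/=; apply: eq_bigr => i _; rewrite mxE mulrDl. Qed.

Lemma dotvZl a u w : dotv (a *: u) w = a * dotv u w.
Proof. by rewrite mulr_sumr; apply: eq_bigr => i _; rewrite mxE mulrA. Qed.

Lemma dotvC u v : dotv u v = dotv v u.
Proof. by apply: eq_bigr => i _; rewrite mulrC. Qed.

Lemma dotv0l w : dotv 0 w = 0.
Proof. by rewrite -(scale0r 0) dotvZl mul0r. Qed.

Lemma dotvNl u w : dotv (- u) w = - dotv u w.
Proof. by rewrite -scaleN1r dotvZl mulN1r. Qed.

Lemma dotvBl u v w : dotv (u - v) w = dotv u w - dotv v w.
Proof. by rewrite dotvDl dotvNl. Qed.

Lemma dotvDr u v w : dotv u (v + w) = dotv u v + dotv u w.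
Proof. by rewrite ![dotv u _]dotvC dotvDl. Qed.

Lemma dotvNr u w : dotv u (- w) = - dotv u w.
Proof. by rewrite ![dotv u _]dotvC dotvNl. Qed.

Lemma dotvZr a u w : dotv u (a *: w) = a * dotv u w.
Proof. by rewrite ![dotv u _]dotvC dotvZl. Qed.

Lemma dotv_sumr (I : Type) (r : seq I) (P : pred I) (F : I -> 'rV[R]_n) u :
  dotv u (\sum_(i <- r | P i) F i) = \sum_(i <- r | P i) dotv u (F i).
Proof.
elim/big_rec2: _ => [|i _ x _ <-]; first by rewrite dotvC dotv0l.
by rewrite dotvDr.
Qed.

Lemma dotv_delta v i : dotv (delta_mx 0 i) v = v 0 i.
Proof.
rewrite /dotv (bigD1 i)//= mxE !eqxx mul1r big1 ?addr0// => j ji.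
by rewrite mxE (negbTE ji) andbF mul0r.
Qed.

Lemma dotv_le u v : `|dotv u v| <= norm1 u * norm1 v.
Proof.
apply: le_trans (ler_norm_sum _ _ _) _; rewrite mulr_suml.
by apply: ler_sum => i _; rewrite normrM ler_wpM2l// norm1_coord.
Qed.

Lemma mulmx_dotv (M : 'M[R]_n) u v : (u *m M *m v^T) 0 0 = dotv (u *m M) v.
Proof. by rewrite mxE; apply: eq_bigr => i _; rewrite [v^T _ _]mxE. Qed.

Lemma qformZ (M : 'M[R]_n) a v : qform M (a *: v) = a ^+ 2 * qform M v.
Proof.
by rewrite /qform !mulmx_dotv -scalemxAl dotvZl dotvZr mulrA.
Qed.

Lemma norm1_mulmx (M : 'M[R]_n) :
  exists2 C : R, 0 <= C & forall v, norm1 (v *m M) <= C * norm1 v.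
Proof.
exists (n%:R * \sum_i \sum_j `|M i j|).
  by rewrite mulr_ge0// sumr_ge0// => i _; rewrite sumr_ge0.
move=> v; rewrite -mulrA; apply: norm1_le => j; rewrite mxE.
apply: le_trans (ler_norm_sum _ _ _) _; rewrite mulr_suml.
apply: ler_sum => i _; rewrite normrM mulrC.
apply: ler_pM => //; last exact: norm1_coord.
by rewrite (bigD1 j)//= lerDl sumr_ge0.
Qed.

End fixed_dim.

(** * Positive definite forms and their inverses *)

Section PositiveDefinite.
Context {n : nat} (M : 'M[R]_n) (Msym : M^T = M) (Mpos : posdef M).
Implicit Types u v w : 'rV[R]_n.

Lemma posdef_unit : M \in unitmx.
Proof.
rewrite -row_free_unit -kermx_eq0; apply/eqP/row_matrixP => i.
rewrite row0; apply/eqP/negPn/negP => /Mpos; rewrite /qform.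
suff -> : row i (kermx M) *m M = 0 by rewrite mul0mx mxE ltxx.
by apply/sub_kermxP; exact: row_sub.
Qed.

Lemma qform_ge0 v : 0 <= qform M v.
Proof.
have [->|/Mpos/ltW//] := eqVneq v 0.
by rewrite /qform mul0mx mul0mx mxE.
Qed.

Lemma bform_sym u v : dotv (u *m M) v = dotv (v *m M) u.
Proof.
rewrite -!mulmx_dotv -[LHS]mulr1n -[LHS]mulr1n -[in LHS]mulmxA.
by rewrite -[M in LHS]Msym -trmx_mul -[u]trmxK -trmx_mul trmxK mxE.
Qed.

Lemma qform_invmx v : qform M (v *m invmx M) = qform (invmx M) v.
Proof.
rewrite /qform !mulmx_dotv -[_ *m M]mulmxA mulVmx ?mulmx1 ?posdef_unit//.
by rewrite dotvC.
Qed.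

(** Nonnegativity of the form at the residual of projecting [u] on the line of [w], with [s] the
    projection coefficient. *)
Lemma qform_cauchy u w : dotv (u *m M) w ^+ 2 <= qform M u * qform M w.
Proof.
have [->|w0] := eqVneq w 0.
  by rewrite dotvC dotv0l expr0n/= mulr_ge0// qform_ge0.
have q0 := Mpos w0; set b := dotv _ _; set s := b / qform M w.
have : 0 <= qform M (u - s *: w) := qform_ge0 _.
rewrite {1}/qform mulmx_dotv mulmxBl -scalemxAl dotvBl dotvDr dotvNr dotvZr.
rewrite dotvZl dotvDr dotvNr dotvZr -!mulmx_dotv -!/(qform _ _) !mulmx_dotv.
rewrite (bform_sym w u) -/b => h.
suff -> : b ^+ 2 = qform M u * qform M w
   - (qform M u - s * b - s * (b - s * qform M w)) * qform M w.
  by rewrite lerBlDr lerDl mulr_ge0// ltW.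
by rewrite /s; field; rewrite gt_eqF.
Qed.

(** No compactness of the sphere is involved: [v 0 i] is the [M]-product of [v] with row [i] of
    [invmx M], and Cauchy-Schwarz bounds it by [qform M v] times a diagonal entry of [invmx M]; [b]
    is the trace of [invmx M]. *)
Lemma posdef_lower : exists2 c : R, 0 < c & forall v, c * norm1 v ^+ 2 <= qform M v.
Proof.
pose b := \sum_i qform (invmx M) (delta_mx 0 i).
have Mu := posdef_unit.
have key i v : `|v 0 i| ^+ 2 <= qform M v * qform (invmx M) (delta_mx 0 i).
  rewrite -normrX ger0_norm ?sqr_ge0//.
  pose w := delta_mx 0 i *m invmx M : 'rV_n.
  have -> : v 0 i = dotv (v *m M) w.
    by rewrite bform_sym /w -mulmxA mulVmx// mulmx1 dotv_delta.
  by apply: le_trans (qform_cauchy _ _) _; rewrite /w qform_invmx.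
have b0 i : 0 <= qform (invmx M) (delta_mx 0 i).
  by rewrite -qform_invmx qform_ge0.
have b0' : 0 <= b by rewrite sumr_ge0.
pose K := n%:R ^+ 2 * (b + 1).
have K0 : 0 <= K by rewrite mulr_ge0 ?sqr_ge0// addr_ge0.
exists (K + 1)^-1 => [|v]; first by rewrite invr_gt0 ltr_wpDl.
rewrite mulrC ler_pdivrMr ?ltr_wpDl//.
have q0 := qform_ge0 v.
have h i : `|v 0 i| <= Num.sqrt (qform M v * b).
  rewrite -sqrtr_sqr -(real_normK (num_real _)) ler_wsqrtr//.
  apply: le_trans (key i v) _; rewrite ler_wpM2l//.
  by rewrite /b (bigD1 i)//= lerDl sumr_ge0.
have := norm1_le h; have := norm1_ge0 v => v0 hn.
have -> : qform M v * (K + 1) =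
   (n%:R * Num.sqrt (qform M v * b)) ^+ 2 + (n%:R ^+ 2 + 1) * qform M v.
  by rewrite exprMn sqr_sqrtr ?mulr_ge0// /K; ring.
apply: (@le_trans _ _ ((n%:R * Num.sqrt (qform M v * b)) ^+ 2)).
  by rewrite ler_sqr ?nnegrE// mulr_ge0// sqrtr_ge0.
by rewrite lerDl mulr_ge0// addr_ge0// sqr_ge0.
Qed.

(** With [e = u *m M + g] one has [u = (e - g) *m invmx M]; the square in [g] cancels and every
    remaining term contains [e]. At critical points [e] is the residual of the linearized
    equation. *)
Lemma qform_perturb : exists2 K : R, 0 <= K & forall u g : 'rV[R]_n,
  `|qform M u - qform (invmx M) g| <=
    K * (norm1 g * norm1 (u *m M + g) + norm1 (u *m M + g) ^+ 2).
Proof.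
have Mu := posdef_unit; have [K K0 hK] := norm1_mulmx (invmx M).
exists (2 * K) => [|u g]; first by rewrite mulr_ge0.
have [e he] : exists e, e = u *m M + g by exists (u *m M + g).
rewrite -he; have -> : u = (e - g) *m invmx M by rewrite he addrK mulmxK.
rewrite qform_invmx /qform !mulmx_dotv mulmxBl dotvBl !dotvDr !dotvNr.
have hb x y : `|dotv (x *m invmx M) y| <= K * norm1 x * norm1 y.
  by apply: le_trans (dotv_le _ _) _; rewrite ler_wpM2r ?norm1_ge0.
have := hb e e; have := hb e g; have := hb g e.
set A := dotv _ _; set B := dotv _ _; set D := dotv _ _; set G := dotv _ _.
move=> h1 h2 h3.
have -> : D - B - (A - G) - G = D - B - A by ring.
apply: le_trans (ler_normB _ _) _; apply: (@le_trans _ _ (`|D| + `|B| + `|A|)).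
  by rewrite lerD2r ler_normB.
have e0 := norm1_ge0 e; have g0 := norm1_ge0 g.
have ee : 0 <= K * norm1 e ^+ 2 by rewrite mulr_ge0 ?sqr_ge0.
have -> : 2 * K * (norm1 g * norm1 e + norm1 e ^+ 2) =
  K * norm1 e * norm1 e + K * norm1 e * norm1 g + K * norm1 g * norm1 e + K * norm1 e ^+ 2.
  by ring.
lra.
Qed.

Lemma qform_invmx_gt0 v : v != 0 -> 0 < qform (invmx M) v.
Proof.
move=> v0; rewrite -qform_invmx; apply: Mpos; apply: contra v0 => /eqP h.
by rewrite -[v](mulmxKV posdef_unit) h mul0mx.
Qed.

End PositiveDefinite.
End Vectors.

Section LipschitzTopology.
Context {R : realType}.
Local Open Scope classical_set_scope.
Local Open Scope ring_scope.
Lemma lip_within_continuous n (f : 'rV[R]_n -> R) (A : set 'rV[R]_n) (C : R) :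
  0 <= C -> (forall v w, A v -> A w -> `|f v - f w| <= C * `|v - w|) ->
  {within A, continuous f}.
Proof.
move=> C0 h; apply/subspace_continuousP => v Av.
apply/cvgrPdist_lt => e e0.
rewrite near_withinE.
near=> w => Aw.
apply: le_lt_trans (h _ _ Av Aw) _.
apply: (@le_lt_trans _ _ ((C + 1) * `|v - w|)).
  by rewrite ler_wpM2r// lerDl.
rewrite mulrC -ltr_pdivlMr ?ltr_wpDl//.
near: w.
apply: cvgr_dist_lt => //.
by rewrite divr_gt0 ?ltr_wpDl.
Unshelve. all: by end_near. Qed.

Lemma lip_sublevel_closed n (f : 'rV[R]_n -> R) (C c : R) :
  0 <= C -> (forall v w, `|f v - f w| <= C * `|v - w|) ->
  closed [set v | f v <= c].
Proof.
move=> C0 h.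
have fc : continuous f.
  apply/continuous_subspace_setT.
  exact: lip_within_continuous C0 (fun v w _ _ => h v w).
have -> : [set v | f v <= c] = f @^-1` [set x | x <= c] by [].
by apply: preimage_closed => //; exact: closed_le.
Qed.
End LipschitzTopology.

(** * One conditional of the family *)

Section OnePosition.
Context {R : realType} {V : finType} {T : nat} {d : 'I_T -> nat}.
Context (E : seq_exp_family R V d) (t : 'I_T) (s : seq V).
Implicit Types (x b u w : 'rV[R]_(d t)) (v : V).

Local Notation p x v := (cond E x s v).
Local Notation S v := (stat E t s v).

Definition partition_fun x := \sum_w weight E x s w.

Definition mean_stat x w := \sum_v p x v * dotv w (S v).

(** The derivative of [ln (cond x s v)] along [w] in closed form. Outside the support it need not
    agree with [score], which is 0 there by convention, but it stays smooth in [x]; [cond_score]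
    links the two under the weight [cond]. *)
Definition dscore x w v := dotv w (S v) - mean_stat x w.

Definition cov_stat x w u := \sum_v p x v * (dscore x w v * dscore x u v).

(** One bound valid for all [x]: means of the statistic stay within the same range, so scores are
    bounded and conditionals Lipschitz uniformly over the parameter space. *)
Definition stat_bound := \sum_v norm1 (S v).

Lemma stat_bound_ge0 : 0 <= stat_bound.
Proof. by apply: sumr_ge0 => v _; exact: norm1_ge0. Qed.

Lemma dotv_stat_le w v : `|dotv w (S v)| <= stat_bound * norm1 w.
Proof.
apply: le_trans (dotv_le _ _) _; rewrite mulrC ler_wpM2r ?norm1_ge0//.
by rewrite /stat_bound (bigD1 v)//= lerDl sumr_ge0// => *; exact: norm1_ge0.
Qed.

Lemma weight_ge0 x v : 0 <= weight E x s v.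
Proof. by rewrite mulr_ge0 ?carrier_ge0// expR_ge0. Qed.

Lemma partition_fun_gt0 x : 0 < partition_fun x.
Proof.
have [v cv] := carrier_neq0 E t s.
rewrite /partition_fun (bigD1 v)//= ltr_wpDr ?mulr_gt0 ?expR_gt0//.
by apply: sumr_ge0 => w _; exact: weight_ge0.
Qed.

Lemma cond_ge0 x v : 0 <= p x v.
Proof. by rewrite divr_ge0 ?weight_ge0// ltW// partition_fun_gt0. Qed.

Lemma sum_cond x : \sum_v p x v = 1.
Proof. by rewrite -mulr_suml divff// gt_eqF// partition_fun_gt0. Qed.

Lemma cond_le1 x v : p x v <= 1.
Proof.
by rewrite -(sum_cond x) (bigD1 v)//= lerDl sumr_ge0// => *; exact: cond_ge0.
Qed.

Lemma cond_norm_le1 x v : `|p x v| <= 1.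
Proof. by rewrite ger0_norm ?cond_ge0 ?cond_le1. Qed.

(** The exponential factor never vanishes, so the support is that of the carrier and is common to
    all parameters. This legitimates the formula [kl] and lets statements about the support pass
    from one parameter to another. *)
Lemma cond_gt0E x v : (0 < p x v) = (0 < carrier E t s v).
Proof.
by rewrite pmulr_lgt0 ?invr_gt0 ?partition_fun_gt0// pmulr_lgt0// expR_gt0.
Qed.

Lemma cond_eq0 x v : (p x v == 0) = (carrier E t s v == 0).
Proof.
have := cond_gt0E x v; rewrite !lt_neqAle cond_ge0 carrier_ge0 !andbT.
by rewrite ![0 == _]eq_sym => /negb_inj.
Qed.

Lemma mean_dscore x w : \sum_v p x v * dscore x w v = 0.
Proof.
rewrite (eq_bigr (fun v => p x v * dotv w (S v) - p x v * mean_stat x w)).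
  by rewrite sumrB -mulr_suml sum_cond mul1r subrr.
by move=> v _; rewrite /dscore mulrBr.
Qed.

Lemma mean_stat_le x w : `|mean_stat x w| <= stat_bound * norm1 w.
Proof.
apply: le_trans (ler_norm_sum _ _ _) _.
rewrite -[leRHS]mul1r -(sum_cond x) mulr_suml; apply: ler_sum => v _.
rewrite normrM ger0_norm ?cond_ge0// ler_wpM2l ?cond_ge0//.
exact: dotv_stat_le.
Qed.

Lemma dscore_le x w v : `|dscore x w v| <= 2 * stat_bound * norm1 w.
Proof.
apply: le_trans (ler_normB _ _) _.
have := dotv_stat_le w v; have := mean_stat_le x w; lra.
Qed.

Lemma mean_statD x w u : mean_stat x (w + u) = mean_stat x w + mean_stat x u.
Proof.
by rewrite -big_split/=; apply: eq_bigr => v _; rewrite dotvDl mulrDr.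
Qed.

Lemma mean_statZ x a w : mean_stat x (a *: w) = a * mean_stat x w.
Proof.
by rewrite mulr_sumr; apply: eq_bigr => v _; rewrite dotvZl mulrCA.
Qed.

Lemma dscoreD x w u v : dscore x (w + u) v = dscore x w v + dscore x u v.
Proof. rewrite /dscore dotvDl mean_statD; ring. Qed.

Lemma dscoreZ x a w v : dscore x (a *: w) v = a * dscore x w v.
Proof. rewrite /dscore dotvZl mean_statZ; ring. Qed.

Lemma dscore_sum x w v :
  dscore x w v = \sum_i w 0 i * dscore x (delta_mx 0 i) v.
Proof.
rewrite {1}(matrix_sum_delta w) big_ord1.
elim/big_rec2: _ => [|i y z _ <-]; last by rewrite dscoreD dscoreZ.
by rewrite -(scale0r 0) dscoreZ mul0r.
Qed.

Lemma cov_stat_ge0 x w : 0 <= cov_stat x w w.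
Proof.
by apply: sumr_ge0 => v _; rewrite mulr_ge0 ?cond_ge0// -expr2 sqr_ge0.
Qed.

Lemma cov_stat_le x w u :
  `|cov_stat x w u| <= (2 * stat_bound) ^+ 2 * (norm1 w * norm1 u).
Proof.
apply: le_trans (ler_norm_sum _ _ _) _.
rewrite -[leRHS]mul1r -[X in _ <= X * _](sum_cond x) mulr_suml.
apply: ler_sum => v _.
rewrite normrM ger0_norm ?cond_ge0// ler_wpM2l ?cond_ge0// normrM.
have -> : (2 * stat_bound) ^+ 2 * (norm1 w * norm1 u) =
  2 * stat_bound * norm1 w * (2 * stat_bound * norm1 u) by ring.
by apply: ler_pM => //; exact: dscore_le.
Qed.

Lemma isd_weight x w v (r : R) :
  is_derive r (1 : R) (fun z => weight E (x + z *: w) s v)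
    (weight E (x + r *: w) s v * dotv w (S v)).
Proof.
rewrite (_ : (fun _ => _) = fun z => carrier E t s v *
    expR (dotv x (S v) + z * dotv w (S v))); last first.
  by apply/funext => z; rewrite /weight dotvDl dotvZl.
apply: is_derive_eq (isdZ _ (isd_expR (isd_affine (dotv x (S v)) (dotv w (S v)) r))) _.
by rewrite /weight dotvDl dotvZl -mulrA [expR _ * _]mulrC.
Qed.

Lemma isd_partition x w (r : R) :
  is_derive r (1 : R) (fun z => partition_fun (x + z *: w))
    (partition_fun (x + r *: w) * mean_stat (x + r *: w) w).
Proof.
apply: is_derive_eq (isd_sum _ _ (fun v => isd_weight x w v r)) _.
rewrite mulr_sumr; apply: eq_bigr => v _; rewrite /cond -/(partition_fun _).
by field; rewrite gt_eqF// partition_fun_gt0.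
Qed.

Lemma isd_cond x w v (r : R) :
  is_derive r (1 : R) (fun z => p (x + z *: w) v)
    (p (x + r *: w) v * dscore (x + r *: w) w v).
Proof.
have Z0 : partition_fun (x + r *: w) != 0 by rewrite gt_eqF// partition_fun_gt0.
apply: is_derive_eq (isdM (isd_weight x w v r) (isd_inv Z0 (isd_partition x w r))) _.
by rewrite /cond -/(partition_fun _) /dscore; field.
Qed.

Lemma cond_lip x y v : `|p x v - p y v| <= 2 * stat_bound * norm1 (x - y).
Proof.
pose f (r : R) := p (y + r *: (x - y)) v.
have -> : p x v - p y v = f 1 - f 0.
  by rewrite /f scale1r scale0r addr0 [y + _]addrC subrK.
apply: isd_lip (fun r => isd_cond y (x - y) v r) _ => r _.
rewrite normrM -[leRHS]mul1r; apply: ler_pM => //; first exact: cond_norm_le1.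
exact: dscore_le.
Qed.

Definition rel_ent b x := kl (cond E x s) (cond E b s).

(** On the support the carriers cancel in the ratio of the two conditionals, so its logarithm is
    affine in the statistic; elsewhere the weight is 0. *)
Lemma rel_entE b x : rel_ent b x =
  \sum_v p x v * dotv (x - b) (S v) - ln (partition_fun x) + ln (partition_fun b).
Proof.
have -> : - ln (partition_fun x) = \sum_v p x v * - ln (partition_fun x).
  by rewrite -mulr_suml sum_cond mul1r.
have -> : ln (partition_fun b) = \sum_v p x v * ln (partition_fun b).
  by rewrite -mulr_suml sum_cond mul1r.
rewrite -!big_split/=; apply: eq_bigr => v _.
have [->|pv] := eqVneq (p x v) 0; first by rewrite !mul0r !addr0.
have cv : 0 < carrier E t s v by rewrite -(cond_gt0E x) lt_neqAle eq_sym pv cond_ge0.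
rewrite -!mulrDr; congr (_ * _).
have Zx := partition_fun_gt0 x; have Zb := partition_fun_gt0 b.
rewrite (_ : p x v / p b v = expR (dotv (x - b) (S v)) / partition_fun x * partition_fun b).
  rewrite lnM ?posrE ?divr_gt0 ?expR_gt0//.
  by rewrite ln_div ?posrE ?expR_gt0// expRK.
rewrite /cond /weight -!/(partition_fun _) dotvBl expRB; field.
by rewrite !gt_eqF// expR_gt0.
Qed.

Lemma rel_ent_id b : rel_ent b b = 0.
Proof.
rewrite rel_entE subrr big1 => [|v _]; last by rewrite dotv0l mulr0.
by rewrite add0r addNr.
Qed.

(** The terms coming from the partition function cancel, and the statistic along the displacement
    may be centred because scores have mean zero; the covariance of [w] with the displacement
    remains. *)
Lemma isd_rel_ent b x w (r : R) :
  is_derive r (1 : R) (fun z => rel_ent b (x + z *: w))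
    (cov_stat (x + r *: w) w (x + r *: w - b)).
Proof.
set y := x + r *: w.
rewrite (_ : (fun _ => _) = fun z => \sum_v p (x + z *: w) v *
   (dotv (x - b) (S v) + z * dotv w (S v))
   - ln (partition_fun (x + z *: w)) + ln (partition_fun b)); last first.
  apply/funext => z; rewrite rel_entE; congr (_ - _ + _); apply: eq_bigr => v _.
  by rewrite -(dotvZl z) -dotvDl addrAC.
apply: is_derive_eq.
  apply: isdD (isd_cst _ _); apply: isdB.
    apply: isd_sum => v; apply: isdM (isd_cond x w v r) (isd_affine _ _ _).
  exact: isd_ln (partition_fun_gt0 _) (isd_partition x w r).
rewrite -/y mulrAC divff ?gt_eqF ?partition_fun_gt0// mul1r addr0 -/(mean_stat y w).
rewrite big_split/= -/(mean_stat y w) addrK.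
have hy v : dotv (x - b) (S v) + r * dotv w (S v) = dscore y (y - b) v + mean_stat y (y - b).
  by rewrite /dscore subrK -dotvZl -dotvDl /y addrAC.
rewrite (eq_bigr (fun v => p y v * (dscore y w v * dscore y (y - b) v)
    + mean_stat y (y - b) * (p y v * dscore y w v))).
  by rewrite big_split/= -mulr_sumr mean_dscore mulr0 addr0.
by move=> v _; rewrite hy; ring.
Qed.

(** The displacement from [b] is [r] times [u], so the derivative is [r] times a variance, hence
    nonnegative for [r >= 0] at any distance. *)
Lemma isd_rel_ent_ray b u (r : R) :
  is_derive r (1 : R) (fun z => rel_ent b (b + z *: u)) (r * cov_stat (b + r *: u) u u).
Proof.
apply: is_derive_eq (isd_rel_ent b b u r) _.
rewrite addrAC subrr add0r mulr_sumr; apply: eq_bigr => v _.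
by rewrite dscoreZ; ring.
Qed.

Lemma rel_ent_ray_nondecr b u (r : R) : 0 <= r <= 1 ->
  rel_ent b (b + r *: u) <= rel_ent b (b + u).
Proof.
case/andP => r0 r1; rewrite -[u in leRHS]scale1r.
apply: (isd_nondecr (fun r => isd_rel_ent_ray b u r)) => // z z0.
by rewrite mulr_ge0// cov_stat_ge0.
Qed.

Lemma rel_ent_ge0 b x : 0 <= rel_ent b x.
Proof.
have := @rel_ent_ray_nondecr b (x - b) 0; rewrite scale0r addr0 rel_ent_id.
by rewrite addrC subrK lexx ler01; apply.
Qed.

(** The derivative is linear in the displacement from [b], so within radius [rho] the Lipschitz
    constant carries a factor [rho]; this gives order 2 in [flat_rel_ent]. *)
Lemma rel_ent_lip b x y (rho : R) :
  norm1 (x - b) <= rho -> norm1 (y - b) <= rho ->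
  `|rel_ent b x - rel_ent b y| <= (2 * stat_bound) ^+ 2 * rho * norm1 (x - y).
Proof.
move=> hx hy; pose f (r : R) := rel_ent b (y + r *: (x - y)).
have -> : rel_ent b x - rel_ent b y = f 1 - f 0.
  by rewrite /f scale1r scale0r addr0 [y + _]addrC subrK.
apply: isd_lip (fun r => isd_rel_ent b y (x - y) r) _ => r /andP[r0 r1].
apply: le_trans (cov_stat_le _ _ _) _.
rewrite -[leRHS]mulrA ler_wpM2l ?sqr_ge0// mulrC ler_wpM2r ?norm1_ge0//.
have -> : y + r *: (x - y) - b = r *: (x - b) + (1 - r) *: (y - b).
  by apply/rowP => i; rewrite !mxE; ring.
apply: le_trans (norm1D _ _) _; rewrite !norm1Z ger0_norm// ger0_norm ?subr_ge0//.
have : r * norm1 (x - b) <= r * rho by rewrite ler_wpM2l.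
have : (1 - r) * norm1 (y - b) <= (1 - r) * rho by rewrite ler_wpM2l// subr_ge0.
lra.
Qed.

Lemma rel_ent_le b x :
  rel_ent b x <= (2 * stat_bound) ^+ 2 * norm1 (x - b) ^+ 2.
Proof.
have := @rel_ent_lip b x b _ (lexx _); rewrite subrr norm10 norm1_ge0.
by rewrite rel_ent_id subr0 ger0_norm ?rel_ent_ge0// -mulrA -expr2; apply.
Qed.

Lemma dscore_lip x y w v : `|dscore x w v - dscore y w v| <=
  2 * #|V|%:R * stat_bound ^+ 2 * norm1 (x - y) * norm1 w.
Proof.
have -> : dscore x w v - dscore y w v = mean_stat y w - mean_stat x w.
  by rewrite /dscore; ring.
rewrite -sumrB; apply: le_trans (ler_norm_sum _ _ _) _.
apply: (@le_trans _ _ (\sum_(v : V) 2 * stat_bound * norm1 (x - y) * (stat_bound * norm1 w))).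
  apply: ler_sum => u _; rewrite -mulrBl normrM; apply: ler_pM => //.
    by rewrite distrC; exact: cond_lip.
  exact: dotv_stat_le.
by rewrite sumr_const -mulr_natl le_eqVlt; apply/orP; left; apply/eqP; ring.
Qed.

Lemma cov_stat_lip : exists2 C : R, 0 <= C & forall x y w u,
  `|cov_stat x w u - cov_stat y w u| <= C * norm1 (x - y) * (norm1 w * norm1 u).
Proof.
have B0 := stat_bound_ge0.
pose B := stat_bound; pose D := 2 * #|V|%:R * B ^+ 2.
have D0 : 0 <= D by rewrite mulr_ge0 ?sqr_ge0// mulr_ge0.
pose C := 2 * B * (2 * B) ^+ 2 + 2 * (D * (2 * B)).
have C0 : 0 <= C by rewrite addr_ge0// !mulr_ge0// ?sqr_ge0// !mulr_ge0.
exists (#|V|%:R * C) => [|x y w u]; first by rewrite mulr_ge0.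
rewrite /cov_stat -sumrB; apply: le_trans (ler_norm_sum _ _ _) _.
apply: (@le_trans _ _ (\sum_(v : V) C * norm1 (x - y) * (norm1 w * norm1 u))); last first.
  by rewrite sumr_const -mulr_natl le_eqVlt; apply/orP; left; apply/eqP; ring.
apply: ler_sum => v _.
set N := norm1 (x - y); set W := norm1 w; set U := norm1 u.
have [N0 W0 U0] : [/\ 0 <= N, 0 <= W & 0 <= U] by split; exact: norm1_ge0.
have -> : cond E x s v * (dscore x w v * dscore x u v) -
   cond E y s v * (dscore y w v * dscore y u v) =
   (cond E x s v - cond E y s v) * (dscore x w v * dscore x u v)
   + cond E y s v * ((dscore x w v - dscore y w v) * dscore x u v)
   + cond E y s v * (dscore y w v * (dscore x u v - dscore y u v)) by ring.
have -> : C * N * (W * U) = 2 * B * N * (2 * B * W * (2 * B * U)) +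
   1 * (D * N * W * (2 * B * U)) + 1 * (2 * B * W * (D * N * U)) by rewrite /C; ring.
apply: le_trans (ler_normD _ _) _; apply: lerD; last first.
  rewrite normrM; apply: ler_pM => //; first exact: cond_norm_le1.
  by rewrite normrM; apply: ler_pM => //; [exact: dscore_le|exact: dscore_lip].
apply: le_trans (ler_normD _ _) _; apply: lerD.
  rewrite normrM; apply: ler_pM => //; first exact: cond_lip.
  by rewrite normrM; apply: ler_pM => //; exact: dscore_le.
rewrite normrM; apply: ler_pM => //; first exact: cond_norm_le1.
by rewrite normrM; apply: ler_pM => //; [exact: dscore_lip|exact: dscore_le].
Qed.

Lemma rel_ent_quadratic : exists2 C : R, 0 <= C & forall b u,
  `|rel_ent b (b + u) - 2^-1 * cov_stat b u u| <= C * norm1 u ^+ 3.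
Proof.
have [C C0 hC] := cov_stat_lip; exists C => // b u.
(* Removing the quadratic with the variance at [b] leaves as derivative [r] times a difference of
   variances, to which [cov_stat_lip] applies. *)
pose f (r : R) := rel_ent b (b + r *: u) - (2^-1 * cov_stat b u u) * (r * r).
have -> : rel_ent b (b + u) - 2^-1 * cov_stat b u u = f 1 - f 0.
  by rewrite /f scale1r scale0r addr0 rel_ent_id; ring.
have hf (r : R) : is_derive r (1 : R) f (r * (cov_stat (b + r *: u) u u - cov_stat b u u)).
  have hq := isdM (@is_derive_id R _ r 1) (@is_derive_id R _ r 1).
  by apply: is_derive_eq (isdB (isd_rel_ent_ray b u r) (isdZ _ hq)) _ => /=; field.
apply: isd_lip hf _ => r /andP[r0 r1].
rewrite normrM ger0_norm//; apply: (@le_trans _ _ (1 * (C * norm1 u * (norm1 u * norm1 u)))).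
  apply: ler_pM => //; apply: le_trans (hC _ _ _ _) _.
  rewrite addrAC subrr add0r norm1Z ger0_norm//.
  rewrite ler_wpM2r ?mulr_ge0 ?norm1_ge0// ler_wpM2l//.
  by rewrite -[leRHS]mul1r ler_wpM2r ?norm1_ge0.
by rewrite mul1r le_eqVlt; apply/orP; left; apply/eqP; ring.
Qed.

Lemma derive_line n (f : 'rV[R]_n -> R) (a w : 'rV[R]_n) (l : R) :
  is_derive (0 : R) (1 : R) (fun r : R => f (a + r *: w)) l -> 'D_w f a = l.
Proof.
have e : (fun h : R => h^-1 *: (((fun r : R => f (a + r *: w)) \o shift 0) (h *: 1)
    - f (a + 0 *: w))) = (fun h => h^-1 *: ((f \o shift a) (h *: w) - f a)).
  apply/funext => h /=; rewrite scale0r !addr0.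
  by rewrite [h *: 1]mulr1 [a + _]addrC.
by move=> [_ <-]; rewrite /derive e.
Qed.

(** Coordinates of [score] are derivatives along basis vectors, and [dscore] is linear in the
    direction. The weight hides the tokens where [ln 0 = 0] may make the two disagree. *)
Lemma cond_score x w v :
  p x v * dotv w (score E x s v) = p x v * dscore x w v.
Proof.
have [->|pv] := eqVneq (p x v) 0; first by rewrite !mul0r.
congr (_ * _); rewrite dscore_sum; apply: eq_bigr => i _; congr (_ * _).
rewrite /score /grad mxE; apply: derive_line.
have pv0 : 0 < p (x + 0 *: delta_mx 0 i) v.
  by rewrite scale0r addr0 lt_neqAle eq_sym pv cond_ge0.
have h := isd_ln (f := fun r => p (x + r *: delta_mx 0 i) v) pv0
  (isd_cond x (delta_mx 0 i) v 0).
apply: is_derive_eq h _.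
by rewrite mulrC mulrA mulVf ?gt_eqF// mul1r scale0r addr0.
Qed.

End OnePosition.

(** * Laws on sequences *)

Section Laws.
Context {R : realType} {V : finType} {T : nat} {d : 'I_T -> nat}.
Context (E : seq_exp_family R V d).
Implicit Types (t : 'I_T) (s : seq V) (y : T.-tuple V) (th : params R d).

Lemma law_ge0 th y : 0 <= law E th y.
Proof. by apply: prodr_ge0 => t _; exact: cond_ge0. Qed.

(* The value 0 beyond position [T] is never used. *)
Definition kern th s v : R :=
  if insub (size s) is Some t then cond E (th t) s v else 0.

Lemma kernE th t s v : size s = t -> kern th s v = cond E (th t) s v.
Proof. by move=> st; rewrite /kern st valK. Qed.

(** The iterated expectation over the [n] tokens after [s]. In this recursive form marginalization
    and the tower property become inductions on [n] instead of manipulations of sums over tuples. *)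
Fixpoint prefix_expect th n (phi : seq V -> R) s : R :=
  if n is n'.+1 then \sum_v kern th s v * prefix_expect th n' phi (rcons s v)
  else phi s.

(** The first token is split off the tuple: its factor leaves the product and the prefix grows by
    [rcons]. *)
Lemma sum_tuples_prefix_expect th n s (phi : seq V -> R) :
  \sum_(z : n.-tuple V) (\prod_(i < n) kern th (s ++ take i z) (tnth z i))
     * phi (s ++ z) = prefix_expect th n phi s.
Proof.
elim: n s => [|n IH] s.
  rewrite (big_pred1 [tuple]) => [|z]; first by rewrite big_ord0 mul1r cats0.
  by apply/esym/eqP/val_inj; rewrite [val z](size0nil (size_tuple z)).
rewrite (reindex (fun q : V * n.-tuple V => [tuple of q.1 :: q.2])); last first.
  exists (fun z : n.+1.-tuple V => (thead z, [tuple of behead z])) => [[v z] _|z _] /=.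
    by congr pair; apply: val_inj.
  by rewrite -tuple_eta.
rewrite -(pair_bigA _ (fun v (z : n.-tuple V) =>
  (\prod_(i < n.+1) kern th (s ++ take i (v :: z)) (tnth [tuple of v :: z] i))
  * phi (s ++ v :: z)))/=.
apply: eq_bigr => v _; rewrite -IH mulr_sumr; apply: eq_bigr => z _.
rewrite big_ord_recl/= cats0 tnth0 mulrA cat_rcons; congr (_ * _ * _).
apply: eq_bigr => i _; rewrite tnthS.
by rewrite cat_rcons.
Qed.

Lemma expect_law th (phi : seq V -> R) :
  \sum_y law E th y * phi y = prefix_expect th T phi [::].
Proof.
rewrite -sum_tuples_prefix_expect; apply: eq_bigr => y _; congr (_ * _).
by apply: eq_bigr => t _; rewrite (@kernE _ t)// size_takel// size_tuple ltnW.
Qed.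

Lemma prefix_expectD th m n phi s :
  prefix_expect th (m + n) phi s = prefix_expect th m (prefix_expect th n phi) s.
Proof. by elim: m s => [|m IH] s //=; apply: eq_bigr => v _; rewrite IH. Qed.

Lemma eq_prefix_expect th th' n (phi psi : seq V -> R) s :
  (forall t, (t < size s + n)%N -> th t = th' t) ->
  (forall z, size z = (size s + n)%N -> phi z = psi z) ->
  prefix_expect th n phi s = prefix_expect th' n psi s.
Proof.
elim: n s => [|n IH] s hth h /=; first by rewrite h// addn0.
apply: eq_bigr => v _; congr (_ * _).
  rewrite /kern; case: insubP => // t _ ts; rewrite hth// ts.
  by rewrite -[X in (X < _)%N]addn0 ltn_add2l.
by apply: IH => [t|z]; rewrite size_rcons addSnnS; [exact: hth|exact: h].
Qed.

(** Tokens that [phi] does not see integrate out, each conditional having mass 1. The bound by [T]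
    matters: beyond it [kern] is 0 and mass would be lost. *)
Lemma prefix_expect_take th m n (phi : seq V -> R) s : (m <= size s)%N ->
  (size s + n <= T)%N ->
  prefix_expect th n (fun z => phi (take m z)) s = phi (take m s).
Proof.
elim: n s => [|n IH] s ms sn //=.
have hs : (size s < T)%N by apply: leq_trans sn; rewrite -addSnnS leq_addr.
rewrite (eq_bigr (fun v => cond E (th (Ordinal hs)) s v * phi (take m s))).
  by rewrite -mulr_suml sum_cond mul1r.
move=> v _; rewrite (@kernE _ (Ordinal hs))// IH ?size_rcons ?addSnnS//.
  by rewrite -cats1 takel_cat.
exact: leqW.
Qed.

Lemma expect_take th m (phi : seq V -> R) : (m <= T)%N ->
  \sum_y law E th y * phi (take m y) = prefix_expect th m phi [::].
Proof.
move=> mT; rewrite (expect_law th (fun z => phi (take m z))).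
rewrite -{1}(subnKC mT) prefix_expectD; apply: eq_prefix_expect => // z /= zm.
rewrite add0n in zm.
by rewrite prefix_expect_take ?zm ?subnKC// -zm take_size.
Qed.

Lemma sum_law th : \sum_y law E th y = 1.
Proof.
have := @expect_take th 0 (fun=> 1) isT.
by move=> /= <-; apply: eq_bigr => y _; rewrite mulr1.
Qed.

Lemma law_le1 th y : law E th y <= 1.
Proof.
by rewrite -(sum_law th) (bigD1 y)//= lerDl sumr_ge0// => *; exact: law_ge0.
Qed.

Lemma expect_take_indep th th' (m : nat) (phi : seq V -> R) : (m <= T)%N ->
  (forall t, (t < m)%N -> th t = th' t) ->
  \sum_y law E th y * phi (take m y) = \sum_y law E th' y * phi (take m y).
Proof. by move=> mT h; rewrite !expect_take//; exact: eq_prefix_expect. Qed.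

(** The last factor of the law of the first [t + 1] tokens is the conditional itself, and later
    tokens integrate out. *)
Lemma expect_tower th t (phi : seq V -> V -> R) :
  \sum_y law E th y * phi (take t y) (tnth y t) =
  \sum_y law E th y * \sum_v cond E (th t) (take t y) v * phi (take t y) v.
Proof.
have [v0 _] := carrier_neq0 E t [::].
pose psi z := phi (take t z) (nth v0 z t).
have -> : \sum_y law E th y * phi (take t y) (tnth y t) =
    \sum_y law E th y * psi (take t.+1 y).
  apply: eq_bigr => y _; rewrite /psi take_takel ?leqnSn// nth_take//.
  by rewrite (tnth_nth v0).
rewrite (expect_take th psi) ?ltn_ord//.
rewrite (expect_take th (fun z => \sum_v cond E (th t) z v * phi z v)) 1?ltnW//.
rewrite -addn1 prefix_expectD; apply: eq_prefix_expect => // z /= zt.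
rewrite add0n in zt; apply: eq_bigr => v _; rewrite (@kernE _ t)// /psi -zt.
by rewrite -cats1 take_size_cat// nth_cat ltnn subnn.
Qed.

(** Given the prefix the score averages to zero, so it is orthogonal to every function of the
    prefix. This removes both the harm past the horizon and the divergences at positions up to
    [t]. *)
Lemma expect_dscore th t w (phi : seq V -> R) :
  \sum_y law E th y * (phi (take t y) * dscore E (take t y) (th t) w (tnth y t)) = 0.
Proof.
rewrite (expect_tower th t (fun z v => phi z * dscore E z (th t) w v)).
apply: big1 => y _; rewrite (eq_bigr (fun v => phi (take t y) *
   (cond E (th t) (take t y) v * dscore E (take t y) (th t) w v))).
  by rewrite -mulr_sumr mean_dscore !mulr0.
by move=> v _; rewrite mulrCA.
Qed.

Lemma law_neq0 th y t : law E th y != 0 -> 0 < cond E (th t) (take t y) (tnth y t).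
Proof.
rewrite prodf_seq_neq0 => /allP /(_ t); rewrite mem_index_enum => /(_ isT) /=.
by rewrite lt_neqAle cond_ge0 eq_sym andbT.
Qed.

Lemma law_eq0 th th' y : (law E th y == 0) = (law E th' y == 0).
Proof.
rewrite !prodf_seq_eq0; apply: eq_has => t /=.
by rewrite !cond_eq0.
Qed.

(** Chain rule. Sequences of law 0 drop out; on the others every factor of both laws is positive,
    the supports being equal, and the logarithm of the product splits. *)
Lemma kl_law th thb : kl (law E th) (law E thb) = \sum_t posKL E thb th t.
Proof.
pose g t z v := ln (cond E (th t) z v / cond E (thb t) z v).
rewrite /kl (eq_bigr (fun y => \sum_t law E th y * g t (take t y) (tnth y t))).
  rewrite exchange_big; apply: eq_bigr => t _.
  by rewrite (expect_tower th t (g t)).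
move=> y _; have [->|y0] := eqVneq (law E th y) 0.
  by rewrite mul0r big1// => t _; rewrite mul0r.
rewrite -mulr_sumr -prodf_div; congr (_ * _).
have h t : 0 < cond E (th t) (take t y) (tnth y t) / cond E (thb t) (take t y) (tnth y t).
  by rewrite divr_gt0// law_neq0// (law_eq0 _ th).
suff [] : 0 < \prod_t (cond E (th t) (take t y) (tnth y t) /
    cond E (thb t) (take t y) (tnth y t)) /\
  ln (\prod_t (cond E (th t) (take t y) (tnth y t) /
    cond E (thb t) (take t y) (tnth y t))) = \sum_t g t (take t y) (tnth y t) by [].
elim/big_rec2: _ => [|t p q _ [q0 e]]; first by rewrite ln1 ltr01.
by split; [rewrite mulr_gt0|rewrite lnM ?posrE// e].
Qed.

End Laws.

(** * Gradients *)

Section Gradients.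
Context {R : realType} {V : finType} {T : nat} {d : 'I_T -> nat}.
Context (E : seq_exp_family R V d).
Implicit Types (s t : 'I_T) (y : T.-tuple V) (th : params R d).

Definition upd th t (x : 'rV[R]_(d t)) : params R d :=
  @dfwith _ (fun s : 'I_T => 'rV[R]_(d s)) th t x.

Lemma upd_same th t (x : 'rV_(d t)) : upd th x t = x.
Proof. exact: dfwith_in. Qed.

Lemma upd_other th t (x : 'rV[R]_(d t)) s : t != s -> upd th x s = th s.
Proof. exact: dfwith_out. Qed.

Lemma upd_id th t : upd th (th t) = th.
Proof.
apply: functional_extensionality_dep => s.
by rewrite /upd; case: dfwithP.
Qed.

Definition law_score th t (w : 'rV_(d t)) y := dscore E (take t y) (th t) w (tnth y t).

Lemma isd_law th t (x w : 'rV_(d t)) y (r : R) :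
  is_derive r (1 : R) (fun z => law E (upd th (x + z *: w)) y)
    (law E (upd th (x + r *: w)) y * law_score (upd th (x + r *: w)) w y).
Proof.
have e z : law E (upd th (z : 'rV_(d t))) y =
    cond E z (take t y) (tnth y t) *
    \prod_(s < T | s != t) cond E (th s) (take s y) (tnth y s).
  rewrite /law (bigD1 t)//= upd_same; congr (_ * _); apply: eq_bigr => s st.
  by rewrite upd_other// eq_sym.
rewrite (_ : (fun _ => _) = fun z => cond E (x + z *: w) (take t y) (tnth y t) *
  \prod_(s < T | s != t) cond E (th s) (take s y) (tnth y s)); last first.
  by apply/funext => z; rewrite e.
apply: is_derive_eq (isdM (isd_cond E _ x w _ r) (isd_cst _ _)) _.
by rewrite e /law_score upd_same; ring.
Qed.

Lemma dotv_vcov t (x w : 'rV[R]_(d t)) (s : seq V) (f : V -> R) :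
  dotv w (vcov (cond E x s) f (score E x s)) =
  \sum_v cond E x s v * (f v * dscore E s x w v).
Proof.
rewrite /vcov dotvDr dotvNr dotvZr /vexpect !dotv_sumr.
rewrite [X in _ * X](eq_bigr (fun v => cond E x s v * dscore E s x w v)).
  rewrite mean_dscore mulr0 subr0; apply: eq_bigr => v _.
  by rewrite dotvZr dotvZr mulrCA cond_score mulrCA.
by move=> v _; rewrite dotvZr cond_score.
Qed.

Definition avg_cov th t (w u : 'rV_(d t)) :=
  \sum_y law E th y * cov_stat E (take t y) (th t) w u.

(** Evaluating a matrix on [u] and [w] is linear and passes through both expectations; on the
    rank-one matrix of a score it gives a product of two directional scores. *)
Lemma fisherE th t (u w : 'rV_(d t)) : dotv (u *m fisher E th t) w = avg_cov th u w.
Proof.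
pose bf (M : 'M[R]_(d t)) := dotv (u *m M) w.
have bfD : {morph bf : M N / M + N >-> M + N}.
  by move=> M N; rewrite /bf mulmxDr dotvDl.
have bf0 : bf 0 = 0 by rewrite /bf mulmx0 dotv0l.
have bfZ a M : bf (a *: M) = a * bf M by rewrite /bf -scalemxAr dotvZl.
rewrite -/(bf _) /fisher /vexpect (big_morph bf bfD bf0); apply: eq_bigr => y _.
rewrite bfZ (big_morph bf bfD bf0); congr (_ * _); apply: eq_bigr => v _.
rewrite bfZ /bf mulmxA.
have -> : u *m (score E (th t) (take t y) v)^T =
    (dotv u (score E (th t) (take t y) v))%:M.
  apply/matrixP => i j; rewrite !ord1 !mxE mulr1n.
  by apply: eq_bigr => k _; rewrite mxE.
rewrite mul_scalar_mx dotvZl [dotv _ w]dotvC mulrA cond_score -mulrA mulrCA.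
by rewrite cond_score mulrCA.
Qed.

Lemma fisher_coord th t (u : 'rV_(d t)) i :
  (u *m fisher E th t) 0 i = avg_cov th u (delta_mx 0 i).
Proof. by rewrite -fisherE dotvC dotv_delta. Qed.

Lemma fisher_sym th t : (fisher E th t)^T = fisher E th t.
Proof.
apply/matrixP => i j; rewrite mxE.
have e k l : fisher E th t k l = avg_cov th (delta_mx 0 k) (delta_mx 0 l).
  by rewrite -fisher_coord -rowE mxE.
rewrite !e; apply: eq_bigr => y _; congr (_ * _); apply: eq_bigr => v _.
by congr (_ * _); rewrite mulrC.
Qed.

Lemma qform_fisher th t (u : 'rV_(d t)) : qform (fisher E th t) u = avg_cov th u u.
Proof. by rewrite /qform mulmx_dotv fisherE. Qed.

Lemma law_score_sq th t (w : 'rV_(d t)) :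
  \sum_y law E th y * law_score th w y ^+ 2 = avg_cov th w w.
Proof.
rewrite (expect_tower E th t (fun z v => dscore E z (th t) w v ^+ 2)).
by apply: eq_bigr => y _; congr (_ * _); apply: eq_bigr => v _; rewrite expr2.
Qed.

(** * Conditional harm, its gradient and the horizon *)

Section HarmGradient.
Variable Harm : T.-tuple V -> R.

(** The derivative of the expected harm in block [t] along [w], obtained by differentiating the law
    under the sum. *)
Definition harm_dir th t (w : 'rV_(d t)) := \sum_y law E th y * (Harm y * law_score th w y).

(** The characteristic property of a conditional expectation; the 0 / 0 in [harm_cond] is harmless
    because such prefixes carry no weight. *)
Lemma harm_cond_expect th m (phi : seq V -> R) : (m <= T)%N ->
  \sum_y law E th y * (phi (take m y) * harm_cond E Harm th (take m y)) =
  \sum_y law E th y * (phi (take m y) * Harm y).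
Proof.
move=> mT; pose P y y' := take m y' == take m y.
pose W y := \sum_(y' | P y y') law E th y'.
have sz y : size (take m y) = m by rewrite size_takel ?size_tuple.
have Pex y y' : P y y' = P y' y by rewrite /P eq_sym.
have WE y y' : P y y' -> W y' = W y.
  by move=> /eqP e; apply: eq_bigl => z; rewrite /P e.
(* A sum over pairs of sequences sharing a prefix; exchanging the order cancels the prefix
   probability [W]. *)
transitivity (\sum_y \sum_(y' | P y y')
    law E th y / W y' * (phi (take m y') * (law E th y' * Harm y'))).
  apply: eq_bigr => y _; rewrite /harm_cond sz -/(P y) mulrA mulr_suml mulr_sumr.
  apply: eq_bigr => y' yy'; rewrite (WE _ _ yy') (eqP yy').
  by rewrite -/(W y); ring.
rewrite (exchange_big_dep xpredT)//=; apply: eq_bigr => y _.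
rewrite (eq_bigl (P y)) => [|y']; last by rewrite Pex.
rewrite -!mulr_suml -/(W y).
have [->|y0] := eqVneq (law E th y) 0; first by rewrite !mul0r !mulr0.
rewrite divff ?mul1r; first by ring.
rewrite gt_eqF// /W (bigD1 y)/= /P ?eqxx// ltr_wpDr//.
  by apply: sumr_ge0 => *; exact: law_ge0.
by rewrite lt_neqAle eq_sym y0 law_ge0.
Qed.

Lemma harm_cond_last th y : law E th y != 0 -> harm_cond E Harm th (take T y) = Harm y.
Proof.
move=> y0; have -> : take T y = y :> seq V by rewrite take_oversize// size_tuple.
have h : (fun y' : T.-tuple V => take (size y) y' == y) =1 pred1 y.
  move=> y'; rewrite take_oversize ?size_tuple//.
by rewrite /harm_cond !(big_pred1 y)// mulrAC divff// mul1r.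
Qed.

Lemma rcons_take_tnth y t : rcons (take t y) (tnth y t) = take t.+1 y.
Proof. by rewrite (tnth_nth (tnth y t)) -take_nth// size_tuple. Qed.

(** The score at [t] is a function of the tokens up to and including position [t], so conditioning
    the harm on them can be undone. *)
Lemma harm_score_next th t (w : 'rV_(d t)) :
  \sum_y law E th y * (harm_cond E Harm th (take t.+1 y) * law_score th w y) =
  harm_dir th w.
Proof.
have [v0 _] := carrier_neq0 E t [::].
pose phi z := dscore E (take t z) (th t) w (nth v0 z t).
have e y : law_score th w y = phi (take t.+1 y).
  by rewrite /phi take_takel ?leqnSn// nth_take// /law_score (tnth_nth v0).
transitivity (\sum_y law E th y * (phi (take t.+1 y) * harm_cond E Harm th (take t.+1 y))).
  by apply: eq_bigr => y _; rewrite e [phi _ * _]mulrC.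
rewrite harm_cond_expect ?ltn_ord//; apply: eq_bigr => y _.
by rewrite e [Harm y * _]mulrC.
Qed.

Lemma dotv_harm_grad th t (w : 'rV_(d t)) : dotv w (harm_grad E Harm th t) = harm_dir th w.
Proof.
rewrite -harm_score_next /harm_grad /vexpect dotv_sumr.
rewrite (eq_bigr (fun y => law E th y * \sum_v cond E (th t) (take t y) v *
   (harm_cond E Harm th (rcons (take t y) v) * dscore E (take t y) (th t) w v))).
  rewrite -(expect_tower E th t (fun z v =>
    harm_cond E Harm th (rcons z v) * dscore E z (th t) w v)).
  by apply: eq_bigr => y _; rewrite rcons_take_tnth.
by move=> y _; rewrite dotvZr dotv_vcov.
Qed.

(** For [w = G *m invmx F] the score along [w] is the projection of the martingale increment of the
    harm on the scores at [t]. The residual has mean square [I_t - 2 q + q], where [q] is the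
    left-hand side, and this is nonnegative. *)
Lemma harm_grad_le_info th t : posdef (fisher E th t) ->
  qform (invmx (fisher E th t)) (harm_grad E Harm th t) <= harm_info E Harm th t.
Proof.
move=> Fpos; set G := harm_grad _ _ _ _; set F := fisher _ _ _.
pose w := G *m invmx F.
have qE : qform (invmx F) G = harm_dir th w.
  by rewrite -dotv_harm_grad /qform mulmx_dotv.
have qE' : qform (invmx F) G = avg_cov th w w.
  by rewrite -(qform_invmx Fpos) qform_fisher.
(* The [0] is kept in order to be rewritten as the pairing of the previous conditional harm with the
   score. *)
have key : \sum_y law E th y * (harm_cond E Harm th (take t.+1 y) -
    harm_cond E Harm th (take t y) - law_score th w y) ^+ 2 =
  harm_info E Harm th t - 2 * (harm_dir th w - 0) + avg_cov th w w.
  rewrite -[X in _ - 2 * (_ - X)](expect_dscore E th w (harm_cond E Harm th)).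
  rewrite -harm_score_next -law_score_sq /harm_info /expect -sumrB mulr_sumr.
  rewrite -sumrB -big_split/=; apply: eq_bigr => y _.
  by rewrite /law_score; ring.
have : 0 <= \sum_y law E th y * (harm_cond E Harm th (take t.+1 y) -
    harm_cond E Harm th (take t y) - law_score th w y) ^+ 2.
  by apply: sumr_ge0 => y _; rewrite mulr_ge0 ?law_ge0 ?sqr_ge0.
rewrite key -qE -qE'; lra.
Qed.

Section Horizon.
Variables (thb : params R d) (k : nat).
Hypothesis hk : forall t, (k <= t)%N -> harm_info E Harm thb t = 0.

(** Zero information at a position means that its token leaves the conditional harm unchanged on the
    support; chaining leads from length [k] to length [T], where the conditional harm is [Harm]
    itself. *)
Lemma harm_prefix y : law E thb y != 0 -> (k <= T)%N ->
  Harm y = harm_cond E Harm thb (take k y).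
Proof.
move=> y0 kT; rewrite -[LHS](harm_cond_last y0) -[X in take X _](subnKC kT).
have : (k + (T - k) <= T)%N by rewrite subnKC.
elim: (T - k)%N => [|j IH] kjT; first by rewrite addn0.
rewrite addnS in kjT *; rewrite -IH ?(ltnW kjT)//.
have /eqP := hk (t := Ordinal kjT) (leq_addr _ _).
rewrite psumr_eq0 => [|z _]; last by rewrite mulr_ge0 ?law_ge0 ?sqr_ge0.
move=> /allP /(_ y); rewrite mem_index_enum => /(_ isT) /=.
by rewrite mulf_eq0 (negbTE y0) sqrf_eq0 subr_eq0 => /eqP.
Qed.

(** This holds at every [th] although the horizon is taken at [thb]: supports coincide, so the harm
    is there a function of the first [k] tokens, to which the score at [t] is orthogonal. *)
Lemma harm_dir_horizon th t (w : 'rV_(d t)) : (k <= t)%N -> harm_dir th w = 0.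
Proof.
move=> kt; have kT : (k <= T)%N by apply: leq_trans kt _; rewrite ltnW.
rewrite -(expect_dscore E th w (fun z => harm_cond E Harm thb (take k z))).
apply: eq_bigr => y _; have [->|y0] := eqVneq (law E th y) 0; first by rewrite !mul0r.
by rewrite take_takel// -harm_prefix// (law_eq0 _ _ th).
Qed.

Lemma harm_grad_horizon t : (k <= t)%N -> harm_grad E Harm thb t = 0.
Proof.
move=> kt; apply/rowP => i; rewrite -dotv_delta dotv_harm_grad mxE.
exact: harm_dir_horizon.
Qed.

End Horizon.
End HarmGradient.

(** * Derivative of the objective in one block *)

Section Objective.
Context (thb : params R d) (Harm : T.-tuple V -> R) (Rec : {set V})
  (Q : T.-tuple V -> R) (gamma : R).

Definition rec_dir t (x w : 'rV[R]_(d t)) :=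
  - \sum_y Q y * \sum_(v in Rec) cond E x (take t y) v * dscore E (take t y) x w v.

Lemma dotv_rec_grad t (x w : 'rV[R]_(d t)) :
  dotv w (rec_grad E Rec Q x) = rec_dir x w.
Proof.
rewrite /rec_grad dotvNr; congr (- _); rewrite dotv_sumr; apply: eq_bigr => y _.
rewrite dotvZr dotv_vcov; congr (_ * _); rewrite [RHS]big_mkcond/=.
by apply: eq_bigr => v _; case: ifP => _; rewrite ?mul1r// mul0r mulr0.
Qed.

(** The part of the derivative, in block [t], of the divergence at position [s] that comes from the
    changing law of prefixes. *)
Definition kl_dir th t s (w : 'rV_(d t)) := \sum_y law E th y *
  (rel_ent E (take s y) (thb s) (th s) * law_score th w y).

Lemma kl_dir_past th t s (w : 'rV_(d t)) : (s <= t)%N -> kl_dir th s w = 0.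
Proof.
move=> st; rewrite -(expect_dscore E th w
  (fun z => rel_ent E (take s z) (thb s) (th s))).
by apply: eq_bigr => y _; rewrite take_takel.
Qed.

Definition grad_dir (lam mu : R) th t (w : 'rV_(d t)) := lam * harm_dir Harm th w
  + mu * (gamma ^+ t * rec_dir (th t) w)
  + (\sum_(s < T) kl_dir th s w + avg_cov th w (th t - thb t)).

Local Notation H := (H_deep E thb Harm Rec Q gamma).

Lemma H_deepE lam mu th : H lam mu th =
  lam * \sum_y law E th y * Harm y
  + mu * \sum_y Q y * \sum_(t < T) gamma ^+ t * (1 - rec_prob E Rec (th t) (take t y))
  + \sum_(s < T) \sum_y law E th y * rel_ent E (take s y) (thb s) (th s).
Proof. by rewrite /H_deep kl_law. Qed.

Lemma isd_H_deep lam mu th t (x w : 'rV_(d t)) (r : R) :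
  is_derive r (1 : R) (fun z => H lam mu (upd th (x + z *: w : 'rV_(d t))))
    (grad_dir lam mu (upd th (x + r *: w)) w).
Proof.
set th' := upd th (x + r *: w).
have tht : th' t = x + r *: w by rewrite /th' upd_same.
have h1 : is_derive r (1 : R) (fun z => \sum_y law E (upd th (x + z *: w)) y * Harm y)
    (harm_dir Harm th' w).
  apply: is_derive_eq (isd_sum _ _ (fun y => isdM (isd_law th x w y r) (isd_cst _ r))) _.
  by apply: eq_bigr => y _; rewrite mulr0 addr0 -/th' mulrAC -!mulrA.
have h2 : is_derive r (1 : R) (fun z => \sum_y Q y * \sum_(s < T) gamma ^+ s *
    (1 - rec_prob E Rec (upd th (x + z *: w) s) (take s y)))
    (gamma ^+ t * rec_dir (th' t) w).
  pose D y (s : 'I_T) := if s == t then gamma ^+ t *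
    (0 - \sum_(v in Rec) cond E (th' t) (take t y) v * dscore E (take t y) (th' t) w v) else 0.
  have hD y s : is_derive r (1 : R) (fun z => gamma ^+ s *
      (1 - rec_prob E Rec (upd th (x + z *: w) s) (take s y))) (D y s).
    rewrite /D; case: (eqVneq s t) => [->|st].
      apply: isdZ; apply: isdB (isd_cst _ _) _; rewrite tht.
      rewrite (_ : (fun _ => _) = fun z => \sum_(v in Rec) cond E (x + z *: w) (take t y) v).
        by apply: isd_sum => v; exact: isd_cond.
      by apply/funext => z; rewrite upd_same.
    rewrite (_ : (fun _ => _) = fun=> gamma ^+ s * (1 - rec_prob E Rec (th s) (take s y))).
      exact: isd_cst.
    by apply/funext => z; rewrite upd_other// eq_sym.
  apply: is_derive_eq (isd_sum _ _ (fun y => isdZ (Q y) (isd_sum _ _ (hD y)))) _.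
  rewrite /rec_dir mulrN mulr_sumr -sumrN; apply: eq_bigr => y _.
  rewrite (bigD1 t)//= big1 => [|s /negbTE st]; last by rewrite /D st.
  by rewrite /D eqxx sub0r addr0 !mulrN mulrCA.
(* Product rule: the law contributes [kl_dir], and the relative entropy itself moves only when
   [s = t]. *)
have h3 s : is_derive r (1 : R) (fun z => \sum_y law E (upd th (x + z *: w)) y *
    rel_ent E (take s y) (thb s) (upd th (x + z *: w) s))
    (kl_dir th' s w + (s == t)%:R * avg_cov th' w (th' t - thb t)).
  apply: is_derive_eq.
    apply: isd_sum => y; apply: isdM; first exact: isd_law.
    suff : is_derive r (1 : R) (fun z => rel_ent E (take s y) (thb s) (upd th (x + z *: w) s))
      ((s == t)%:R * cov_stat E (take t y) (th' t) w (th' t - thb t)) by apply.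
    case: (eqVneq s t) => [->|st].
      rewrite mul1r tht (_ : (fun _ => _) = fun z => rel_ent E (take t y) (thb t) (x + z *: w)).
        exact: isd_rel_ent.
      by apply/funext => z; rewrite upd_same.
    rewrite mul0r (_ : (fun _ => _) = fun=> rel_ent E (take s y) (thb s) (th s)).
      exact: isd_cst.
    by apply/funext => z; rewrite upd_other// eq_sym.
  rewrite -/th' mulr_sumr -big_split/=; apply: eq_bigr => y _.
  by ring.
rewrite (_ : (fun _ => _) = fun z =>
  lam * \sum_y law E (upd th (x + z *: w)) y * Harm y
  + mu * \sum_y Q y * \sum_(s < T) gamma ^+ s *
       (1 - rec_prob E Rec (upd th (x + z *: w) s) (take s y))
  + \sum_(s < T) \sum_y law E (upd th (x + z *: w)) y *
       rel_ent E (take s y) (thb s) (upd th (x + z *: w) s)); last first.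
  by apply/funext => z; rewrite H_deepE.
apply: is_derive_eq (isdD (isdD (isdZ _ h1) (isdZ _ h2)) (isd_sum _ _ h3)) _.
rewrite /grad_dir big_split/=; congr (_ + (_ + _)).
rewrite (bigD1 t)//= eqxx mul1r big1 ?addr0// => s /negbTE->.
by rewrite mul0r.
Qed.

Lemma minimizer_grad lam mu th t (w : 'rV_(d t)) : is_minimizer (H lam mu) th ->
  grad_dir lam mu th w = 0.
Proof.
move=> hmin; pose f z := H lam mu (upd th (th t + z *: w)).
have e0 : upd th (th t + 0 *: w) = th by rewrite scale0r addr0 upd_id.
have := isd_H_deep lam mu th (th t) w 0; rewrite e0 => df.
apply: (isd_min df) => z; last by rewrite e0; exact: hmin.
by case: (isd_H_deep lam mu th (th t) w z).
Qed.

End Objective.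
End Gradients.

(** * Estimates near the base model *)

Section Estimates.
Context {R : realType} {V : finType} {T : nat} {d : 'I_T -> nat}.
Context (E : seq_exp_family R V d) (thb : params R d).
Implicit Types (s t : 'I_T) (y : T.-tuple V) (a b th : params R d).

Definition dst a b : R := \sum_t norm1 (a t - b t).

Lemma dst_ge0 a b : 0 <= dst a b.
Proof. by apply: sumr_ge0 => t _; exact: norm1_ge0. Qed.

Lemma dst_pos t a b : norm1 (a t - b t) <= dst a b.
Proof. by rewrite /dst (bigD1 t)//= lerDl sumr_ge0// => *; exact: norm1_ge0. Qed.

Lemma dst_id a : dst a a = 0.
Proof. by apply: big1 => t _; rewrite subrr norm10. Qed.

Lemma dst_le a b (r : R) : (forall t, norm1 (a t - b t) <= r) -> dst a b <= T%:R * r.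
Proof.
move=> h; apply: le_trans (ler_sum _ (fun t _ => h t)) _.
by rewrite sumr_const card_ord mulr_natl.
Qed.

Lemma dst_dist a b : `|dst a thb - dst b thb| <= dst a b.
Proof.
rewrite /dst -sumrB; apply: le_trans (ler_norm_sum _ _ _) _.
apply: ler_sum => t _; apply: le_trans (norm1_dist _ _) _.
by rewrite opprB addrA subrK.
Qed.

Lemma dst_eq a b : dst a b <= 0 -> a = b.
Proof.
move=> h; apply: functional_extensionality_dep => t.
by apply/eqP; rewrite -subr_eq0 (@norm1_eq0 _ _ (a t - b t))// (le_trans (dst_pos _ _ _)).
Qed.

(* [flat j f] : on the ball of radius [rho] around [thb], [f] is [O(rho ^ j)]
   with Lipschitz constant [O(rho ^ (j - 1))] (truncated subtraction). *)
Definition flat (j : nat) (f : params R d -> R) :=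
  exists2 C : R, 0 <= C & forall rho : R, 0 <= rho <= 1 ->
    forall a b, dst a thb <= rho -> dst b thb <= rho ->
    `|f a| <= C * rho ^+ j /\ `|f a - f b| <= C * rho ^+ j.-1 * dst a b.

Lemma flat_ext j f g : (forall a, f a = g a) -> flat j f -> flat j g.
Proof. by move=> /funext->. Qed.

Lemma flat_cst c : flat 0 (fun=> c).
Proof.
exists `|c| => // rho /andP[r0 _] a b _ _; rewrite expr0 mulr1 lexx subrr normr0.
by rewrite !mulr_ge0// dst_ge0.
Qed.

Lemma flatD j f g : flat j f -> flat j g -> flat j (fun a => f a + g a).
Proof.
move=> [C C0 hf] [D D0 hg]; exists (C + D) => [|rho r01 a b ha hb].
  exact: addr_ge0.
have [f1 f2] := hf _ r01 _ _ ha hb; have [g1 g2] := hg _ r01 _ _ ha hb.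
split; rewrite !mulrDl; first by apply: le_trans (ler_normD _ _) _; exact: lerD.
by rewrite opprD addrACA; apply: le_trans (ler_normD _ _) _; exact: lerD.
Qed.

Lemma flatM i j f g : flat i f -> flat j g -> flat (i + j) (fun a => f a * g a).
Proof.
move=> [C C0 hf] [D D0 hg]; exists (2 * (C * D)) => [|rho r01 a b ha hb].
  by rewrite !mulr_ge0.
have /andP[r0 r1] := r01.
have [f1 f2] := hf _ r01 _ _ ha hb; have [g1 g2] := hg _ r01 _ _ ha hb.
have [f3 _] := hf _ r01 _ _ hb ha.
have CD0 : 0 <= C * D by exact: mulr_ge0.
have d0 := dst_ge0 a b.
split.
  rewrite normrM; apply: le_trans (ler_pM _ _ f1 g1) _ => //.
  rewrite mulrACA -exprD ler_wpM2r ?exprn_ge0// ler_peMl//; lra.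
have -> : f a * g a - f b * g b = (f a - f b) * g a + f b * (g a - g b) by ring.
apply: le_trans (ler_normD _ _) _; rewrite !normrM.
have h1 : `|f a - f b| * `|g a| <= C * D * rho ^+ (i + j).-1 * dst a b.
  apply: le_trans (ler_pM _ _ f2 g1) _ => //.
  have -> : C * rho ^+ i.-1 * dst a b * (D * rho ^+ j) =
    C * D * (rho ^+ (i.-1 + j)) * dst a b by rewrite exprD; ring.
  rewrite ler_wpM2r// ler_wpM2l//; apply: ler_wiXn2l => //.
  by case: i {f1 f2 f3 hf} => [|i] //=; rewrite leq_pred.
have h2 : `|f b| * `|g a - g b| <= C * D * rho ^+ (i + j).-1 * dst a b.
  apply: le_trans (ler_pM _ _ f3 g2) _ => //.
  have -> : C * rho ^+ i * (D * rho ^+ j.-1 * dst a b) =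
    C * D * (rho ^+ (i + j.-1)) * dst a b by rewrite exprD; ring.
  rewrite ler_wpM2r// ler_wpM2l//; apply: ler_wiXn2l => //.
  by case: j {g1 g2 hg h1} => [|j] /=; rewrite ?addn0 ?leq_pred// addnS.
lra.
Qed.

Lemma flat_sub j j' f : (j' <= j)%N -> flat j f -> flat j' f.
Proof.
move=> jj [C C0 hf]; exists C => // rho r01 a b ha hb.
have /andP[r0 r1] := r01; have [f1 f2] := hf _ r01 _ _ ha hb.
split; [apply: le_trans f1 _|apply: le_trans f2 _].
  by rewrite ler_wpM2l//; exact: ler_wiXn2l.
rewrite ler_wpM2r ?dst_ge0// ler_wpM2l//; apply: ler_wiXn2l => //.
by rewrite -!subn1 leq_sub2r.
Qed.

Lemma flatZ j c f : flat j f -> flat j (fun a => c * f a).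
Proof. exact: flatM (flat_cst c). Qed.

Lemma flatB j f g : flat j f -> flat j g -> flat j (fun a => f a - g a).
Proof.
move=> hf hg; apply: flat_ext (flatD hf (flatZ (-1) hg)) => a.
by rewrite mulN1r.
Qed.

Lemma flat0 j : flat j (fun=> 0).
Proof.
exists 0 => // rho _ a b _ _; rewrite subrr normr0 !mul0r//.
Qed.

Lemma flat_sum j (I : Type) (r : seq I) (P : pred I) (F : I -> params R d -> R) :
  (forall i, flat j (F i)) -> flat j (fun a => \sum_(i <- r | P i) F i a).
Proof.
move=> h; elim: r => [|i r IH].
  by apply: flat_ext (flat0 j) => a; rewrite big_nil.
case Pi : (P i); last by apply: flat_ext IH => a; rewrite big_cons Pi.
by apply: flat_ext (flatD (h i) IH) => a; rewrite big_cons Pi.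
Qed.

Lemma flat_prod (I : Type) (r : seq I) (F : I -> params R d -> R) :
  (forall i, flat 0 (F i)) -> flat 0 (fun a => \prod_(i <- r) F i a).
Proof.
move=> h; elim: r => [|i r IH].
  by apply: flat_ext (flat_cst 1) => a; rewrite big_nil.
by apply: flat_ext (flatM (h i) IH) => a; rewrite big_cons.
Qed.

(** Order 0 already includes a bounded Lipschitz constant, which is all that order 1 asks once the
    value at [thb] is subtracted. *)
Lemma flat_center f : flat 0 f -> flat 1 (fun a => f a - f thb).
Proof.
move=> [C C0 hf]; exists C => // rho r01 a b ha hb.
have /andP[r0 r1] := r01.
have hb' : dst thb thb <= rho by rewrite dst_id.
have [_] := hf _ r01 _ _ ha hb'; have [_] := hf _ r01 _ _ ha hb.
rewrite expr0 expr1 !mulr1 => h1 h2; split.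
  by apply: le_trans h2 _; rewrite ler_wpM2l.
by have -> : f a - f thb - (f b - f thb) = f a - f b by ring.
Qed.

Lemma flat_cond t (s : seq V) v : flat 0 (fun a => cond E (a t) s v).
Proof.
have B0 := stat_bound_ge0 E t s.
exists (1 + 2 * stat_bound E t s) => [|rho _ a b _ _].
  by rewrite addr_ge0// mulr_ge0.
rewrite expr0 mulr1; split.
  by apply: le_trans (cond_norm_le1 _ _ _ _) _; rewrite lerDl mulr_ge0.
apply: le_trans (cond_lip _ _ _ _ _) _.
have := dst_pos t a b; have := norm1_ge0 (a t - b t) => h0 h1.
by apply: ler_pM => //; [rewrite mulr_ge0|rewrite lerDr].
Qed.

Lemma flat_law y : flat 0 (fun a => law E a y).
Proof. by apply: flat_prod => t; exact: flat_cond. Qed.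

Lemma flat_dscore t (s : seq V) w v : flat 0 (fun a => dscore E s (a t) w v).
Proof.
apply: flatB (flat_cst _) _; apply: flat_sum => u.
exact: flatM (flat_cond _ _ _) (flat_cst _).
Qed.

Lemma flat_coord t i : flat 1 (fun a => (a t - thb t) 0 i).
Proof.
exists 1 => // rho r01 a b ha hb; rewrite expr1 expr0 !mul1r; split.
  apply: le_trans (norm1_coord _ _) _; exact: le_trans (dst_pos _ _ _) ha.
have -> : (a t - thb t) 0 i - (b t - thb t) 0 i = (a t - b t) 0 i.
  by rewrite !mxE; ring.
apply: le_trans (norm1_coord _ _) _; exact: dst_pos.
Qed.

Lemma flat_rel_ent t (s : seq V) : flat 2 (fun a => rel_ent E s (thb t) (a t)).
Proof.
pose C := (2 * stat_bound E t s) ^+ 2.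
exists C => [|rho /andP[r0 r1] a b ha hb]; first exact: sqr_ge0.
have ha' := le_trans (dst_pos t _ _) ha; have hb' := le_trans (dst_pos t _ _) hb.
split.
  rewrite ger0_norm ?rel_ent_ge0//; apply: le_trans (rel_ent_le _ _ _ _) _.
  by rewrite ler_wpM2l ?sqr_ge0// ler_sqr ?nnegrE ?norm1_ge0.
apply: le_trans (rel_ent_lip _ _ ha' hb') _; rewrite expr1 ler_wpM2l ?dst_pos//.
by rewrite mulr_ge0 ?sqr_ge0.
Qed.

Lemma flat_cov_stat t (s : seq V) w u : flat 0 (fun a => cov_stat E s (a t) w u).
Proof.
apply: flat_sum => v; apply: flatM (flat_cond _ _ _) _.
by apply: (flatM (i := 0) (j := 0)); exact: flat_dscore.
Qed.

Lemma flat_avg_cov t (w u : 'rV_(d t)) : flat 0 (fun a => avg_cov E a w u).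
Proof.
by apply: flat_sum => y; apply: flatM (flat_law _) (flat_cov_stat _ _ _).
Qed.

Lemma avg_cov_sum th t (w u : 'rV_(d t)) :
  avg_cov E th w u = \sum_j u 0 j * avg_cov E th w (delta_mx 0 j).
Proof.
rewrite /avg_cov (eq_bigr (fun y => \sum_j u 0 j *
   (law E th y * cov_stat E (take t y) (th t) w (delta_mx 0 j)))).
  by rewrite exchange_big; apply: eq_bigr => j _; rewrite mulr_sumr.
move=> y _; rewrite -[LHS]mulr1 mulrAC mulr1 /cov_stat.
rewrite (eq_bigr (fun v => \sum_j u 0 j * (cond E (th t) (take t y) v *
  (dscore E (take t y) (th t) w v * dscore E (take t y) (th t) (delta_mx 0 j) v)))).
  rewrite exchange_big mulr_sumr; apply: eq_bigr => j _; rewrite -mulr_sumr; ring.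
move=> v _; rewrite (dscore_sum _ _ _ u) !mulr_sumr; apply: eq_bigr => j _; ring.
Qed.

Context (Harm : T.-tuple V -> R) (Rec : {set V}) (Q : T.-tuple V -> R) (gamma : R).

Lemma flat_harm_dir t (w : 'rV_(d t)) : flat 0 (fun a => harm_dir E Harm a w).
Proof.
apply: flat_sum => y; apply: (flatM (i := 0) (j := 0)) (flat_law _) _.
by apply: flatZ; exact: flat_dscore.
Qed.

Lemma flat_rec_dir t (w : 'rV_(d t)) :
  flat 0 (fun a => gamma ^+ t * rec_dir E Rec Q (a t) w).
Proof.
apply: flatZ; apply: flat_ext (flatZ (-1) _) => [a|].
  by rewrite mulN1r /rec_dir.
apply: flat_sum => y; apply: flatZ; apply: flat_sum => v.
by apply: (flatM (i := 0) (j := 0)); [exact: flat_cond|exact: flat_dscore].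
Qed.

(** What the divergence adds to the derivative beyond its linearization at [thb]: the moving prefix
    laws and the variation of the Fisher form. *)
Definition quad_part t (w : 'rV_(d t)) a := \sum_(s < T) kl_dir E thb a s w
  + (avg_cov E a w (a t - thb t) - avg_cov E thb w (a t - thb t)).

Lemma flat_quad_part t (w : 'rV_(d t)) : flat 2 (quad_part w).
Proof.
apply: flatD.
  apply: flat_sum => s; apply: flat_sum => y.
  apply: (flatM (i := 0) (j := 2)); first exact: flat_law.
  apply: (flatM (i := 2) (j := 0)); first exact: flat_rel_ent.
  exact: flat_dscore.
have h : flat 2 (fun a => \sum_j (a t - thb t) 0 j *
    (avg_cov E a w (delta_mx 0 j) - avg_cov E thb w (delta_mx 0 j))).
  apply: flat_sum => j; apply: (flatM (i := 1) (j := 1)); first exact: flat_coord.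
  exact: (flat_center (flat_avg_cov w (delta_mx 0 j))).
apply: flat_ext h => a.
rewrite (avg_cov_sum a) (avg_cov_sum thb) -sumrB.
by apply: eq_bigr => j _; rewrite mulrBr.
Qed.

(** All of [grad_dir] except the linear Fisher term, which it must balance at a critical point. *)
Definition nonlin (lam mu : R) t (w : 'rV_(d t)) a :=
  lam * harm_dir E Harm a w + mu * (gamma ^+ t * rec_dir E Rec Q (a t) w)
  + quad_part w a.

(** Position and coordinate are packed into one finite type so that a single constant serves. The
    penalties bring the factors [lam] and [mu], the part of order 2 brings [rho]. *)
Lemma nonlin_lip : exists2 C : R, 0 <= C & forall (ti : {t : 'I_T & 'I_(d t)})
  (lam mu rho : R), 0 <= lam -> 0 <= mu -> 0 <= rho <= 1 ->
  forall a b, dst a thb <= rho -> dst b thb <= rho ->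
  let w := delta_mx 0 (tagged ti) in
  `|nonlin lam mu w a| <= C * (lam + mu + rho) /\
  `|nonlin lam mu w a - nonlin lam mu w b| <= C * (lam + mu + rho) * dst a b.
Proof.
apply: uniform_bound => [ti C C' CC h lam mu rho l0 m0 r01 a b ha hb w|[t i]].
  have [h1 h2] := h lam mu rho l0 m0 r01 a b ha hb.
  have /andP[r0 _] := r01; have d0 := dst_ge0 a b.
  split; [apply: le_trans h1 _|apply: le_trans h2 _].
    by rewrite ler_wpM2r// !addr_ge0.
  by rewrite ler_wpM2r// ler_wpM2r// !addr_ge0.
have [C1 C10 h1] := flat_harm_dir (delta_mx 0 i).
have [C2 C20 h2] := flat_rec_dir (delta_mx 0 i).
have [C3 C30 h3] := flat_quad_part (delta_mx 0 i).
exists (C1 + C2 + C3) => [|lam mu rho l0 m0 r01 a b ha hb /=].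
  by rewrite !addr_ge0.
have [h11 h12] := h1 _ r01 _ _ ha hb; have [h21 h22] := h2 _ r01 _ _ ha hb.
have [h31 h32] := h3 _ r01 _ _ ha hb.
have /andP[r0 r1] := r01; have d0 := dst_ge0 a b.
rewrite ?expr0 ?expr1 ?mulr1 /= in h11 h12 h21 h22 h31 h32.
have r2 : rho ^+ 2 <= rho by rewrite expr2 -[leRHS]mulr1 ler_wpM2l.
have k1 : 0 <= C1 * mu by exact: mulr_ge0.
have k2 : 0 <= C1 * rho by exact: mulr_ge0.
have k3 : 0 <= C2 * lam by exact: mulr_ge0.
have k4 : 0 <= C2 * rho by exact: mulr_ge0.
have k5 : 0 <= C3 * lam by exact: mulr_ge0.
have k6 : 0 <= C3 * mu by exact: mulr_ge0.
rewrite /nonlin; set A := harm_dir _ _ _ _ in h11 h12 *.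
set A' := harm_dir _ _ _ _ in h12 *.
set B := gamma ^+ t * _ in h21 h22 *; set B' := gamma ^+ t * _ in h22 *.
set D := quad_part _ a in h31 h32 *; set D' := quad_part _ b in h32 *.
split.
  apply: (@le_trans _ _ (lam * C1 + mu * C2 + C3 * rho)).
    apply: le_trans (ler_normD _ _) _; apply: lerD.
      apply: le_trans (ler_normD _ _) _.
      by rewrite (normrM lam) (normrM mu) (ger0_norm l0) (ger0_norm m0) lerD ?ler_wpM2l.
    by apply: le_trans h31 _; rewrite ler_wpM2l.
  have -> : (C1 + C2 + C3) * (lam + mu + rho) = lam * C1 + mu * C2 + C3 * rho +
    (C1 * mu + C1 * rho + C2 * lam + C2 * rho + C3 * lam + C3 * mu) by ring.
  by rewrite lerDl !addr_ge0.
have -> : lam * A + mu * B + D - (lam * A' + mu * B' + D') =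
  lam * (A - A') + mu * (B - B') + (D - D') by ring.
apply: (@le_trans _ _ ((lam * C1 + mu * C2 + C3 * rho) * dst a b)).
  rewrite !mulrDl; apply: le_trans (ler_normD _ _) _; apply: lerD => //.
  apply: le_trans (ler_normD _ _) _.
  by rewrite (normrM lam) (normrM mu) (ger0_norm l0) (ger0_norm m0) -!mulrA
    lerD ?ler_wpM2l.
rewrite ler_wpM2r//.
have -> : (C1 + C2 + C3) * (lam + mu + rho) = lam * C1 + mu * C2 + C3 * rho +
  (C1 * mu + C1 * rho + C2 * lam + C2 * rho + C3 * lam + C3 * mu) by ring.
by rewrite lerDl !addr_ge0.
Qed.

Hypothesis Fpos : forall t, posdef (fisher E thb t).

Local Notation F t := (fisher E thb t).

Lemma fisher_inv_bound : exists2 K : R, 0 <= K & forall t (v : 'rV_(d t)),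
  norm1 v <= K * norm1 (v *m F t).
Proof.
apply: uniform_bound => [t C C' CC h v|t].
  by apply: le_trans (h v) _; rewrite ler_wpM2r ?norm1_ge0.
have [K K0 hK] := norm1_mulmx (invmx (F t)); exists K => // v.
by have := hK (v *m F t); rewrite mulmxK// posdef_unit.
Qed.

(** The Fisher equations decouple by position, so they can be inverted on any set [P] of positions
    alone; the positions past the horizon are one such set. *)
Lemma params_bound : exists2 K : R, 0 <= K & forall (P : pred 'I_T)
  (v : params R d) (X : R), 0 <= X ->
  (forall t i, P t -> `|(v t *m F t) 0 i| <= X) ->
  \sum_(t | P t) norm1 (v t) <= K * X.
Proof.
have [K K0 hK] := fisher_inv_bound.
exists (\sum_t K * (d t)%:R) => [|P v X X0 h].
  by apply: sumr_ge0 => t _; rewrite mulr_ge0.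
rewrite mulr_suml [leRHS](bigID P)/= -[leLHS]addr0; apply: lerD.
  apply: ler_sum => t Pt; apply: le_trans (hK _ _) _.
  by rewrite -mulrA ler_wpM2l// norm1_le// => i; exact: h.
by apply: sumr_ge0 => t _; rewrite !mulr_ge0.
Qed.

(** The error keeps the square of the block at [t] apart from the full distance: past the horizon
    the former is [O(mu ^ 2)] while the latter is only [O(lam + mu)]. *)
Lemma posKL_quad : exists2 C : R, 0 <= C & forall t a, dst a thb <= 1 ->
  `|posKL E thb a t - 2^-1 * qform (F t) (a t - thb t)| <=
    C * (norm1 (a t - thb t) ^+ 2 * dst a thb).
Proof.
apply: uniform_bound => [t C C' CC h a ha|t].
  apply: le_trans (h a ha) _; rewrite ler_wpM2r// mulr_ge0 ?dst_ge0//.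
  by rewrite sqr_ge0.
pose term a y := law E a y * rel_ent E (take t y) (thb t) (a t) -
   2^-1 * (law E thb y * cov_stat E (take t y) (thb t) (a t - thb t) (a t - thb t)).
have [C C0 hC] : exists2 C : R, 0 <= C & forall y a, dst a thb <= 1 ->
    `|term a y| <= C * (norm1 (a t - thb t) ^+ 2 * dst a thb).
  apply: uniform_bound => [y C C' CC h a ha|y].
    apply: le_trans (h a ha) _; rewrite ler_wpM2r// mulr_ge0 ?dst_ge0//.
    by rewrite sqr_ge0.
  have [C1 C10 h1] := rel_ent_quadratic E t (take t y).
  have [C2 C20 h2] := flat_law y.
  pose B := (2 * stat_bound E t (take t y)) ^+ 2.
  have B0 : 0 <= B by exact: sqr_ge0.
  exists (C1 + C2 * B) => [|a ha]; first by rewrite addr_ge0// mulr_ge0.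
  set u := a t - thb t; set N := norm1 u; set D := dst a thb.
  have N0 : 0 <= N := norm1_ge0 u.
  have D0 : 0 <= D by exact: dst_ge0.
  have ND : N <= D by exact: dst_pos.
  have r01 : 0 <= (1 : R) <= 1 by rewrite ler01 lexx.
  have hb : dst thb thb <= 1 by rewrite dst_id.
  have [_] := h2 _ r01 _ _ ha hb; rewrite expr1n mulr1 -/D => h3.
  have := h1 (thb t) u; have -> : thb t + u = a t by rewrite /u addrC subrK.
  set rel := rel_ent _ _ _ _; set cv := cov_stat _ _ _ _ _ => h4.
  have h5 : `|cv| <= B * (N * N) by exact: cov_stat_le.
  (* The first summand is the cubic Taylor remainder of the relative entropy, the second the effect
     of the changed law on the quadratic form. *)
  have -> : term a y = law E a y * (rel - 2^-1 * cv) +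
     2^-1 * ((law E a y - law E thb y) * cv).
    by rewrite /term -/u -/rel -/cv; ring.
  apply: le_trans (ler_normD _ _) _; rewrite [leRHS]mulrDl; apply: lerD.
    rewrite normrM ger0_norm ?law_ge0//.
    apply: (@le_trans _ _ (1 * (C1 * N ^+ 3))).
      by apply: ler_pM; rewrite ?law_ge0 ?law_le1.
    by rewrite mul1r ler_wpM2l// exprSr ler_wpM2l ?sqr_ge0.
  have -> : C2 * B * (N ^+ 2 * D) = C2 * D * (B * (N * N)) by ring.
  have : `|(law E a y - law E thb y) * cv| <= C2 * D * (B * (N * N)).
    by rewrite normrM; apply: ler_pM.
  have := normr_ge0 ((law E a y - law E thb y) * cv).
  rewrite (normrM 2^-1) (@ger0_norm _ 2^-1) ?invr_ge0//; lra.
exists (#|{: T.-tuple V}|%:R * C) => [|a ha]; first by rewrite mulr_ge0.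
have -> : posKL E thb a t - 2^-1 * qform (F t) (a t - thb t) = \sum_y term a y.
  by rewrite qform_fisher sumrB -mulr_sumr.
apply: le_trans (ler_norm_sum _ _ _) _.
apply: le_trans (ler_sum _ (fun y _ => hC y a ha)) _.
by rewrite sumr_const -[leRHS]mulrA mulr_natl.
Qed.

Definition crit lam mu a :=
  forall t (w : 'rV_(d t)), grad_dir E thb Harm Rec Q gamma lam mu a w = 0.

Definition gvec lam mu t : 'rV[R]_(d t) :=
  lam *: harm_grad E Harm thb t + (mu * gamma ^+ t) *: rec_grad E Rec Q (thb t).

Lemma quad_part_thb t (w : 'rV_(d t)) : quad_part w thb = 0.
Proof.
rewrite /quad_part !subrr addr0; apply: big1 => s _; apply: big1 => y _.
by rewrite rel_ent_id mul0r mulr0.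
Qed.

Lemma nonlin_thb lam mu t (w : 'rV_(d t)) :
  nonlin lam mu w thb = dotv w (gvec lam mu t).
Proof.
rewrite /nonlin quad_part_thb addr0 /gvec dotvDr !dotvZr dotv_harm_grad.
by rewrite dotv_rec_grad mulrA.
Qed.

Lemma avg_covC a t (u w : 'rV_(d t)) : avg_cov E a u w = avg_cov E a w u.
Proof.
apply: eq_bigr => y _; congr (_ * _); apply: eq_bigr => v _; congr (_ * _).
by rewrite mulrC.
Qed.

Lemma crit_fisher lam mu a t i : crit lam mu a ->
  ((a t - thb t) *m F t) 0 i = - nonlin lam mu (delta_mx 0 i) a.
Proof.
move=> /(_ t (delta_mx 0 i)); rewrite fisher_coord avg_covC /grad_dir => h.
by apply/eqP; rewrite -addr_eq0 -[eqbRHS]h /nonlin /quad_part; apply/eqP; ring.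
Qed.

(** [gvec] is the nonlinear part at [thb], so the residual is a difference and the Lipschitz bound
    makes it small. *)
Lemma crit_residual lam mu a t i : crit lam mu a ->
  ((a t - thb t) *m F t + gvec lam mu t) 0 i =
  - (nonlin lam mu (delta_mx 0 i) a - nonlin lam mu (delta_mx 0 i) thb).
Proof.
by move=> h; rewrite mxE (crit_fisher _ h) nonlin_thb dotv_delta opprB addrC.
Qed.

(** Subtracting two critical equations bounds [dst a b] by a multiple of itself. Comparison with
    [thb], which need not be critical, leaves the source term [C * (lam + mu)]. *)
Lemma crit_dist : exists2 C : R, 0 <= C & forall lam mu rho : R,
  0 <= lam -> 0 <= mu -> 0 <= rho <= 1 ->
  forall a b, crit lam mu a -> crit lam mu b -> dst a thb <= rho -> dst b thb <= rho ->
  dst a b <= C * (lam + mu + rho) * dst a b /\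
  dst a thb <= C * (lam + mu) + C * (lam + mu + rho) * dst a thb.
Proof.
have [C C0 hC] := nonlin_lip; have [K K0 hK] := params_bound.
exists (K * C) => [|lam mu rho l0 m0 r01 a b ca cb ha hb]; first exact: mulr_ge0.
have lm0 : 0 <= lam + mu by exact: addr_ge0.
have /andP[r0 _] := r01; have d0 := dst_ge0 a b; have d1 := dst_ge0 a thb.
have hthb rho' : 0 <= rho' -> dst thb thb <= rho' by rewrite dst_id.
split.
  rewrite -!mulrA; apply: (hK xpredT (fun t => a t - b t)).
    by rewrite !mulr_ge0// addr_ge0.
  move=> t i _.
  have -> : (a t - b t) *m F t = (a t - thb t) *m F t - (b t - thb t) *m F t.
    by rewrite -mulmxBl; congr (_ *m _); rewrite opprB addrA subrK.
  rewrite mxE [in X in _ + X]mxE (crit_fisher _ ca) (crit_fisher _ cb) opprK.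
  rewrite addrC mulrA distrC.
  by have [_] := hC (Tagged _ i) lam mu rho l0 m0 r01 a b ha hb.
rewrite -!mulrA -mulrDr; apply: (hK xpredT (fun t => a t - thb t)).
  by rewrite addr_ge0 ?mulr_ge0 ?addr_ge0.
move=> t i _; rewrite (crit_fisher _ ca) normrN.
have [_] := hC (Tagged _ i) lam mu rho l0 m0 r01 a thb ha (hthb _ r0).
have r0' : 0 <= (0 : R) <= 1 by rewrite lexx ler01.
(* At [thb] itself the radius 0 is admissible, which removes [rho] from the bound. *)
have [+ _] := hC (Tagged _ i) lam mu 0 l0 m0 r0' thb thb (hthb 0 (lexx _)) (hthb 0 (lexx _)).
rewrite addr0 /= => h1 h2.
apply: le_trans (lerD h1 (le_trans h2 _)); last by rewrite mulrA.
by rewrite [leRHS]addrC -{1}(subrK (nonlin lam mu (delta_mx 0 i) thb)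
  (nonlin lam mu _ a)) ler_normD.
Qed.

Lemma crit_local : exists rho0 C : R, [/\ 0 < rho0 <= 1, 0 <= C &
  forall lam mu : R, 0 <= lam -> 0 <= mu -> lam + mu <= rho0 ->
  (forall a b, crit lam mu a -> crit lam mu b -> dst a thb <= rho0 ->
     dst b thb <= rho0 -> a = b) /\
  (forall a, crit lam mu a -> dst a thb <= rho0 -> dst a thb <= C * (lam + mu))].
Proof.
have [C C0 hC] := crit_dist.
(* With [lam + mu] and the radius both at most this value, the contraction factor
   [C * (lam + mu + rho0)] is at most one half. *)
have rpos : 0 < (4 * (C + 1))^-1 by rewrite invr_gt0 mulr_gt0// ltr_wpDl.
have r1 : (4 * (C + 1))^-1 <= 1.
  by rewrite invf_le1 ?mulr_gt0 ?ltr_wpDl//; lra.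
set rho0 := (4 * (C + 1))^-1 in rpos r1 *.
exists rho0, (2 * C); split; [by rewrite rpos| by rewrite mulr_ge0|].
move=> lam mu l0 m0 lm.
have key : C * (lam + mu + rho0) <= 2^-1.
  apply: (@le_trans _ _ (C * (2 * rho0))); first by rewrite ler_wpM2l//; lra.
  have -> : C * (2 * rho0) = 2^-1 * (C / (C + 1)) by rewrite /rho0; field; lra.
  by rewrite ler_piMr ?invr_ge0// ler_pdivrMr ?ltr_wpDl// mul1r lerDl.
have r01 : 0 <= rho0 <= 1 by rewrite (ltW rpos).
split=> [a b ca cb ha hb|a ca ha].
  apply: dst_eq; have [h _] := hC _ _ _ l0 m0 r01 _ _ ca cb ha hb.
  have := ler_wpM2r (dst_ge0 a b) key; lra.
have [_ h] := hC _ _ _ l0 m0 r01 _ _ ca ca ha ha.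
have := ler_wpM2r (dst_ge0 a thb) key; lra.
Qed.

(** The bounds [X], [Y], [Z] are left free because their sizes differ by use: with [e = lam + mu],
    they are of order [e], [e], [e ^ 2] in general and [mu], [mu], [mu * e] past the horizon. *)
Lemma posKL_expansion : exists2 C : R, 0 <= C & forall t lam mu a (X Y Z : R),
  dst a thb <= 1 -> norm1 (a t - thb t) <= X -> norm1 (gvec lam mu t) <= Y ->
  norm1 ((a t - thb t) *m F t + gvec lam mu t) <= Z ->
  `|posKL E thb a t - 2^-1 * qform (invmx (F t)) (gvec lam mu t)| <=
    C * (X ^+ 2 * dst a thb + Y * Z + Z ^+ 2).
Proof.
have [C C0 hC] := posKL_quad.
have [K K0 hK] : exists2 K : R, 0 <= K & forall t (u g : 'rV_(d t)),
  `|qform (F t) u - qform (invmx (F t)) g| <=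
    K * (norm1 g * norm1 (u *m F t + g) + norm1 (u *m F t + g) ^+ 2).
  apply: uniform_bound => [t K K' KK h u g|t]; last exact: qform_perturb.
  apply: le_trans (h u g) _; rewrite ler_wpM2r//.
  by rewrite addr_ge0 ?sqr_ge0// mulr_ge0 ?norm1_ge0.
exists (C + K) => [|t lam mu a X Y Z ha hX hY hZ]; first exact: addr_ge0.
have := hC t a ha; have := hK t (a t - thb t) (gvec lam mu t).
set N := norm1 _ in hX *; set G := norm1 (gvec _ _ _) in hY *.
set r := norm1 _ in hZ *; set D := dst a thb.
set q1 := qform (F t) _; set q2 := qform (invmx _) _; set P := posKL _ _ _ _.
have N0 : 0 <= N := norm1_ge0 _; have G0 : 0 <= G := norm1_ge0 _.
have r0 : 0 <= r := norm1_ge0 _; have D0 : 0 <= D := dst_ge0 _ _.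
have X0 := le_trans N0 hX; have Y0 := le_trans G0 hY; have Z0 := le_trans r0 hZ.
move=> h1 h2.
have i1 : N ^+ 2 * D <= X ^+ 2 * D by rewrite ler_wpM2r// ler_sqr.
have i2 : G * r + r ^+ 2 <= Y * Z + Z ^+ 2 by rewrite lerD ?ler_sqr ?ler_pM.
have h1' := le_trans h1 (ler_wpM2l K0 i2).
have h2' := le_trans h2 (ler_wpM2l C0 i1).
have -> : P - 2^-1 * q2 = P - 2^-1 * q1 + 2^-1 * (q1 - q2) by ring.
apply: le_trans (ler_normD _ _) _.
rewrite (normrM 2^-1) (@ger0_norm _ 2^-1) ?invr_ge0//.
have k1 : 0 <= K * (X ^+ 2 * D) by rewrite !mulr_ge0 ?sqr_ge0.
have k2 : 0 <= C * (Y * Z + Z ^+ 2) by rewrite mulr_ge0 ?addr_ge0 ?sqr_ge0 ?mulr_ge0.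
have k3 : 0 <= K * (Y * Z + Z ^+ 2) by rewrite mulr_ge0 ?addr_ge0 ?sqr_ge0 ?mulr_ge0.
have -> : (C + K) * (X ^+ 2 * D + Y * Z + Z ^+ 2) = C * (X ^+ 2 * D) +
  K * (Y * Z + Z ^+ 2) + K * (X ^+ 2 * D) + C * (Y * Z + Z ^+ 2) by ring.
lra.
Qed.

Lemma main_expansion : exists rho0 C : R, [/\ 0 < rho0 <= 1, 0 <= C &
  forall lam mu : R, 0 <= lam -> 0 <= mu -> lam + mu <= rho0 ->
  forall a, crit lam mu a -> dst a thb <= rho0 -> forall t,
  `|posKL E thb a t - 2^-1 * qform (invmx (F t)) (gvec lam mu t)| <=
    C * (lam + mu) ^+ 3].
Proof.
have [rho0 [C1 [r01 C10 hloc]]] := crit_local.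
have [C2 C20 hnl] := nonlin_lip; have [C3 C30 hexp] := posKL_expansion.
pose n : R := \sum_t (d t)%:R.
have n0 : 0 <= n by exact: sumr_ge0.
have nt t : (d t)%:R <= n by rewrite /n (bigD1 t)//= lerDl sumr_ge0.
pose C := C3 * (C1 ^+ 2 * C1 + (n * C2) * (n * (C2 * (1 + C1) * C1))
  + (n * (C2 * (1 + C1) * C1)) ^+ 2).
have W0 : 0 <= n * (C2 * (1 + C1) * C1) by rewrite !mulr_ge0// addr_ge0.
exists rho0, C; split => //.
  rewrite /C mulr_ge0// addr_ge0 ?sqr_ge0//.
  apply: addr_ge0; apply: mulr_ge0 => //; first exact: sqr_ge0.
  exact: mulr_ge0.
move=> lam mu l0 m0 lm a ca ha t.
have /andP[rpos r1] := r01.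
have [_ hd] := hloc lam mu l0 m0 lm.
have {hd} hd := hd a ca ha.
set e := lam + mu in hd lm *.
have e0 : 0 <= e by exact: addr_ge0.
have e1 : e <= 1 by exact: le_trans lm r1.
set D := dst a thb in hd ha *.
have D0 : 0 <= D := dst_ge0 _ _.
have D1 : D <= 1 by exact: le_trans ha r1.
have D01 : 0 <= D <= 1 by rewrite D0.
have hthb : dst thb thb <= D by rewrite dst_id.
have hX : norm1 (a t - thb t) <= C1 * e by exact: le_trans (dst_pos t _ _) hd.
have hY : norm1 (gvec lam mu t) <= n * C2 * e.
  apply: (@le_trans _ _ ((d t)%:R * (C2 * e))); last first.
    by rewrite -mulrA ler_wpM2r// mulr_ge0.
  apply: norm1_le => i; rewrite -dotv_delta -nonlin_thb.
  have r0 : 0 <= (0 : R) <= 1 by rewrite lexx ler01.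
  have hb0 : dst thb thb <= 0 by rewrite dst_id.
  by have [+ _] := hnl (Tagged _ i) lam mu 0 l0 m0 r0 thb thb hb0 hb0; rewrite addr0.
have hZ : norm1 ((a t - thb t) *m F t + gvec lam mu t) <=
    n * (C2 * (1 + C1) * C1) * e ^+ 2.
  apply: (@le_trans _ _ ((d t)%:R * (C2 * (1 + C1) * C1 * e ^+ 2))); last first.
    rewrite -[leRHS]mulrA ler_wpM2r// !mulr_ge0 ?sqr_ge0// addr_ge0//.
  apply: norm1_le => i; rewrite (crit_residual _ ca) normrN.
  have [_] := hnl (Tagged _ i) lam mu D l0 m0 D01 a thb (lexx _) hthb.
  rewrite -/e -/D /= => h; apply: le_trans h _.
  have -> : C2 * (1 + C1) * C1 * e ^+ 2 = C2 * ((1 + C1) * e) * (C1 * e) by ring.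
  apply: ler_pM => //; first by rewrite mulr_ge0// addr_ge0.
  by rewrite ler_wpM2l// mulrDl mul1r lerD2l.
apply: le_trans (hexp t lam mu a _ _ _ D1 hX hY hZ) _.
rewrite -/D /C -[leRHS]mulrA ler_wpM2l//.
have -> : (C1 ^+ 2 * C1 + n * C2 * (n * (C2 * (1 + C1) * C1)) +
  (n * (C2 * (1 + C1) * C1)) ^+ 2) * e ^+ 3 =
  C1 ^+ 2 * e ^+ 2 * (C1 * e) + n * C2 * e * (n * (C2 * (1 + C1) * C1) * e ^+ 2) +
  (n * (C2 * (1 + C1) * C1)) ^+ 2 * (e ^+ 3 * 1) by ring.
rewrite exprMn; apply: lerD; first by rewrite lerD2r ler_wpM2l// mulr_ge0 ?sqr_ge0.
rewrite exprMn ler_wpM2l ?sqr_ge0//.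
(* The squared residual is of order four; [e <= 1] absorbs one factor. *)
have -> : (e ^+ 2) ^+ 2 = e ^+ 3 * e by ring.
by rewrite ler_wpM2l// exprn_ge0.
Qed.

(** * Positions past the harm horizon *)

Section PastHorizon.
Variable k : nat.
Hypothesis hk : forall t, (k <= t)%N -> harm_info E Harm thb t = 0.
Hypothesis hgamma : 0 <= gamma <= 1.

Definition tail_dst a : R := \sum_(s < T | (k <= s)%N) norm1 (a s - thb s).

Lemma tail_dst_ge0 a : 0 <= tail_dst a.
Proof. by apply: sumr_ge0 => s _; exact: norm1_ge0. Qed.

Lemma tail_dst_pos t a : (k <= t)%N -> norm1 (a t - thb t) <= tail_dst a.
Proof.
by move=> kt; rewrite /tail_dst (bigD1 t)//= lerDl sumr_ge0// => *; exact: norm1_ge0.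
Qed.

Lemma kl_dir_le t s (w : 'rV_(d t)) : exists2 C : R, 0 <= C & forall a,
  `|kl_dir E thb a s w| <= C * norm1 (a s - thb s) ^+ 2.
Proof.
pose c y := (2 * stat_bound E s (take s y)) ^+ 2 * (2 * stat_bound E t (take t y) * norm1 w).
have c0 y : 0 <= c y.
  by rewrite mulr_ge0 ?sqr_ge0// !mulr_ge0 ?norm1_ge0// stat_bound_ge0.
exists (\sum_y c y) => [|a]; first exact: sumr_ge0.
apply: le_trans (ler_norm_sum _ _ _) _; rewrite mulr_suml; apply: ler_sum => y _.
rewrite normrM ger0_norm ?law_ge0//;
apply: (@le_trans _ _ (1 * (c y * norm1 (a s - thb s) ^+ 2))).
  rewrite ler_pM ?law_ge0 ?law_le1// normrM /c mulrAC; apply: ler_pM => //.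
    by rewrite ger0_norm ?rel_ent_ge0// rel_ent_le.
  exact: dscore_le.
by rewrite mul1r.
Qed.

(** The harm drops out, and so do the prefix-law terms of positions before [k]. Those of [s >= k]
    are quadratic in the block at [s], and the Fisher variation is linear in the block at [t]; hence
    the factor [tail_dst] and the absence of [lam]. *)
Lemma tail_residual : exists2 C : R, 0 <= C &
  forall (ti : {t : 'I_T & 'I_(d t)}) (lam mu : R), 0 <= mu ->
  (k <= tag ti)%N -> forall a, dst a thb <= 1 ->
  let w := delta_mx 0 (tagged ti) in
  `|nonlin lam mu w a - nonlin lam mu w thb| <= C * ((mu + tail_dst a) * dst a thb).
Proof.
apply: uniform_bound => [ti C C' CC h lam mu m0 kt a ha /=|[t i]].
  apply: le_trans (h lam mu m0 kt a ha) _; rewrite ler_wpM2r// mulr_ge0 ?dst_ge0//.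
  by rewrite addr_ge0 ?tail_dst_ge0.
pose w := delta_mx 0 i : 'rV[R]_(d t).
have [C2 C20 h2] := flat_rec_dir w.
have [C3 C30 h3] : exists2 C : R, 0 <= C & forall s a,
    `|kl_dir E thb a s w| <= C * norm1 (a s - thb s) ^+ 2.
  apply: uniform_bound => [s C C' CC h a|s]; last exact: kl_dir_le.
  by apply: le_trans (h a) _; rewrite ler_wpM2r// sqr_ge0.
have [C4 C40 h4] : exists2 C : R, 0 <= C & forall j a, dst a thb <= 1 ->
    `|avg_cov E a w (delta_mx 0 j) - avg_cov E thb w (delta_mx 0 j)| <= C * dst a thb.
  apply: uniform_bound => [j C C' CC h a ha|j].
    by apply: le_trans (h a ha) _; rewrite ler_wpM2r// dst_ge0.
  have [C C0 h] := flat_center (flat_avg_cov w (delta_mx 0 j)); exists C => // a ha.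
  have r01 : 0 <= dst a thb <= 1 by rewrite dst_ge0.
  by have [] := h _ r01 a a (lexx _) (lexx _); rewrite expr1.
exists (C2 + C3 + C4) => [|lam mu m0 kt a ha /=]; first by rewrite !addr_ge0.
rewrite -/w /nonlin !(harm_dir_horizon hk)// quad_part_thb.
set D := dst a thb in ha *; set L := tail_dst a.
have D0 : 0 <= D := dst_ge0 _ _; have L0 : 0 <= L := tail_dst_ge0 _.
have r01 : 0 <= (1 : R) <= 1 by rewrite ler01 lexx.
have hb : dst thb thb <= 1 by rewrite dst_id.
have [_] := h2 _ r01 a thb ha hb; rewrite expr1n mulr1 -/D.
set B := gamma ^+ t * _; set B' := gamma ^+ t * _ => k2.
have k3 : `|quad_part w a| <= (C3 + C4) * (L * D).
  apply: le_trans (ler_normD _ _) _; rewrite mulrDl; apply: lerD.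
    apply: le_trans (ler_norm_sum _ _ _) _; rewrite mulr_suml mulr_sumr.
    rewrite [leRHS]big_mkcond; apply: ler_sum => s _.
    have [ks|sk] := leqP k s; last first.
      by rewrite kl_dir_past ?normr0// ltnW// (leq_trans sk).
    apply: le_trans (h3 s a) _; rewrite ler_wpM2l// expr2 ler_wpM2l ?norm1_ge0//.
    exact: dst_pos.
  rewrite (avg_cov_sum a) (avg_cov_sum thb) -sumrB.
  apply: le_trans (ler_norm_sum _ _ _) _.
  apply: (@le_trans _ _ (norm1 (a t - thb t) * (C4 * D))).
    rewrite mulr_suml; apply: ler_sum => j _.
    by rewrite -mulrBr normrM ler_wpM2l//; exact: h4.
  have -> : C4 * (L * D) = L * (C4 * D) by ring.
  by rewrite ler_wpM2r ?mulr_ge0// tail_dst_pos.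
have -> : lam * 0 + mu * B + quad_part w a - (lam * 0 + mu * B' + 0) =
  mu * (B - B') + quad_part w a by ring.
have -> : (C2 + C3 + C4) * ((mu + L) * D) = mu * (C2 * D) + (C3 + C4) * (L * D) +
   (C2 * (L * D) + (C3 + C4) * (mu * D)) by ring.
apply: le_trans (ler_normD _ _) _; rewrite normrM (ger0_norm m0).
apply: (@le_trans _ _ (mu * (C2 * D) + (C3 + C4) * (L * D))).
  by rewrite lerD// ler_wpM2l.
by rewrite lerDl addr_ge0// !mulr_ge0// addr_ge0.
Qed.

Lemma gvec_tail : exists2 C : R, 0 <= C & forall t lam mu, (k <= t)%N -> 0 <= mu ->
  norm1 (gvec lam mu t) <= C * mu.
Proof.
apply: uniform_bound => [t C C' CC h lam mu kt m0|t].
  by apply: le_trans (h lam mu kt m0) _; rewrite ler_wpM2r.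
exists (norm1 (rec_grad E Rec Q (thb t))) => [|lam mu kt m0]; first exact: norm1_ge0.
rewrite /gvec (harm_grad_horizon hk)// scaler0 add0r norm1Z mulrC ler_wpM2l ?norm1_ge0//.
have /andP[g0 g1] := hgamma.
by rewrite ger0_norm ?mulr_ge0 ?exprn_ge0// ler_piMr// exprn_ile1.
Qed.

(** The tail [L] satisfies a closed inequality: it is at most a multiple of [mu] plus [A * D * L],
    and a small radius lets the last term be absorbed. For [mu = 0] the tail is therefore exactly
    zero. *)
Lemma tail_expansion : exists rho0 C : R, [/\ 0 < rho0 <= 1, 0 <= C &
  forall lam mu : R, 0 <= lam -> 0 <= mu -> lam + mu <= rho0 ->
  forall a, crit lam mu a -> dst a thb <= rho0 ->
  tail_dst a <= C * mu /\ forall t, (k <= t)%N ->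
  `|posKL E thb a t - 2^-1 * qform (invmx (F t)) (gvec lam mu t)| <=
    C * (mu ^+ 2 * (lam + mu))].
Proof.
have [rho1 [C1 [r01 C10 hloc]]] := crit_local.
have [C2 C20 hres] := tail_residual; have [C3 C30 hexp] := posKL_expansion.
have [C4 C40 hg] := gvec_tail; have [K K0 hK] := params_bound.
pose n : R := \sum_t (d t)%:R.
have n0 : 0 <= n by exact: sumr_ge0.
have nt t : (d t)%:R <= n by rewrite /n (bigD1 t)//= lerDl sumr_ge0.
pose A := K * (C2 + C4).
have A0 : 0 <= A by rewrite mulr_ge0// addr_ge0.
(* A radius below this value makes [A * D] at most one half, whence the [4 * A] in [B]. *)
have Apos : 0 < (2 * (A + 1))^-1 by rewrite invr_gt0 mulr_gt0// ltr_wpDl.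
have /andP[rho1pos rho11] := r01.
pose rho0 := Num.min rho1 (2 * (A + 1))^-1.
pose B := 4 * A; pose Z := n * (C2 * ((1 + B) * C1)).
have B0 : 0 <= B by exact: mulr_ge0.
have Z0 : 0 <= Z by rewrite !mulr_ge0// addr_ge0.
pose C := B + C3 * (B ^+ 2 * C1 + C4 * Z + Z ^+ 2).
have C0 : 0 <= C.
  by rewrite addr_ge0// mulr_ge0// addr_ge0 ?sqr_ge0// addr_ge0// mulr_ge0// sqr_ge0.
exists rho0, C; split => //; first by rewrite lt_min rho1pos Apos/= ge_min rho11.
move=> lam mu l0 m0 lm a ca ha.
have lm1 : lam + mu <= rho1 by apply: le_trans lm _; rewrite ge_min lexx.
have ha1 : dst a thb <= rho1 by apply: le_trans ha _; rewrite ge_min lexx.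
have [_ hd] := hloc lam mu l0 m0 lm1.
have {hd} hd := hd a ca ha1.
have haA : dst a thb <= (2 * (A + 1))^-1 by apply: le_trans ha _; rewrite ge_min lexx orbT.
set e := lam + mu in hd lm1 *; set D := dst a thb in hd ha1 haA *.
have e0 : 0 <= e by exact: addr_ge0.
have e1 : e <= 1 by exact: le_trans lm1 rho11.
have D0 : 0 <= D := dst_ge0 _ _; have D1 : D <= 1 := le_trans ha1 rho11.
set L := tail_dst a; have L0 : 0 <= L := tail_dst_ge0 a.
have mu_e : mu <= e by rewrite /e lerDr.
have hLD : L * D <= L by rewrite ler_piMr.
have AD : A * D <= 2^-1.
  apply: (@le_trans _ _ (A * (2 * (A + 1))^-1)); first by rewrite ler_wpM2l.
  have -> : A * (2 * (A + 1))^-1 = 2^-1 * (A / (A + 1)) by field; lra.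
  by rewrite ler_piMr ?invr_ge0// ler_pdivrMr ?ltr_wpDl// mul1r lerDl.
have hL : L <= B * mu.
  have : L <= K * (C2 * ((mu + L) * D) + C4 * mu).
    apply: (hK (fun t : 'I_T => (k <= t)%N) (fun t => a t - thb t)).
      by rewrite addr_ge0 ?mulr_ge0// addr_ge0.
    move=> t i kt.
    have -> : ((a t - thb t) *m F t) 0 i =
      ((a t - thb t) *m F t + gvec lam mu t) 0 i - gvec lam mu t 0 i.
      by rewrite [in RHS]mxE addrK.
    apply: le_trans (ler_normB _ _) _; apply: lerD.
      by rewrite (crit_residual _ ca) normrN; exact: (hres (Tagged _ i)).
    exact: le_trans (norm1_coord _ _) (hg t lam mu kt m0).
  have : K * (C2 * ((mu + L) * D) + C4 * mu) <= A * mu * (1 + D) + A * D * L.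
    rewrite /A -subr_ge0.
    have -> : K * (C2 + C4) * mu * (1 + D) + K * (C2 + C4) * D * L -
      K * (C2 * ((mu + L) * D) + C4 * mu) =
      K * C2 * mu + K * C4 * mu * D + K * C4 * D * L by ring.
    by rewrite !addr_ge0// !mulr_ge0.
  have : A * D * L <= 2^-1 * L by rewrite ler_wpM2r.
  have : A * mu * (1 + D) <= A * mu * 2 by rewrite ler_wpM2l ?mulr_ge0//; lra.
  rewrite /B; lra.
have hCC : C3 * (B ^+ 2 * C1 + C4 * Z + Z ^+ 2) <= C by rewrite /C lerDr.
split=> [|t kt].
  apply: le_trans hL _; rewrite ler_wpM2r// /C lerDl mulr_ge0//.
  by rewrite addr_ge0 ?sqr_ge0// addr_ge0// mulr_ge0// sqr_ge0.
have hX : norm1 (a t - thb t) <= B * mu by exact: le_trans (tail_dst_pos _ kt) hL.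
have hZ : norm1 ((a t - thb t) *m F t + gvec lam mu t) <= Z * (mu * e).
  apply: (@le_trans _ _ ((d t)%:R * (C2 * ((mu + L) * D)))).
    apply: norm1_le => i; rewrite (crit_residual _ ca) normrN.
    exact: (hres (Tagged _ i)).
  rewrite /Z -mulrA; apply: ler_pM => //.
    by rewrite !mulr_ge0// addr_ge0.
  rewrite -mulrA ler_wpM2l//.
  have -> : (1 + B) * C1 * (mu * e) = ((1 + B) * mu) * (C1 * e) by ring.
  by apply: ler_pM => //; [rewrite addr_ge0|rewrite mulrDl mul1r lerD2l].
apply: le_trans (hexp t lam mu a _ _ _ D1 hX (hg t lam mu kt m0) hZ) _.
apply: le_trans _ (ler_wpM2r _ hCC); last by rewrite mulr_ge0 ?sqr_ge0.
rewrite -[leRHS]mulrA ler_wpM2l// -/D.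
have -> : (B ^+ 2 * C1 + C4 * Z + Z ^+ 2) * (mu ^+ 2 * e) =
  (B * mu) ^+ 2 * (C1 * e) + C4 * mu * (Z * (mu * e)) + (Z * mu) ^+ 2 * (e * 1).
  by ring.
apply: lerD; first by rewrite lerD2r ler_wpM2l// sqr_ge0.
have -> : (Z * (mu * e)) ^+ 2 = (Z * mu) ^+ 2 * (e * e) by ring.
by rewrite ler_wpM2l ?sqr_ge0// ler_wpM2l.
Qed.

End PastHorizon.

(** * Localization and existence of minimizers *)

Lemma fisher_lower : exists2 C : R, 0 < C & forall t (v : 'rV_(d t)),
  norm1 v ^+ 2 <= C * qform (F t) v.
Proof.
have [C C0 hC] : exists2 C : R, 0 <= C & forall t (v : 'rV_(d t)),
    norm1 v ^+ 2 <= C * qform (F t) v.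
  apply: uniform_bound => [t C C' CC h v|t].
    by apply: le_trans (h v) _; rewrite ler_wpM2r// qform_ge0.
  have [c c0 hc] := posdef_lower (fisher_sym E thb t) (@Fpos t).
  exists c^-1 => [|v]; first by rewrite invr_ge0 ltW.
  by rewrite mulrC ler_pdivlMr// mulrC.
exists (C + 1) => [|t v]; first by rewrite ltr_wpDl.
by apply: le_trans (hC t v) _; rewrite ler_wpM2r ?qform_ge0// lerDl.
Qed.

Lemma posKL_ge0 a t : 0 <= posKL E thb a t.
Proof. by apply: sumr_ge0 => y _; rewrite mulr_ge0 ?law_ge0 ?rel_ent_ge0. Qed.

(* Radial monotonicity in [a t]; the parameters after [t] do not enter. *)
Lemma posKL_shrink a b t (r : R) : 0 <= r <= 1 ->
  (forall s, (s < t)%N -> b s = a s) -> b t = thb t + r *: (a t - thb t) ->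
  posKL E thb b t <= posKL E thb a t.
Proof.
move=> r01 hs ht.
rewrite /posKL /expect (expect_take_indep E (m := t)
  (fun z => rel_ent E z (thb t) (b t)) (ltnW (ltn_ord t)) hs) ht.
apply: ler_sum => y _; rewrite ler_wpM2l ?law_ge0//.
apply: le_trans (rel_ent_ray_nondecr _ _ _ _ r01) _.
by rewrite addrC subrK.
Qed.

(** The first position displaced by at least [r] is isolated: earlier blocks are kept, later ones
    reset to [thb], and its own block is pulled back to norm [r]. This does not raise the divergence
    there, and the result lies where the quadratic expansion is accurate. *)
Lemma kl_localize (rho : R) : 0 < rho -> exists2 m : R, 0 < m &
  forall a, rho <= dst a thb -> m <= \sum_t posKL E thb a t.
Proof.
move=> rho_gt0; have [C C0 hC] := posKL_quad; have [L L0 hL] := fisher_lower.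
(* Within radius [c] the cubic error is at most half of the quadratic lower bound
   [r ^+ 2 / (2 * L)]. *)
pose c := (4 * (C + 1) * L)^-1.
have c0 : 0 < c by rewrite invr_gt0 !mulr_gt0// ltr_wpDl.
pose rho' := Num.min rho (Num.min 1 c).
have r'0 : 0 < rho' by rewrite !lt_min rho_gt0 ltr01.
have r'1 : rho' <= 1 by rewrite !ge_min lexx orbT.
have r'c : rho' <= c by rewrite !ge_min lexx !orbT.
have r'r : rho' <= rho by rewrite ge_min lexx.
have T1 : 0 < T.+1%:R :> R by [].
(* If all [T] blocks have norm at most [r], the total distance stays below [rho']. *)
pose r := rho' / T.+1%:R.
have r0 : 0 < r by rewrite divr_gt0.
have Tr : T%:R * r <= rho'.
  by rewrite /r mulrCA ler_piMr ?(ltW r'0)// ler_pdivrMr// mul1r ler_nat.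
exists (r ^+ 2 / (4 * L)) => [|a ha]; first by rewrite divr_gt0 ?exprn_gt0 ?mulr_gt0.
have [t0 ht0] : exists t, r <= norm1 (a t - thb t).
  apply: contrapT => /forallNP h.
  have : dst a thb <= T%:R * r.
    by apply: dst_le => t; rewrite ltW// ltNge; apply/negP/h.
  have : T%:R * r < rho'.
    by rewrite /r mulrCA gtr_pMr// ltr_pdivrMr// mul1r ltr_nat.
  by move=> h1 h2; have := le_lt_trans h2 h1; rewrite ltNge (le_trans r'r).
have [t ht hmin] : exists2 t, r <= norm1 (a t - thb t) &
    forall s, (s < t)%N -> norm1 (a s - thb s) < r.
  case: (arg_minnP (P := fun t => r <= norm1 (a t - thb t))
    (fun t : 'I_T => t : nat) ht0) => t ht h.
  exists t => // s st; rewrite ltNge; apply/negP => /h.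
  by rewrite leqNgt st.
have N0 : 0 < norm1 (a t - thb t) by exact: lt_le_trans ht.
pose q := r / norm1 (a t - thb t).
have q01 : 0 <= q <= 1 by rewrite divr_ge0 ?norm1_ge0 ?(ltW r0)//= ler_pdivrMr// mul1r.
pose b : params R d := upd (fun s => if (s < t)%N then a s else thb s)
  (thb t + q *: (a t - thb t)).
have bt : b t = thb t + q *: (a t - thb t) by rewrite /b upd_same.
have bs s : (s < t)%N -> b s = a s.
  by move=> st; rewrite /b upd_other ?st// neq_ltn st orbT.
have bo s : (t < s)%N -> b s = thb s.
  by move=> ts; rewrite /b upd_other ?ltnNge ?(ltnW ts)// neq_ltn ts.
have bN : norm1 (b t - thb t) = r.
  rewrite bt addrAC subrr add0r norm1Z ger0_norm; last by case/andP: q01.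
  by rewrite divfK// gt_eqF.
have bd : dst b thb <= rho'.
  apply: le_trans Tr; apply: dst_le => s.
  case: (ltngtP s t) => [st|ts|/val_inj->]; last by rewrite bN.
    by rewrite bs// ltW// hmin.
  by rewrite bo// subrr norm10 ltW.
apply: (@le_trans _ _ (posKL E thb b t)); last first.
  apply: le_trans (posKL_shrink q01 bs bt) _.
  by rewrite (bigD1 t)//= lerDl sumr_ge0// => *; exact: posKL_ge0.
have := hC t b (le_trans bd r'1); rewrite ler_norml => /andP[+ _].
have := hL t (b t - thb t); rewrite bN => h1 h2.
have h3 : r ^+ 2 / (2 * L) <= 2^-1 * qform (F t) (b t - thb t).
  rewrite ler_pdivrMr ?mulr_gt0//.
  by have -> : 2^-1 * qform (F t) (b t - thb t) * (2 * L) =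
    L * qform (F t) (b t - thb t) by field.
have h4 : C * (r ^+ 2 * dst b thb) <= r ^+ 2 / (4 * L).
  have -> : r ^+ 2 / (4 * L) = (C + 1) * (r ^+ 2 * c) by rewrite /c; field; lra.
  apply: ler_pM => //; first by rewrite mulr_ge0 ?sqr_ge0 ?dst_ge0.
    by rewrite lerDl.
  by rewrite ler_wpM2l ?sqr_ge0// (le_trans bd).
have -> : r ^+ 2 / (4 * L) = r ^+ 2 / (2 * L) - r ^+ 2 / (4 * L) by field; lra.
lra.
Qed.

Section Minimizers.
Hypotheses (hHarm : forall y, 0 <= Harm y <= 1) (hQ : is_dist Q).
Hypothesis hgamma : 0 < gamma <= 1.

Local Notation H := (H_deep E thb Harm Rec Q gamma).

Lemma rec_prob_bounds t (x : 'rV_(d t)) (s : seq V) : 0 <= rec_prob E Rec x s <= 1.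
Proof.
apply/andP; split; first by apply: sumr_ge0 => v _; exact: cond_ge0.
rewrite -(sum_cond E s x) [leRHS](bigID (mem Rec))/= lerDl.
by apply: sumr_ge0 => v _; exact: cond_ge0.
Qed.

Lemma fail_sum_bounds a y :
  0 <= \sum_(t < T) gamma ^+ t * (1 - rec_prob E Rec (a t) (take t y)) <= T%:R.
Proof.
have /andP[g0 g1] := hgamma.
apply/andP; split.
  apply: sumr_ge0 => t _; have /andP[_ p1] := rec_prob_bounds (a t) (take t y).
  by rewrite mulr_ge0 ?exprn_ge0 ?(ltW g0)// subr_ge0.
rewrite -[T in T%:R]card_ord -sumr_const; apply: ler_sum => t _.
have /andP[p0 p1] := rec_prob_bounds (a t) (take t y).
rewrite -[leRHS]mulr1; apply: ler_pM; rewrite ?exprn_ge0 ?(ltW g0) ?subr_ge0//.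
  by rewrite exprn_ile1// ltW.
by rewrite lerBlDr lerDl.
Qed.

Lemma objective_ge lam mu a : 0 <= lam -> 0 <= mu ->
  \sum_t posKL E thb a t <= H lam mu a.
Proof.
move=> l0 m0; rewrite H_deepE -[leLHS]add0r lerD2r addr_ge0// mulr_ge0//.
  by apply: sumr_ge0 => y _; have /andP[h _] := hHarm y; rewrite mulr_ge0 ?law_ge0.
case: hQ => Q0 _; apply: sumr_ge0 => y _.
by have /andP[h _] := fail_sum_bounds a y; rewrite mulr_ge0.
Qed.

Lemma objective_base lam mu : 0 <= lam -> 0 <= mu -> H lam mu thb <= lam + mu * T%:R.
Proof.
move=> l0 m0; rewrite H_deepE [X in _ + X]big1 ?addr0; last first.
  by move=> s _; apply: big1 => y _; rewrite rel_ent_id mulr0.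
apply: lerD.
  rewrite -[leRHS]mulr1 ler_wpM2l// -(sum_law E thb); apply: ler_sum => y _.
  by have /andP[_ h] := hHarm y; rewrite ler_piMr ?law_ge0.
case: hQ => Q0 Q1; rewrite ler_wpM2l// -[leRHS]mul1r -[X in _ <= X * _]Q1 mulr_suml.
apply: ler_sum => y _; rewrite ler_wpM2l//.
by have /andP[] := fail_sum_bounds thb y.
Qed.

Lemma objective_lip lam mu : exists2 C : R, 0 <= C & forall a b,
  dst a thb <= 1 -> dst b thb <= 1 -> `|H lam mu a - H lam mu b| <= C * dst a b.
Proof.
have : flat 0 (H lam mu).
  apply: flat_ext (fun a => esym (H_deepE _ _ _ _ _ _ _ _ a)) _.
  apply: flatD; first apply: flatD.
  - apply: flatZ; apply: flat_sum => y.
    exact: (flatM (i := 0) (j := 0) (flat_law _) (flat_cst _)).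
  - apply: flatZ; apply: flat_sum => y; apply: flatZ; apply: flat_sum => t.
    apply: flatZ; apply: flatB (flat_cst _) _; apply: flat_sum => v.
    exact: flat_cond.
  - apply: flat_sum => s; apply: flat_sum => y.
    apply: (flatM (i := 0) (j := 0) (flat_law _)).
    by apply: flat_sub (flat_rel_ent _ _).
move=> [C C0 h]; exists C => // a b ha hb.
have r01 : 0 <= (1 : R) <= 1 by rewrite ler01 lexx.
by have [_] := h _ r01 _ _ ha hb; rewrite expr0 mulr1.
Qed.

Local Open Scope classical_set_scope.
Local Open Scope ring_scope.

(** The blocks, of different dimensions, are flattened into one row vector indexed by pairs of
    position and coordinate and centred at [thb]; the extreme value theorem applies to the ball seen
    there. *)
Lemma minimizer_exists_ball lam mu : exists2 a, dst a thb <= 1 &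
  forall b, dst b thb <= 1 -> H lam mu a <= H lam mu b.
Proof.
pose I : finType := {t : 'I_T & 'I_(d t)}.
pose unfl (v : 'rV[R]_#|I|) : params R d :=
  fun t => thb t + \row_i v 0 (enum_rank (Tagged (fun t => 'I_(d t)) i : I)).
pose n : R := \sum_t (d t)%:R.
have n0 : 0 <= n by exact: sumr_ge0.
have unfl_lip v w : dst (unfl v) (unfl w) <= n * `|v - w|.
  rewrite /dst mulr_suml; apply: ler_sum => t _.
  apply: norm1_le => i; rewrite /unfl !mxE opprD addrACA subrr add0r.
  have -> : v 0 (enum_rank (Tagged _ i : I)) - w 0 (enum_rank (Tagged _ i : I)) =
    (v - w) 0 (enum_rank (Tagged _ i : I)) by rewrite !mxE.
  rewrite [leRHS]/Num.Def.normr/= mx_normrE.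
  by apply/bigmax_geP; right; exists (0, enum_rank (Tagged _ i : I)).
have unfl_onto a : exists v, unfl v = a.
  exists (\row_j (a (tag (enum_val j)) - thb (tag (enum_val j))) 0 (tagged (enum_val j))).
  apply: functional_extensionality_dep => t; rewrite /unfl; apply/rowP => i.
  by rewrite !mxE enum_rankK/= addrC subrK.
pose A : set 'rV[R]_#|I| := [set v | dst (unfl v) thb <= 1].
have A0 : A !=set0 by have [v hv] := unfl_onto thb; exists v; rewrite /A/= hv dst_id.
have Acl : closed A.
  apply: (@lip_sublevel_closed _ _ (fun v => dst (unfl v) thb) n) => // v w.
  by apply: le_trans (dst_dist _ _) (unfl_lip _ _).
have Abd : bounded_set A.
  exists 1; split=> [|M M1 v Av]; first exact: num_real.
  rewrite /Num.Def.normr/= mx_normrE; apply/bigmax_leP; split=> [|[i j] _ /=].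
    exact: le_trans (ltW M1).
  rewrite ord1 -(enum_valK j); case: (enum_val j) => t l.
  have := dst_pos t (unfl v) thb; rewrite {1}/unfl addrAC subrr add0r.
  have := norm1_coord (\row_i v 0 (enum_rank (Tagged (fun t => 'I_(d t)) i : I))) l.
  rewrite mxE => h1 h2; apply: le_trans h1 _; apply: le_trans h2 _.
  exact: le_trans Av (ltW M1).
have Acpt := bounded_closed_compact Abd Acl.
have [C C0 hC] := objective_lip lam mu.
have Hct : {within A, continuous (fun v => H lam mu (unfl v))}.
  apply: (@lip_within_continuous _ _ _ _ (C * n)); first exact: mulr_ge0.
  move=> v w Av Aw; apply: le_trans (hC _ _ Av Aw) _.
  by rewrite -mulrA ler_wpM2l.
have [v Av vmin] := EVT_min_rV A0 Acpt Hct.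
rewrite inE in Av; exists (unfl v) => // b.
by have [w <-] := unfl_onto b => Aw; apply: vmin; rewrite inE.
Qed.

(** Outside the ball of radius [r] the divergence alone exceeds the value at [thb], so a minimizer
    over the unit ball is global and every minimizer lies inside. *)
Lemma minimizer_local (rho : R) : 0 < rho -> exists2 eps : R, 0 < eps &
  forall lam mu : R, 0 <= lam -> 0 <= mu -> lam + mu < eps ->
  (exists a, is_minimizer (H lam mu) a) /\
  forall a, is_minimizer (H lam mu) a -> crit lam mu a /\ dst a thb <= rho.
Proof.
move=> rho0; pose r := Num.min rho 1.
have r0 : 0 < r by rewrite lt_min rho0 ltr01.
have [m m0 hm] := kl_localize r0.
(* The value at [thb] is at most [lam + mu * T], hence at most [(lam + mu) * (T + 1)]. *)
exists (m / T.+1%:R) => [|lam mu l0 mu0 lm]; first by rewrite divr_gt0.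
have base : H lam mu thb < m.
  apply: le_lt_trans (objective_base l0 mu0) _.
  apply: (@le_lt_trans _ _ ((lam + mu) * T.+1%:R)); last by rewrite -ltr_pdivlMr.
  rewrite mulrDl; apply: lerD; first by rewrite ler_peMr// ler1n.
  by rewrite ler_wpM2l// ler_nat.
have far a : r <= dst a thb -> H lam mu thb < H lam mu a.
  move=> ha; apply: lt_le_trans base _; apply: le_trans (hm a ha) _.
  exact: objective_ge.
split=> [|a amin].
  have [a ha hmin] := minimizer_exists_ball lam mu.
  exists a => b; have [hb|hb] := leP (dst b thb) 1; first exact: hmin.
  apply: le_trans (hmin thb _) (ltW (far b _)); first by rewrite dst_id.
  by rewrite ge_min (ltW hb) orbT.
split=> [t w|]; first exact: minimizer_grad.
have [ha|ha] := leP r (dst a thb).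
  by have := lt_le_trans (far a ha) (amin thb); rewrite ltxx.
by apply: ltW; apply: lt_le_trans ha _; rewrite ge_min lexx.
Qed.

End Minimizers.

End Estimates.

(** * Null sets *)

Section NullSets.
Context {R : realType} {n : nat}.
Hypothesis n_gt0 : (0 < n)%N.
Local Open Scope classical_set_scope.
Local Open Scope ring_scope.
Implicit Types (A : set 'rV[R]_n) (q : 'rV[R]_n * 'rV[R]_n).

Definition box_vol q : R := \prod_(i < n) (q.2 0 i - q.1 0 i).

Definition box_ok q := forall i, q.1 0 i <= q.2 0 i.

Definition in_box q (x : 'rV[R]_n) := forall i, q.1 0 i <= x 0 i <= q.2 0 i.

Lemma box_vol_ge0 q : box_ok q -> 0 <= box_vol q.
Proof. by move=> h; apply: prodr_ge0 => i _; rewrite subr_ge0. Qed.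

(** In dimension 0 the empty product is 1, so degenerate boxes can pad a cover only when [0 < n]. *)
Lemma box_vol0 : box_vol (0, 0) = 0.
Proof. by rewrite /box_vol (bigD1 (Ordinal n_gt0))//= subrr mul0r. Qed.

Lemma box_ok0 : box_ok (0, 0). Proof. by move=> i. Qed.

Lemma lebesgue_nullP A : lebesgue_null A <-> forall e : R, 0 < e ->
  exists F : nat -> 'rV[R]_n * 'rV[R]_n, [/\ forall m, box_ok (F m),
    forall x, A x -> exists m, in_box (F m) x &
    forall N : nat, \sum_(m < N) box_vol (F m) <= e].
Proof.
split=> h e e0.
  by have [a [b [h1 h2 h3]]] := h e e0; exists (fun m => (a m, b m)).
have [F [h1 h2 h3]] := h e e0.
by exists (fun m => (F m).1), (fun m => (F m).2).
Qed.

Lemma null_sub A B : A `<=` B -> lebesgue_null B -> lebesgue_null A.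
Proof.
move=> AB h e e0; have [a [b [h1 h2 h3]]] := h e e0.
by exists a, b; split => // x /AB; exact: h2.
Qed.

Lemma null_seq_cover A : (forall e : R, 0 < e ->
  exists s : seq ('rV[R]_n * 'rV[R]_n), [/\ forall q, q \in s -> box_ok q,
    forall x, A x -> exists2 q, q \in s & in_box q x &
    \sum_(q <- s) box_vol q <= e]) -> lebesgue_null A.
Proof.
move=> h; apply/lebesgue_nullP => e e0; have [s [h1 h2 h3]] := h e e0.
exists (nth (0, 0) s); split=> [m|x /h2[q qs qx]|N].
- have [ms|ms] := ltnP m (size s); first by apply: h1; exact: mem_nth.
  by rewrite nth_default//; exact: box_ok0.
- by exists (index q s); rewrite nth_index.
- apply: le_trans h3; elim: s N h1 {h2} => [|q s IH] [|N] h1.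
  + by rewrite big_ord0 big_nil.
  + by rewrite big_nil big1// => m _; rewrite nth_nil box_vol0.
  + rewrite big_ord0 big_seq; apply: sumr_ge0 => q' /h1; exact: box_vol_ge0.
  + rewrite big_ord_recl big_cons/= lerD2l; apply: IH => q' q's.
    by apply: h1; rewrite inE q's orbT.
Qed.

Lemma null_set0 : lebesgue_null (set0 : set 'rV[R]_n).
Proof.
apply: null_seq_cover => e e0; exists [::]; split => //.
by rewrite big_nil ltW.
Qed.

Lemma sum_pair_le (F : nat -> nat -> R) (s : seq (nat * nat)) (e : nat -> R) (c : R) :
  uniq s -> (forall m j, 0 <= F m j) ->
  (forall m N, \sum_(j < N) F m j <= e m) -> (forall N, \sum_(m < N) e m <= c) ->
  \sum_(p <- s) F p.1 p.2 <= c.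
Proof.
move=> us F0 hF he.
pose K := (\max_(p <- s) (maxn p.1 p.2)).+1.
have hK p : p \in s -> (p.1 < K)%N && (p.2 < K)%N.
  by move=> ps; rewrite !ltnS -geq_max; exact: leq_bigmax_seq.
pose S := [seq (m, j) | m <- iota 0 K, j <- iota 0 K].
have pS : perm_eq s [seq p <- S | p \in s].
  apply: uniq_perm => //.
    rewrite filter_uniq// allpairs_uniq ?iota_uniq//.
    by move=> [? ?] [? ?] _ _ /=.
  move=> p; rewrite mem_filter; apply/idP/andP => [ps|[] //]; split=> //.
  have /andP[p1 p2] := hK p ps.
  by apply/allpairsP; exists p; rewrite !mem_iota/= !add0n; split => //; case: (p).
rewrite (perm_big _ pS) big_filter.
apply: (@le_trans _ _ (\sum_(p <- S) F p.1 p.2)).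
  rewrite [leRHS](bigID (mem s))/= lerDl; exact: sumr_ge0.
rewrite /S big_allpairs/=; apply: le_trans (he K).
rewrite -(big_mkord xpredT e) /index_iota subn0.
apply: ler_sum => m _; apply: le_trans (hF m K).
by rewrite -(big_mkord xpredT (F m)) /index_iota subn0.
Qed.

Lemma half_series_le (c : R) N : 0 <= c -> \sum_(m < N) c / 2 ^+ m.+1 <= c.
Proof.
move=> c0; suff -> : \sum_(m < N) c / 2 ^+ m.+1 = c - c / 2 ^+ N.
  by rewrite lerBlDr lerDl divr_ge0// exprn_ge0.
elim: N => [|N IH]; first by rewrite big_ord0 expr0 divr1 subrr.
rewrite big_ord_recr/= IH exprS; field.
by rewrite expf_neq0.
Qed.

Lemma null_bigcup (A : nat -> set 'rV[R]_n) :
  (forall m, lebesgue_null (A m)) -> lebesgue_null (\bigcup_m A m).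
Proof.
move=> h; apply/lebesgue_nullP => e e0.
have em m : 0 < e / 2 ^+ m.+1 by rewrite divr_gt0// exprn_gt0.
have /choice[F hF] : forall m, exists F : nat -> 'rV[R]_n * 'rV[R]_n,
    [/\ forall j, box_ok (F j), forall x, A m x -> exists j, in_box (F j) x &
    forall N : nat, \sum_(j < N) box_vol (F j) <= e / 2 ^+ m.+1].
  by move=> m; have /lebesgue_nullP := h m; apply.
(* Boxes are enumerated through codes of pairs; numbers coding no pair get the degenerate box. *)
pose G p := if pickle_inv p is Some x then F x.1 x.2 else (0, 0).
exists G; split=> [p|x [m _ Ax]|N].
- rewrite /G; case: pickle_inv => [x|]; last exact: box_ok0.
  by have [] := hF x.1.
- have [_ /(_ x Ax)[j hj] _] := hF m.
  by exists (pickle (m, j)); rewrite /G pickleK_inv.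
- have -> : \sum_(p < N) box_vol (G p) =
      \sum_(x <- pmap pickle_inv (iota 0 N)) box_vol (F x.1 x.2).
    rewrite -(big_mkord xpredT (fun p => box_vol (G p))) /index_iota subn0.
    elim: (iota 0 N) => [|p s IH]; first by rewrite !big_nil.
    rewrite big_cons IH /= /G; case: pickle_inv => [x|] /=.
      by rewrite big_cons.
    by rewrite box_vol0 add0r.
  apply: (@sum_pair_le (fun m j => box_vol (F m j)) _ (fun m => e / 2 ^+ m.+1)).
  + by apply: (pmap_uniq (g := pickle)); [move=> p; exact: pickle_invK|exact: iota_uniq].
  + by move=> m j; apply: box_vol_ge0; have [] := hF m.
  + by move=> m K; have [] := hF m.
  + by move=> K; apply: half_series_le; exact: ltW.
Qed.

Lemma null_bigcup_count (K : countType) (A : K -> set 'rV[R]_n) :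
  (forall i, lebesgue_null (A i)) -> lebesgue_null (\bigcup_i A i).
Proof.
move=> h; apply: (@null_sub _ (\bigcup_p
    if unpickle p is Some i then A i else set0)).
  by move=> x [i _ Ax]; exists (pickle i) => //; rewrite pickleK.
by apply: null_bigcup => p; case: unpickle => [i|]; [exact: h|exact: null_set0].
Qed.

Lemma grid_cell (N : nat) (h z : R) : (0 < N)%N -> 0 <= z <= N%:R * h ->
  exists k : 'I_N, k%:R * h <= z <= k.+1%:R * h.
Proof.
case: N => // N _; elim: N => [|N IH] /andP[z0 zN].
  by exists ord0; rewrite mul0r z0.
have [zN'|zN'] := leP z (N.+1%:R * h).
  by have [|k hk] := IH; [rewrite z0|exists (widen_ord (leqnSn _) k)].
by exists ord_max; rewrite (ltW zN').
Qed.

(* In the column over a grid cell of side [2 r / N] transverse to the [i]-axis,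
   the zeros of [g] have [i]-th coordinates within [O(1 / N)] of each other. *)
Lemma null_zero_cube (g : 'rV[R]_n -> R) (D : 'I_n -> 'rV[R]_n -> R)
    (i : 'I_n) (q : 'rV[R]_n) (r c L : R) :
  0 < r -> 0 < c -> 0 <= L ->
  (forall x w (z : R), is_derive z (1 : R) (fun z => g (x + z *: w))
     (\sum_j w 0 j * D j (x + z *: w))) ->
  let Q := [set x : 'rV[R]_n | forall j, `|x 0 j - q 0 j| <= r] in
  (forall x, Q x -> c <= `|D i x|) -> (forall j x, Q x -> `|D j x| <= L) ->
  lebesgue_null [set x | Q x /\ g x = 0].
Proof.
move=> r0 c0 L0 gD Q Dc DL.
(* Mean value theorem on the segment between two zeros: the change along [i], weighted by at least
   [c], balances the changes along the other axes. *)
have close x y (h : R) : Q x -> Q y -> g x = 0 -> g y = 0 ->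
    (forall j, j != i -> `|y 0 j - x 0 j| <= h) -> 0 <= h ->
    `|y 0 i - x 0 i| <= L * n%:R * h / c.
  move=> Qx Qy gx gy hj h0.
  have [z /andP[z0 z1]] := isd_MVT (gD x (y - x)).
  rewrite scale1r scale0r addr0 [x + (y - x)]addrC subrK gx gy subrr (bigD1 i)//=.
  set p := x + z *: (y - x).
  have Qp : Q p.
    move=> j; have -> : p 0 j - q 0 j = (1 - z) * (x 0 j - q 0 j) + z * (y 0 j - q 0 j).
      by rewrite /p !mxE; ring.
    apply: le_trans (ler_normD _ _) _; rewrite !normrM ger0_norm ?subr_ge0// (ger0_norm z0).
    have : (1 - z) * `|x 0 j - q 0 j| <= (1 - z) * r by rewrite ler_wpM2l ?subr_ge0.
    have : z * `|y 0 j - q 0 j| <= z * r by rewrite ler_wpM2l.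
    lra.
  move/esym/eqP; rewrite addr_eq0 => /eqP e.
  have e1 : (y - x) 0 i = y 0 i - x 0 i by rewrite !mxE.
  rewrite ler_pdivlMr// -e1; apply: (@le_trans _ _ (`|(y - x) 0 i| * `|D i p|)).
    by rewrite ler_wpM2l// Dc.
  rewrite -normrM e normrN; apply: le_trans (ler_norm_sum _ _ _) _.
  apply: (@le_trans _ _ (\sum_(j < n) h * L)); last first.
    by rewrite sumr_const card_ord -mulr_natl le_eqVlt; apply/orP; left; apply/eqP; ring.
  rewrite [leRHS](bigID (predC1 i))/= -[leLHS]addr0 lerD//.
    apply: ler_sum => j ji; rewrite normrM; apply: ler_pM => //; last exact: DL.
    by rewrite !mxE; exact: hj.
  by apply: sumr_ge0 => j _; rewrite mulr_ge0.
apply: null_seq_cover => e e0.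
(* There are [N ^ (n - 1)] columns of base volume [h ^ (n - 1)] and height [2 * w], of total volume
   [P / N]. *)
pose P := (2 * r) ^+ n.-1 * (4 * L * n%:R * r / c).
have P0 : 0 <= P.
  by rewrite mulr_ge0 ?exprn_ge0 ?mulr_ge0 ?invr_ge0 ?(ltW r0) ?(ltW c0).
pose N := (Num.truncn (P / e)).+1.
have NP : P / N%:R <= e.
  rewrite ler_pdivrMr// mulrC -ler_pdivrMr// ltW// /N.
  by have /andP[] := truncn_itv (divr_ge0 P0 (ltW e0)).
have NR : 0 < N%:R :> R by [].
pose h := 2 * r / N%:R; have h0 : 0 <= h by rewrite divr_ge0// mulr_ge0// ltW.
pose w := L * n%:R * h / c.
have w0 : 0 <= w by rewrite /w divr_ge0 ?(ltW c0)// mulr_ge0// mulr_ge0.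
pose Z := [set x | Q x /\ g x = 0].
pose cell (s : {ffun 'I_n -> 'I_N}) (x : 'rV[R]_n) := forall j, j != i ->
  q 0 j - r + (s j)%:R * h <= x 0 j <= q 0 j - r + (s j).+1%:R * h.
have /choice[ctr hctr] : forall s, exists m : R, forall x, Z x -> cell s x -> `|x 0 i - m| <= w.
  move=> s; have [[x [[Qx gx] sx]]|no] := pselect (exists x, Z x /\ cell s x).
    exists (x 0 i) => y [Qy gy] sy; apply: (close x y h) => // j ji.
    have := sx j ji; have := sy j ji; rewrite -natr1 mulrDl mul1r.
    move=> /andP[? ?] /andP[? ?]; rewrite ler_norml; apply/andP; split; lra.
  by exists 0 => x Zx sx; case: no; exists x.
(* Cells are indexed along all axes, [i] included, so that the total volume factors over the axes;
   only index 0 along [i] carries the column, the others collapse to width 0. *)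
pose lo (s : {ffun 'I_n -> 'I_N}) j := if j == i then (if s i == ord0 then ctr s - w else 0)
  else q 0 j - r + (s j)%:R * h.
pose hi (s : {ffun 'I_n -> 'I_N}) j := if j == i then (if s i == ord0 then ctr s + w else 0)
  else q 0 j - r + (s j).+1%:R * h.
pose B (s : {ffun 'I_n -> 'I_N}) : 'rV[R]_n * 'rV[R]_n := (\row_j lo s j, \row_j hi s j).
exists [seq B s | s <- enum {ffun 'I_n -> 'I_N}]; split.
- move=> _ /mapP[s _ ->] j; rewrite !mxE /lo /hi; case: eqP => _.
    by case: eqP => // _; lra.
  by rewrite lerD2l ler_wpM2r// ler_nat.
- move=> x [Qx gx].
  have /fin_all_exists[s hs] : forall j, exists k : 'I_N,
      k%:R * h <= x 0 j - q 0 j + r <= k.+1%:R * h.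
    move=> j; apply: grid_cell => //; have := Qx j.
    rewrite ler_norml => /andP[? ?]; rewrite /h mulrCA divff ?gt_eqF// mulr1.
    apply/andP; split; lra.
  pose s' : {ffun 'I_n -> 'I_N} := [ffun j => if j == i then ord0 else s j].
  have cx : cell s' x.
    move=> j ji; rewrite ffunE (negbTE ji); have := hs j => /andP[? ?].
    apply/andP; split; lra.
  exists (B s'); first by apply: map_f; rewrite mem_enum.
  move=> j; rewrite !mxE /lo /hi; case: eqVneq => [->|ji]; last exact: cx.
  rewrite ffunE eqxx/=; have := hctr s' x (conj Qx gx) cx.
  rewrite ler_norml => /andP[? ?]; apply/andP; split; lra.
- rewrite big_map big_enum/=.
  pose v (j : 'I_n) (k : 'I_N) : R := if j == i then (if k == ord0 then 2 * w else 0) else h.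
  rewrite (eq_bigr (fun s : {ffun 'I_n -> 'I_N} => \prod_j v j (s j))); last first.
    move=> s _; apply: eq_bigr => j _; rewrite !mxE /lo /hi /v.
    case: eqVneq => [->|_]; last by rewrite -natr1; ring.
    by case: eqP => _; ring.
  rewrite -bigA_distr_bigA/=; apply: le_trans NP.
  rewrite (bigD1 i)//= {1}/v eqxx (bigD1 ord0)//= big1 => [|k /negbTE->//].
  rewrite addr0 (eq_bigr (fun=> 2 * r)) => [|j ji]; last first.
    rewrite (eq_bigr (fun=> h)) => [|k _]; last by rewrite /v (negbTE ji).
    by rewrite sumr_const card_ord -[LHS]mulr_natr /h divfK ?gt_eqF.
  rewrite prodr_const cardC1 card_ord /P /w /h le_eqVlt; apply/orP; left; apply/eqP.
  by field; rewrite !gt_eqF.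
Qed.

End NullSets.

(** * Exponential sums and their zeros *)

Section ExponentialSums.
Context {R : realType} {n : nat}.
Implicit Types (l : seq (R * 'rV[R]_n)) (x u w : 'rV[R]_n).

Definition expsum l x : R := \sum_(p <- l) p.1 * expR (dotv x p.2).

Definition expsum_diff l (i : 'I_n) :=
  [seq (p.1 * p.2 0 i, p.2) | p : R * 'rV[R]_n <- l].

Definition expsum_diffs l (b : seq 'I_n) := foldr (fun i l => expsum_diff l i) l b.

Lemma isd_expsum l x w (z : R) :
  is_derive z (1 : R) (fun z => expsum l (x + z *: w))
    (\sum_j w 0 j * expsum (expsum_diff l j) (x + z *: w)).
Proof.
have h (p : R * 'rV[R]_n) : is_derive z (1 : R)
    (fun z => p.1 * expR (dotv (x + z *: w) p.2))
    (p.1 * (dotv w p.2 * expR (dotv (x + z *: w) p.2))).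
  rewrite (_ : (fun _ => _) = fun z => p.1 * expR (dotv x p.2 + z * dotv w p.2)).
    apply: is_derive_eq (isdZ _ (isd_expR (isd_affine (dotv x p.2) (dotv w p.2) z))) _.
    by rewrite dotvDl dotvZl.
  by apply/funext => z'; rewrite dotvDl dotvZl.
apply: is_derive_eq (isd_sum _ _ h) _.
rewrite (eq_bigr (fun p : R * 'rV[R]_n =>
    \sum_j w 0 j * (p.1 * p.2 0 j * expR (dotv (x + z *: w) p.2)))).
  rewrite exchange_big; apply: eq_bigr => j _.
  by rewrite /expsum /expsum_diff big_map mulr_sumr.
move=> p _; rewrite {1}/dotv mulr_suml mulr_sumr; apply: eq_bigr => j _; ring.
Qed.

Lemma expsum_bound l (M : R) : exists2 C : R, 0 <= C &
  forall x, norm1 x <= M -> `|expsum l x| <= C.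
Proof.
exists (\sum_(p <- l) `|p.1| * expR (M * norm1 p.2)) => [|x xM].
  by apply: sumr_ge0 => p _; rewrite mulr_ge0 ?expR_ge0.
apply: le_trans (ler_norm_sum _ _ _) _; apply: ler_sum => p _.
rewrite normrM ler_wpM2l// ger0_norm ?expR_ge0// ler_expR.
apply: le_trans (ler_norm _) _; apply: le_trans (dotv_le _ _) _.
by rewrite ler_wpM2r ?norm1_ge0.
Qed.

Lemma expsum_lip l (M : R) : exists2 C : R, 0 <= C &
  forall x y, norm1 x <= M -> norm1 y <= M ->
  `|expsum l x - expsum l y| <= C * norm1 (x - y).
Proof.
have [C C0 hC] : exists2 C : R, 0 <= C & forall j x, norm1 x <= M ->
    `|expsum (expsum_diff l j) x| <= C.
  apply: uniform_bound => [j C C' CC h x xM|j]; last exact: expsum_bound.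
  exact: le_trans (h x xM) CC.
exists C => // x y xM yM.
have -> : expsum l x - expsum l y =
    expsum l (y + 1 *: (x - y)) - expsum l (y + 0 *: (x - y)).
  by rewrite scale1r scale0r addr0 [y + _]addrC subrK.
apply: (isd_lip (isd_expsum l y (x - y))) => z /andP[z0 z1].
apply: le_trans (ler_norm_sum _ _ _) _; rewrite mulr_sumr.
apply: ler_sum => j _; rewrite normrM mulrC ler_wpM2r// hC//.
have -> : y + z *: (x - y) = z *: x + (1 - z) *: y.
  by apply/rowP => k; rewrite !mxE; ring.
apply: le_trans (norm1D _ _) _; rewrite !norm1Z (ger0_norm z0) ger0_norm ?subr_ge0//.
have : z * norm1 x <= z * M by rewrite ler_wpM2l.
have : (1 - z) * norm1 y <= (1 - z) * M by rewrite ler_wpM2l// subr_ge0.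
lra.
Qed.

(** Newton's scheme: a new node is corrected by a multiple of the polynomial vanishing at the
    earlier ones. *)
Lemma interpolation (S : seq R) (phi : R -> R) :
  exists q : {poly R}, forall s, s \in S -> q.[s] = phi s.
Proof.
elim: S => [|s0 S [q hq]]; first by exists 0.
pose w := \prod_(s <- S) ('X - s%:P).
have w0 s : s \in S -> w.[s] = 0.
  by move=> sS; apply/eqP; rewrite -/(root w s) root_prod_XsubC.
have [s0S|s0S] := boolP (s0 \in S).
  by exists q => s; rewrite inE => /orP[/eqP->|]; exact: hq.
have ws0 : w.[s0] != 0 by rewrite -/(root w s0) root_prod_XsubC.
exists (q + ((phi s0 - q.[s0]) / w.[s0]) *: w) => s.
rewrite inE hornerD hornerZ => /orP[/eqP->|sS].
  by rewrite divfK// addrC subrK.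
by rewrite (w0 s sS) mulr0 addr0 hq.
Qed.

Lemma expsum_diffsE l b x : expsum (expsum_diffs l b) x =
  \sum_(p <- l) p.1 * expR (dotv x p.2) * \prod_(i <- b) p.2 0 i.
Proof.
have e : expsum_diffs l b = [seq (p.1 * \prod_(i <- b) p.2 0 i, p.2) | p : R * 'rV[R]_n <- l].
  elim: b => [|i b IH] /=.
    by rewrite -[LHS]map_id; apply: eq_map => -[p v] /=; rewrite big_nil mulr1.
  rewrite IH /expsum_diff -map_comp; apply: eq_map => -[p v] /=.
  by rewrite big_cons -mulrA; congr (_ * _, _); rewrite mulrC.
rewrite e /expsum big_map; apply: eq_bigr => p _ /=; ring.
Qed.

(* Vanishing of all derivatives at [x] kills every power sum of the exponents
   weighted by the terms of [expsum l x]; interpolating the exponential at the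
   finitely many exponents by a polynomial then gives the value at [x']. *)
Lemma expsum_analytic l x : (forall b, expsum (expsum_diffs l b) x = 0) ->
  forall x', expsum l x' = 0.
Proof.
move=> h x'; pose u := x' - x; pose a (p : R * 'rV[R]_n) := p.1 * expR (dotv x p.2).
(* Expanding one more factor [dotv u p.2] in coordinates lengthens [b], so the induction on [k]
   ranges over all [b]. *)
have key k b : \sum_(p <- l) a p * (\prod_(i <- b) p.2 0 i) * dotv u p.2 ^+ k = 0.
  elim: k b => [|k IH] b.
    by rewrite -[RHS](h b) expsum_diffsE; apply: eq_bigr => p _; rewrite mulr1.
  rewrite (eq_bigr (fun p => \sum_j u 0 j *
      (a p * (\prod_(i <- j :: b) p.2 0 i) * dotv u p.2 ^+ k))).
    by rewrite exchange_big big1// => j _; rewrite -mulr_sumr IH mulr0.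
  move=> p _; rewrite exprS {1}/dotv mulr_suml mulr_sumr; apply: eq_bigr => j _.
  by rewrite big_cons; ring.
have [q hq] := interpolation [seq dotv u p.2 | p <- l] expR.
have -> : expsum l x' = \sum_(p <- l) \sum_(k < size q) q`_k *
    (a p * (\prod_(i <- [::]) p.2 0 i) * dotv u p.2 ^+ k).
  rewrite /expsum !big_seq; apply: eq_bigr => p pl.
  have -> : dotv x' p.2 = dotv x p.2 + dotv u p.2.
    by rewrite -dotvDl /u addrC subrK.
  rewrite expRD -(hq (dotv u p.2)); last exact: (map_f (fun p => dotv u p.2)).
  rewrite horner_coef mulrA mulr_sumr; apply: eq_bigr => k _.
  by rewrite big_nil /a; ring.
by rewrite exchange_big big1// => k _; rewrite -mulr_sumr key mulr0.
Qed.

Local Open Scope classical_set_scope.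
Local Open Scope ring_scope.

Lemma expsum_zeros_null l x0 : (0 < n)%N -> expsum l x0 != 0 ->
  lebesgue_null [set x | expsum l x = 0].
Proof.
move=> n0 l0.
(* A piece records a word of derivatives, a further direction, a cube centred on the grid of mesh
   [1 / (k + 1)], and a lower bound [1 / (m + 1)] for the partial derivative on it. *)
pose K := ((seq 'I_n * 'I_n) * ({ffun 'I_n -> int} * (nat * nat)))%type.
pose ctr (z : {ffun 'I_n -> int}) (k : nat) : 'rV[R]_n := \row_j ((z j)%:~R / k.+1%:R).
pose Q z k := [set x : 'rV[R]_n | forall j, `|x 0 j - ctr z k 0 j| <= k.+1%:R^-1].
pose P (a : K) x := `|expsum (expsum_diff (expsum_diffs l a.1.1) a.1.2) x|.
pose good (a : K) := forall x, Q a.2.1 a.2.2.1 x -> a.2.2.2.+1%:R^-1 <= P a x.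
pose A (a : K) : set 'rV[R]_n := [set x | good a /\
   (Q a.2.1 a.2.2.1 x /\ expsum (expsum_diffs l a.1.1) x = 0)].
apply: (@null_sub _ _ _ (\bigcup_a A a)); last first.
  apply: null_bigcup_count => // -[[b i] [z [k m]]].
  have [ga|nga] := pselect (good (b, i, (z, (k, m)))); last first.
    by apply: null_sub (null_set0 n0) => x [].
  pose g := expsum_diffs l b.
  pose M : R := norm1 (ctr z k) + n%:R * k.+1%:R^-1.
  have [L L0 hL] : exists2 C : R, 0 <= C & forall j x, norm1 x <= M ->
      `|expsum (expsum_diff g j) x| <= C.
    apply: uniform_bound => [j C C' CC h x xM|j]; last exact: expsum_bound.
    exact: le_trans (h x xM) CC.
  apply: (@null_sub _ _ _ [set x | Q z k x /\ expsum g x = 0]).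
    by move=> x [].
  apply: (@null_zero_cube _ _ n0 _ (fun j => expsum (expsum_diff g j)) i
    (ctr z k) k.+1%:R^-1 m.+1%:R^-1 L) => //.
    exact: isd_expsum.
  move=> j x Qx; apply: hL; rewrite -[x](subrK (ctr z k)) addrC.
  apply: le_trans (norm1D _ _) _; rewrite /M lerD2l; apply: norm1_le => i'.
  by rewrite !mxE; have := Qx i'; rewrite !mxE.
move=> x fx.
have [b hb] : exists b, expsum (expsum_diffs l b) x != 0.
  apply: contrapT => no; case/eqP: l0; apply: (expsum_analytic (x := x)) => b.
  by apply/eqP/negPn/negP => hb; apply: no; exists b.
(* The empty word gives 0 at [x] and the word [b] does not, so some extension by one letter passes
   from zero to nonzero. *)
have [b' [i [z0 nz]]] : exists b' i, expsum (expsum_diffs l b') x = 0 /\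
    expsum (expsum_diff (expsum_diffs l b') i) x != 0.
  elim: b hb => [|i b IH] hb; first by rewrite /= fx eqxx in hb.
  have [e|/IH//] := eqVneq (expsum (expsum_diffs l b) x) 0.
  by exists b, i.
set g := expsum_diff _ _ in nz.
have [L L0 hL] := expsum_lip g (norm1 x + n%:R * 2).
(* The cube is chosen so small that [g] varies by at most this half of its value at [x], so at least
   the other half survives on the whole cube. *)
pose c := `|expsum g x| / 2.
have c0 : 0 < c by rewrite divr_gt0 ?normr_gt0.
pose m := Num.truncn c^-1.
have mc : m.+1%:R^-1 <= c.
  have ci0 : 0 <= c^-1 by rewrite invr_ge0 ltW.
  have /andP[_ h] := truncn_itv ci0.
  by rewrite -[leRHS]invrK lef_pV2 ?posrE ?invr_gt0// ltW.
pose k := Num.truncn (L * n%:R * 2 / c).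
have kc : L * (n%:R * (2 * k.+1%:R^-1)) <= c.
  have h0 : 0 <= L * n%:R * 2 / c by rewrite divr_ge0 ?(ltW c0)// !mulr_ge0.
  have /andP[_ h] := truncn_itv h0.
  by rewrite !mulrA ler_pdivrMr// [leRHS]mulrC -ler_pdivrMr// ltW.
pose z : {ffun 'I_n -> int} := [ffun j => Num.floor (x 0 j * k.+1%:R)].
have kpos : 0 < k.+1%:R :> R by [].
have Qx : Q z k x.
  move=> j; rewrite !mxE ffunE; have /andP[h1 h2] := floor_itv (x 0 j * k.+1%:R).
  rewrite intrD in h2.
  have -> : x 0 j - (Num.floor (x 0 j * k.+1%:R))%:~R / k.+1%:R =
    (x 0 j * k.+1%:R - (Num.floor (x 0 j * k.+1%:R))%:~R) / k.+1%:R by field; rewrite gt_eqF.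
  rewrite normrM (@ger0_norm _ k.+1%:R^-1) ?invr_ge0// ler_piMl ?invr_ge0//.
  by rewrite ger0_norm ?subr_ge0// lerBlDr addrC ltW.
exists (b', i, (z, (k, m))) => //; split=> // y Qy.
have yx : norm1 (x - y) <= n%:R * (2 * k.+1%:R^-1).
  apply: norm1_le => j; have := Qx j; have := Qy j; rewrite !mxE /= => h1 h2.
  have -> : x 0 j - y 0 j =
    (x 0 j - (z j)%:~R / k.+1%:R) - (y 0 j - (z j)%:~R / k.+1%:R) by ring.
  by apply: le_trans (ler_normB _ _) _; rewrite mulr_natl mulr2n; exact: lerD.
have k1 : k.+1%:R^-1 <= 1 :> R by rewrite invf_le1// ler1n.
have yx2 : norm1 (x - y) <= n%:R * 2.
  by apply: le_trans yx _; rewrite ler_wpM2l// ler_piMr.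
have hx : norm1 x <= norm1 x + n%:R * 2 by rewrite lerDl mulr_ge0.
have hy : norm1 y <= norm1 x + n%:R * 2.
  have := norm1_dist x y; rewrite distrC => /(le_trans (ler_norm _)).
  rewrite lerBlDl => h; apply: le_trans h _; rewrite lerD2l//.
have := hL x y hx hy => h.
rewrite /P /= -/g; apply: le_trans mc _.
have := le_trans h (le_trans (ler_wpM2l L0 yx) kc).
have := lerB_dist (expsum g x) (expsum g y).
by rewrite /c; lra.
Qed.

(** A class closed under sums and products that contains the conditionals; as the denominator is
    positive, the zeros are those of a single exponential sum. *)
Definition expquot (f : 'rV[R]_n -> R) :=
  exists l m, forall x, 0 < expsum m x /\ f x = expsum l x / expsum m x.

Lemma expsumD l m x : expsum (l ++ m) x = expsum l x + expsum m x.
Proof. exact: big_cat. Qed.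

Lemma expsumM l m x :
  expsum [seq (p.1 * q.1, p.2 + q.2) | p <- l, q <- m] x = expsum l x * expsum m x.
Proof.
rewrite /expsum big_allpairs_dep mulr_suml; apply: eq_bigr => p _.
rewrite mulr_sumr; apply: eq_bigr => q _ /=; rewrite dotvDr expRD; ring.
Qed.

Lemma expsum_cst c x : expsum [:: (c, 0)] x = c.
Proof. by rewrite /expsum big_seq1 dotvC dotv0l expR0 mulr1. Qed.

Lemma expquot_ext f g : (forall x, f x = g x) -> expquot f -> expquot g.
Proof. by move=> /funext->. Qed.

Lemma expquot_cst c : expquot (fun=> c).
Proof.
by exists [:: (c, 0)], [:: (1, 0)] => x; rewrite !expsum_cst divr1 ltr01.
Qed.

Lemma expquotD f g : expquot f -> expquot g -> expquot (fun x => f x + g x).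
Proof.
move=> [l [m hf]] [l' [m' hg]].
exists ([seq (p.1 * q.1, p.2 + q.2) | p <- l, q <- m'] ++
        [seq (p.1 * q.1, p.2 + q.2) | p <- l', q <- m]).
exists [seq (p.1 * q.1, p.2 + q.2) | p <- m, q <- m'] => x.
have [m0 ->] := hf x; have [m'0 ->] := hg x.
rewrite expsumD !expsumM mulr_gt0//; split=> //.
by field; rewrite !gt_eqF.
Qed.

Lemma expquotM f g : expquot f -> expquot g -> expquot (fun x => f x * g x).
Proof.
move=> [l [m hf]] [l' [m' hg]].
exists [seq (p.1 * q.1, p.2 + q.2) | p <- l, q <- l'].
exists [seq (p.1 * q.1, p.2 + q.2) | p <- m, q <- m'] => x.
have [m0 ->] := hf x; have [m'0 ->] := hg x.
rewrite !expsumM mulr_gt0//; split=> //.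
by field; rewrite !gt_eqF.
Qed.

Lemma expquot_sum (I : Type) (r : seq I) (P : pred I) (F : I -> 'rV[R]_n -> R) :
  (forall i, expquot (F i)) -> expquot (fun x => \sum_(i <- r | P i) F i x).
Proof.
move=> h; elim: r => [|i r IH].
  by apply: expquot_ext (expquot_cst 0) => a; rewrite big_nil.
case Pi : (P i); last by apply: expquot_ext IH => a; rewrite big_cons Pi.
by apply: expquot_ext (expquotD (h i) IH) => a; rewrite big_cons Pi.
Qed.

Lemma expquot_zeros_null f x0 : (0 < n)%N -> expquot f -> f x0 != 0 ->
  lebesgue_null [set x | f x = 0].
Proof.
move=> n0 [l [m h]] f0.
apply: (@null_sub _ _ _ [set x | expsum l x = 0]).
  move=> x /=; have [m0 ->] := h x => /eqP.
  by rewrite mulf_eq0 invr_eq0 (gt_eqF m0) orbF => /eqP.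
apply: (@expsum_zeros_null _ x0 n0); have [_ e] := h x0.
by apply: contra f0; rewrite e => /eqP->; rewrite mul0r.
Qed.

End ExponentialSums.

Section RecoveryNull.
Context {R : realType} {V : finType} {T : nat} {d : 'I_T -> nat}.
Context (E : seq_exp_family R V d) (Rec : {set V}) (Q : T.-tuple V -> R).
Context (t : 'I_T).
Local Open Scope classical_set_scope.
Local Open Scope ring_scope.

Lemma expquot_cond (s : seq V) v : expquot (fun x : 'rV_(d t) => cond E x s v).
Proof.
exists [:: (carrier E t s v, stat E t s v)].
exists [seq (carrier E t s w, stat E t s w) | w <- index_enum V] => x.
have -> : expsum [seq (carrier E t s w, stat E t s w) | w <- index_enum V] x =
  partition_fun E s x by rewrite /expsum big_map.
by rewrite partition_fun_gt0 /expsum big_seq1.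
Qed.

Lemma rec_grad_null (x0 : 'rV_(d t)) : rec_grad E Rec Q x0 != 0 ->
  lebesgue_null [set x : 'rV_(d t) | rec_grad E Rec Q x = 0].
Proof.
move=> g0; have [i gi] : exists i, rec_grad E Rec Q x0 0 i != 0.
  apply: contrapT => no; case/eqP: g0; apply/rowP => i; rewrite [RHS]mxE.
  by apply/eqP/negPn/negP => h; apply: no; exists i.
have d0 : (0 < d t)%N by case: (d t) i {gi} => [[]|].
apply: (@null_sub _ _ _ [set x | rec_grad E Rec Q x 0 i = 0]).
  by move=> x /= ->; rewrite mxE.
apply: (expquot_zeros_null d0 _ gi).
apply: (expquot_ext (f := fun x => -1 * \sum_y Q y * \sum_(v in Rec)
  cond E x (take t y) v * dscore E (take t y) x (delta_mx 0 i) v)).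
  by move=> x; rewrite mulN1r -/(rec_dir E Rec Q x _) -dotv_rec_grad dotv_delta.
apply: expquotM (expquot_cst _) _; apply: expquot_sum => y.
apply: expquotM (expquot_cst _) _; apply: expquot_sum => v.
apply: expquotM (expquot_cond _ _) _; apply: expquotD (expquot_cst _) _.
apply: expquot_ext (expquotM (expquot_cst (-1)) (expquot_sum _ _ (fun u =>
  expquotM (expquot_cond (take t y) u) (expquot_cst _)))) => x.
by rewrite mulN1r.
Qed.

End RecoveryNull.

(** * Choice of thresholds and assembly *)

Theorem theorem19 (R : realType) (V : finType) (T : nat) (d : 'I_T -> nat)
    (E : seq_exp_family R V d) (thb : params R d)
    (Harm : T.-tuple V -> R) (Rec : {set V}) (Q : T.-tuple V -> R)
    (gamma : R) (k : nat)
    (hT : (0 < T)%N)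
    (hHarm : forall y, 0 <= Harm y <= 1)
    (hQ : is_dist Q)
    (hgamma : 0 < gamma <= 1)
    (hfisher : forall t, posdef (fisher E thb t))
    (hk : is_harm_horizon E Harm thb k) :
  let H := H_deep E thb Harm Rec Q gamma in
  let G := harm_grad E Harm thb in
  let Gr t := rec_grad E Rec Q (thb t) in
  let J t := rec_info E Rec Q (thb t) in
  let normF t := qform (invmx (fisher E thb t)) in
  (* existence and uniqueness of the minimizer, and the main expansion *)
  (exists eps C : R, 0 < eps /\
     forall lam mu : R, 0 < lam -> 0 <= mu -> lam + mu < eps ->
       (exists! th, is_minimizer (H lam mu) th) /\
       forall th, is_minimizer (H lam mu) th -> forall t,
         `| posKL E thb th t
            - 2^-1 * normF t (lam *: G t + (mu * gamma ^+ t) *: Gr t) |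
         <= C * (lam + mu) ^+ 3)
  /\
  (* (i) beyond the harm horizon *)
  (forall t : 'I_T, (k <= t)%N ->
     [/\ G t = 0,
         exists eps C : R, 0 < eps /\
           forall lam mu : R, 0 < lam -> 0 < mu -> lam + mu < eps ->
           forall th, is_minimizer (H lam mu) th ->
             `| posKL E thb th t
                - mu ^+ 2 * gamma ^+ (2 * t) / 2 * normF t (Gr t) |
             <= C * (mu ^+ 2 * (lam + mu)),
         forall c : R, 0 < c -> exists eps C : R, 0 < eps /\
           forall lam mu : R, 0 < lam -> 0 < mu -> lam + mu < eps ->
           lam <= c * mu ->
           forall th, is_minimizer (H lam mu) th ->
             `| posKL E thb th t
                - mu ^+ 2 * gamma ^+ (2 * t) / 2 * normF t (Gr t) |
             <= C * mu ^+ 3,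
         0 < J t -> Gr t != 0 ->
           0 < normF t (Gr t) /\
           exists eps : R, 0 < eps /\
             forall lam mu : R, 0 < lam -> 0 < mu -> lam + mu < eps ->
             forall th, is_minimizer (H lam mu) th -> 0 < posKL E thb th t
       & (exists x0, rec_grad E Rec Q (t := t) x0 != 0) ->
           lebesgue_null [set x | 0 < rec_info E Rec Q (t := t) x /\
                             rec_grad E Rec Q x = 0]%classic])
  /\
  (* (ii) no recovery penalty *)
  (forall t : 'I_T,
     (exists eps C : R, 0 < eps /\
        forall lam : R, 0 < lam -> lam < eps ->
        forall th, is_minimizer (H lam 0) th ->
          posKL E thb th t
          <= lam ^+ 2 / 2 * harm_info E Harm thb t + C * lam ^+ 3)
     /\
     (0 < harm_info E Harm thb t \/ (k <= t)%N ->
      exists eps C : R, 0 < eps /\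
        forall lam : R, 0 < lam -> lam < eps ->
        forall th, is_minimizer (H lam 0) th ->
          `| posKL E thb th t | <= C * (lam ^+ 2 * harm_info E Harm thb t))).
Proof.
move=> H G Gr J normF.
have hk0 : forall t : 'I_T, (k <= t)%N -> harm_info E Harm thb t = 0 by case: hk.
have /andP[g0 g1] := hgamma.
have hg01 : 0 <= gamma <= 1 by rewrite (ltW g0).
have loc := minimizer_local Rec (@hfisher) hHarm hQ hgamma.
have [rho1 [C1 [/andP[rho1pos _] _ hloc]]] :=
  crit_local Harm Rec Q gamma (@hfisher).
have [rho2 [C2 [/andP[rho2pos rho21] C20 hmain]]] :=
  main_expansion Harm Rec Q gamma (@hfisher).
have [rho3 [C3 [/andP[rho3pos _] C30 htail]]] :=
  tail_expansion Rec Q (@hfisher) hk0 hg01.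
have tailE (t : 'I_T) (lam mu : R) : (k <= t)%N ->
    2^-1 * qform (invmx (fisher E thb t)) (gvec E thb Harm Rec Q gamma lam mu t) =
    mu ^+ 2 * gamma ^+ (2 * t) / 2 * normF t (Gr t).
  move=> kt; rewrite /gvec (harm_grad_horizon hk0)// scaler0 add0r qformZ.
  by rewrite exprMn -exprM [(t * 2)%N]mulnC -[qform _ _]/(normF t (Gr t)); field.
have tail_bound (t : 'I_T) : (k <= t)%N -> exists eps C : R, [/\ 0 < eps, 0 <= C &
    forall lam mu : R, 0 < lam -> 0 < mu -> lam + mu < eps ->
    forall th, is_minimizer (H lam mu) th ->
      `| posKL E thb th t - mu ^+ 2 * gamma ^+ (2 * t) / 2 * normF t (Gr t) |
      <= C * (mu ^+ 2 * (lam + mu))].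
  move=> kt; have [eps eps0 heps] := loc _ rho3pos.
  exists (Num.min eps rho3), C3; split=> //; first by rewrite lt_min eps0 rho3pos.
  move=> lam mu l0 m0; rewrite lt_min => /andP[h1 h2] th thmin.
  have [_ /(_ th thmin)[cth dth]] := heps _ _ (ltW l0) (ltW m0) h1.
  have [_ /(_ t kt)] := htail _ _ (ltW l0) (ltW m0) (ltW h2) th cth dth.
  by rewrite tailE.
have [eps2 eps20 heps2] := loc _ rho2pos.
split; [|split].
- have [eps1 eps10 heps1] := loc _ rho1pos.
  exists (Num.min (Num.min eps1 rho1) (Num.min eps2 rho2)), C2.
  split=> [|lam mu l0 m0]; first by rewrite !lt_min eps10 rho1pos eps20 rho2pos.
  rewrite !lt_min => /andP[/andP[h1 h2] /andP[h3 h4]]; split.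
    have [[th thmin] hall] := heps1 _ _ (ltW l0) m0 h1.
    exists th; split=> // th' thmin'.
    have [huniq _] := hloc _ _ (ltW l0) m0 (ltW h2).
    by have [c d1] := hall _ thmin; have [c' d2] := hall _ thmin'; exact: huniq.
  move=> th thmin t.
  have [_ /(_ th thmin)[cth dth]] := heps2 _ _ (ltW l0) m0 h3.
  exact: hmain (ltW l0) m0 (ltW h4) th cth dth t.
- move=> t kt; have [eps [C [eps0 C0 hC]]] := tail_bound t kt.
  split.
  + exact: (harm_grad_horizon hk0).
  + by exists eps, C.
  + move=> c c0; exists eps, (C * (c + 1)); split=> // lam mu l0 m0 lm lc th thmin.
    apply: le_trans (hC _ _ l0 m0 lm th thmin) _.
    have -> : C * (c + 1) * mu ^+ 3 = C * (mu ^+ 2 * ((c + 1) * mu)) by ring.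
    by rewrite ler_wpM2l// ler_wpM2l ?sqr_ge0// mulrDl mul1r lerD2r.
  + move=> _ Gr0; have N0 : 0 < normF t (Gr t).
      exact: (qform_invmx_gt0 (@hfisher t) Gr0).
    split=> //; pose K := gamma ^+ (2 * t) / 2 * normF t (Gr t).
    have K0 : 0 < K by rewrite mulr_gt0// divr_gt0// exprn_gt0.
    (* Below this threshold the error [C * (lam + mu)] stays under the leading coefficient [K], both
       being multiplied by [mu ^+ 2]. *)
    exists (Num.min eps (K / (C + 1))); split=> [|lam mu l0 m0].
      by rewrite lt_min eps0 divr_gt0// ltr_wpDl.
    rewrite lt_min => /andP[h1 h2] th thmin.
    have := hC _ _ l0 m0 h1 th thmin.
    rewrite ltr_pdivlMr ?ltr_wpDl// in h2.
    have -> : mu ^+ 2 * gamma ^+ (2 * t) / 2 * normF t (Gr t) = mu ^+ 2 * K.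
      by rewrite /K; ring.
    rewrite ler_norml => /andP[+ _].
    rewrite lerBrDr => h; apply: lt_le_trans h.
    have -> : - (C * (mu ^+ 2 * (lam + mu))) + mu ^+ 2 * K =
      mu ^+ 2 * (K - C * (lam + mu)) by ring.
    rewrite mulr_gt0 ?exprn_gt0// subr_gt0; apply: le_lt_trans h2.
    by rewrite mulrC ler_wpM2l ?addr_ge0 ?ltW// ?ltrDl.
  + move=> [x0 hx0]; apply: null_sub (rec_grad_null hx0) => x [].
    by [].
- move=> t; have gE lam : gvec E thb Harm Rec Q gamma lam 0 t = lam *: G t.
    by rewrite /gvec mul0r scale0r addr0.
  have bound : exists eps C : R, [/\ 0 < eps, eps <= 1, 0 <= C &
      forall lam : R, 0 < lam -> lam < eps -> forall th, is_minimizer (H lam 0) th ->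
      posKL E thb th t <= lam ^+ 2 / 2 * harm_info E Harm thb t + C * lam ^+ 3].
    exists (Num.min eps2 rho2), C2; split=> //.
    + by rewrite lt_min eps20 rho2pos.
    + by rewrite ge_min rho21 orbT.
    move=> lam l0; rewrite lt_min => /andP[h1 h2] th thmin.
    have lam0 : lam + 0 = lam by rewrite addr0.
    have h1' : lam + 0 < eps2 by rewrite lam0.
    have h2' : lam + 0 <= rho2 by rewrite lam0 ltW.
    have [_ /(_ th thmin)[cth dth]] := heps2 _ _ (ltW l0) (lexx 0) h1'.
    have := hmain _ _ (ltW l0) (lexx 0) h2' th cth dth t.
    rewrite lam0 gE qformZ => /(le_trans (ler_norm _)); rewrite lerBlDl => h.
    apply: le_trans h _; rewrite lerD2r mulrCA mulrA.
    by rewrite ler_wpM2l ?harm_grad_le_info// divr_ge0// sqr_ge0.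
  have [eps [C [eps0 eps1 C0 hC]]] := bound.
  split; first by exists eps, C.
  set I := harm_info E Harm thb t in hC *.
  case=> [I0|kt].
    (* For fixed positive [I] the cubic term is absorbed using [lam <= 1], at the price of the
       factor [C / I]. *)
    exists eps, (2^-1 + C / I); split=> // lam l0 h1 th thmin.
    rewrite ger0_norm ?posKL_ge0//; apply: le_trans (hC lam l0 h1 th thmin) _.
    have -> : (2^-1 + C / I) * (lam ^+ 2 * I) = lam ^+ 2 / 2 * I + C * lam ^+ 2.
      by field; rewrite gt_eqF.
    rewrite lerD2l ler_wpM2l// exprSr ler_piMr ?sqr_ge0//.
    by rewrite ltW// (lt_le_trans h1).
  have [eps3 eps30 heps3] := loc _ rho3pos.
  (* With [mu = 0] the tail estimate forces [th t = thb t], so the divergence is exactly 0 and the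
     constant 0 works. *)
  exists (Num.min eps3 rho3), 0; split; first by rewrite lt_min eps30 rho3pos.
  move=> lam l0; rewrite lt_min => /andP[h1 h2] th thmin.
  have lam0 : lam + 0 = lam by rewrite addr0.
  have h1' : lam + 0 < eps3 by rewrite lam0.
  have h2' : lam + 0 <= rho3 by rewrite lam0 ltW.
  have [_ /(_ th thmin)[cth dth]] := heps3 _ _ (ltW l0) (lexx 0) h1'.
  have [+ _] := htail _ _ (ltW l0) (lexx 0) h2' th cth dth.
  rewrite mulr0 => /(le_trans (tail_dst_pos thb th kt))/norm1_eq0/eqP.
  rewrite subr_eq0 => /eqP e.
  rewrite mul0r normr_le0 /posKL /expect big1// => y _.
  by rewrite e -/(rel_ent E (take t y) (thb t) (thb t)) rel_ent_id mulr0.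
Qed.
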